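(* Let $a,t\in\mathbb{C}$ with $\operatorname{Re} a>0$ and $|t|<\operatorname{Re} a$, and let $m\ge 0$ be an integer. Then $$\int_0^t s^m\log\Gamma(a+s)\,ds=-\gamma\,\frac{t^{m+2}}{m+2}+\Bigl[\log\sqrt{2\pi}-\gamma\bigl(a-\tfrac12\bigr)\Bigr]\frac{t^{m+1}}{m+1}+\sum_{k=0}^{m}\frac{(-1)^k}{k+1}\binom{m}{k}\,t^{m-k}\,g(k+1,a+t)-\frac{(-1)^m}{m+1}\,g(m+1,a).$$
   Context: $\log\Gamma$ denotes the analytic branch on $\operatorname{Re} s>0$ that is real on the positive reals; the integral is along the segment from $0$ to $t$. For $\operatorname{Re} a>0$, $\zeta(s,a)$ is the Hurwitz zeta function: $\zeta(s,a)=\sum_{n=0}^\infty (n+a)^{-s}$ for $\operatorname{Re} s>1$ (principal powers), extended analytically in $s$ to $\mathbb{C}\setminus\{1\}$; $\zeta'(s,a)=\partial_s\zeta(s,a)$. $\psi=\Gamma'/\Gamma$ is the digamma function and $\gamma=-\psi(1)$ is Euler's constant. For integers $n\ge 0$ and $\operatorname{Re} a>0$, $$g(n,a)=\zeta'(-n,a)+\psi(n+1)\,\zeta(-n,a).$$ The convention $t^0=1$ (also for $t=0$) is used. *)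

(* Defs.v *)
(* Stdlib reals with Coquelicot; complex numbers are Coquelicot's [C]. *)
From Stdlib Require Import Reals.
From Coquelicot Require Import Coquelicot.
Open Scope R_scope.

Definition Cexp (z : C) : C :=
  (exp (Re z) * cos (Im z), exp (Re z) * sin (Im z)).

(* Principal argument, with values in (-PI, PI]; meaningless at 0. *)
Definition Carg (z : C) : R :=
  if Rle_dec 0 (Im z) then acos (Re z / Cmod z) else - acos (Re z / Cmod z).

Definition Clog (z : C) : C := (ln (Cmod z), Carg z).

(* Principal power [w ^ s], for [w <> 0]. *)
Definition Cpower (w s : C) : C := Cexp (s * Clog w)%C.

Definition C_analytic_at (f : C -> C) (z0 : C) : Prop :=
  exists (c : nat -> C) (r : R), 0 < r /\
    forall z : C, Cmod (z - z0)%C < r ->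
      is_pseries (K := C_AbsRing) (V := C_NormedModule) c (z - z0)%C (f z).

(* [v] is the integral of [f] along the segment from [z0] to [z1]. *)
Definition is_CInt_segment (f : C -> C) (z0 z1 v : C) : Prop :=
  is_RInt (V := C_R_NormedModule)
    (fun u : R => (f (z0 + RtoC u * (z1 - z0)) * (z1 - z0))%C) 0 1 v.

(* Euler's integral; this is the Gamma function for [0 < Re s]. *)
Definition CGamma (s : C) : C :=
  RInt_gen (V := C_R_CompleteNormedModule)
    (fun x : R => (Cpower (RtoC x) (s - 1) * RtoC (exp (- x)))%C)
    (at_right 0) (Rbar_locally p_infty).

Definition digamma (z : C) : C := (C_derive CGamma z / CGamma z)%C.

Definition Euler_gamma : C := (- digamma 1)%C.

(* This determines [L] on the half-plane [0 < Re s]; other values are free. *)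
Definition is_log_Gamma (L : C -> C) : Prop :=
  (forall s : C, 0 < Re s -> C_analytic_at L s) /\
  (forall s : C, 0 < Re s -> Cexp (L s) = CGamma s) /\
  (forall x : R, 0 < x -> Im (L (RtoC x)) = 0).

(* By uniqueness of analytic continuation, this determines [zeta s a] for
   [0 < Re a] and [s <> 1]; other values are free. *)
Definition is_Hurwitz_zeta (zeta : C -> C -> C) : Prop :=
  forall a : C, 0 < Re a ->
    (forall s : C, 1 < Re s ->
       is_series (K := C_AbsRing) (V := C_NormedModule)
         (fun n : nat => Cpower (RtoC (INR n) + a)%C (- s)%C) (zeta s a)) /\
    (forall s : C, s <> RtoC 1 -> C_analytic_at (fun w : C => zeta w a) s).

Definition g (zeta : C -> C -> C) (n : nat) (a : C) : C :=
  (C_derive (fun s : C => zeta s a) (- RtoC (INR n))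
   + digamma (RtoC (INR n) + 1) * zeta (- RtoC (INR n)) a)%C.

(* Main.v *)
(* Write [zeta s a = Y s a + a^(1-s) / (s - 1)].  The recursion expressing [Y s] by integrals of
   [Y (s + 1)] continues [Y] to the left with power series coefficients in [s] that are controlled
   uniformly in [a], and the identity theorem extends
   [Y s (a + h) - Y s a = - s h int_0^1 Y (s + 1) (a + u h) du] from a right half-plane to all [s].
   Expanding this at [s = -n] and using [digamma (n + 1) = digamma n + 1 / n] gives
   [d/da g n a = n * g (n - 1) a].

   Lerch's formula [log Gamma a = zeta' 0 a + log (sqrt (2 PI))] provides the starting point
   [log Gamma a = g 0 a + log (sqrt (2 PI)) - gamma (a - 1/2)]: on [1, 2] the difference of the two
   sides is constant, by the Bohr-Mollerup argument (Wendel's inequality for the Euler integral, and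
   the decay of [Y 1] for [zeta' 0]); analyticity in [a] extends this to the half-plane, and Wallis'
   product gives the constant.  Repeated integration by parts then yields an explicit antiderivative
   of [s^m * log Gamma (a + s)]. *)
Require Import Defs.
From Stdlib Require Import Reals Lra Lia Factorial Arith ClassicalEpsilon.
From Coquelicot Require Import Coquelicot.
Open Scope R_scope.

(** The hypothesis on [zeta] is pointwise in a: for each a it gives the series and the analyticity
    in s, but no regularity in a outside the region of convergence. Integrability, Lipschitz
    dependence and derivatives in a have to be rebuilt from the series and carried through the
    continuation; hence the families of power series with bounds uniform on boxes. Subtracting
    a^(1-s) / (s - 1) removes the only pole, so the identities for Y also hold at s = 0, where they
    involve the value at 1. That value is log a - digamma a, and it links the zeta side to Gamma. No
    global Y is formed: for a given m finitely many steps to the left suffice, and the abscissa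
    reached is a parameter of [entire_part]. Likewise [CGamma] is evaluated only at real arguments p
    >= 1. Its complex derivative, hence [digamma], is obtained from Lerch's formula through the
    exponential of log Gamma, not by differentiating the improper integral. *)

(** * Moduli and real parts *)

Lemma Ceq (x y : C) : Re x = Re y -> Im x = Im y -> x = y.
Proof. destruct x, y; simpl; intros -> ->; reflexivity. Qed.

Lemma im_le_Cmod (c : C) : Rabs (Im c) <= Cmod c.
Proof. apply Rle_trans with (2 := Rmax_Cmod c). apply Rmax_r. Qed.

Lemma Cmod_tri3 (x y : C) : Cmod (x - y) <= Cmod x + Cmod y.
Proof. replace (x - y)%C with (x + - y)%C by ring. rewrite <- (Cmod_opp y). apply Cmod_triangle.
Qed.

Lemma Cmod_sub_sym (x y : C) : Cmod (x - y) = Cmod (y - x).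
Proof. rewrite <- Cmod_opp. f_equal. ring. Qed.

Lemma Cmod_dist_tri (x y z : C) : Cmod (x - z) <= Cmod (x - y) + Cmod (y - z).
Proof. replace (x - z)%C with ((x - y) + (y - z))%C by ring. apply Cmod_triangle. Qed.

Lemma Cmod_tri_rev (x y : C) : Cmod x - Cmod y <= Cmod (x + y).
Proof.
assert (H := Cmod_triangle (x + y) (- y)). rewrite Cmod_opp in H.
replace (x + y + - y)%C with x in H by ring. lra.
Qed.

Lemma Cadd_sub (x y : C) : (x + (y - x))%C = y.
Proof. ring. Qed.

Lemma Re_add (x y : C) : Re (x + y)%C = Re x + Re y.
Proof. reflexivity. Qed.
Lemma Im_add (x y : C) : Im (x + y)%C = Im x + Im y.
Proof. reflexivity. Qed.
Lemma Re_sub (x y : C) : Re (x - y)%C = Re x - Re y.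
Proof. reflexivity. Qed.
Lemma Re_opp (x : C) : Re (- x)%C = - Re x.
Proof. reflexivity. Qed.
Lemma Re_RtoC (x : R) : Re (RtoC x) = x.
Proof. reflexivity. Qed.
Lemma Im_RtoC (x : R) : Im (RtoC x) = 0.
Proof. reflexivity. Qed.
Lemma Re_Rmul (x : R) (z : C) : Re (RtoC x * z)%C = x * Re z.
Proof. destruct z; simpl; ring. Qed.

Lemma Cpos_neq0 (z : C) : 0 < Re z -> z <> 0.
Proof. intros H E; rewrite E in H; simpl in H; lra. Qed.

Lemma Re_le_Cmod (z : C) : Re z <= Cmod z.
Proof. apply Rle_trans with (2 := re_le_Cmod z). apply Rle_abs. Qed.

Lemma lt_div_mul_l (x e k : R) : 0 < k -> x < e / k -> k * x < e.
Proof.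
intros Hk H. apply Rmult_lt_compat_l with (r := k) in H; [|exact Hk].
replace (k * (e / k)) with e in H by (field; lra). exact H.
Qed.

Lemma lt_div_mul_r (x e k : R) : 0 < k -> x < e / k -> x * k < e.
Proof. intros Hk H. rewrite Rmult_comm. apply lt_div_mul_l; assumption. Qed.

Lemma Cmod_ratio (h : C) (r : R) : Cmod h < r -> 0 <= Cmod h / r < 1.
Proof.
intros H. assert (H0 := Cmod_ge_0 h).
split; [apply Rmult_le_pos; [exact H0|apply Rlt_le, Rinv_0_lt_compat; lra]|].
apply Rmult_lt_reg_r with r; [lra|]. unfold Rdiv. rewrite Rmult_assoc, Rinv_l; lra.
Qed.

Lemma Cmod_ratio_half (h : C) (r : R) : Cmod h < r / 2 -> 0 <= Cmod h / r < / 2.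
Proof.
intros H. assert (H0 := Cmod_ge_0 h).
split; [apply Rmult_le_pos; [exact H0|apply Rlt_le, Rinv_0_lt_compat; lra]|].
apply Rmult_lt_reg_r with r; [lra|]. unfold Rdiv. rewrite Rmult_assoc, Rinv_l; lra.
Qed.

(** * Complex derivatives *)

Definition cder (f : C -> C) (z l : C) : Prop :=
  is_derive (K := C_AbsRing) (V := C_NormedModule) f z l.

Lemma cder_eps (f : C -> C) (z l : C) :
  cder f z l <->
  (forall eps, 0 < eps -> exists d, 0 < d /\ forall h, Cmod h < d ->
     Cmod (f (z + h) - f z - h * l)%C <= eps * Cmod h).
Proof.
split.
- intros [_ H] eps He.
  specialize (H z (fun P HP => HP) (mkposreal eps He)).
  destruct H as [d Hd].
  exists d; split; [apply cond_pos|].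
  intros h Hh.
  specialize (Hd (z + h)%C).
  assert (Hb : ball (M := AbsRing_UniformSpace C_AbsRing) z d (z + h)%C).
  { change (Cmod ((z + h) - z)%C < d).
    replace (z + h - z)%C with h by ring. exact Hh. }
  specialize (Hd Hb).
  change (Cmod ((f (z + h) - f z) - ((z + h) - z) * l)%C <= eps * Cmod ((z + h) - z)%C) in Hd.
  replace (z + h - z)%C with h in Hd by ring. exact Hd.
- intros H. split.
  + apply (is_linear_scal_l (K := C_AbsRing) (V := C_NormedModule) l).
  + intros y Hy.
    apply (is_filter_lim_locally_unique (K := C_AbsRing) (V :=
      AbsRing_NormedModule C_AbsRing)) in Hy.
    subst y. intros eps. destruct (H eps (cond_pos eps)) as (d & Hd & HH).
    exists (mkposreal d Hd). intros y Hy.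
    change (Cmod (y - z)%C < d) in Hy.
    change (Cmod ((f y - f z) - (y - z) * l)%C <= eps * Cmod (y - z)%C).
    specialize (HH (y - z)%C Hy).
    rewrite Cadd_sub in HH. exact HH.
Qed.

(** The product and chain rules use the normed module that C is over itself, [C_derive] uses
    [C_NormedModule]. These are different structures with convertible norms, so the differential
    estimate passes from one to the other unchanged. *)
Lemma cder_AbsRing (f : C -> C) (z l : C) :
  cder f z l <-> is_derive (K := C_AbsRing) (V := AbsRing_NormedModule C_AbsRing) f z l.
Proof.
split; intros [_ H]; split; try exact H.
- apply (is_linear_scal_l (K := C_AbsRing) (V := AbsRing_NormedModule C_AbsRing) l).
- apply (is_linear_scal_l (K := C_AbsRing) (V := C_NormedModule) l).
Qed.

Lemma cder_C_derive (f : C -> C) (z l : C) : cder f z l -> C_derive f z = l.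
Proof.
intros H. apply is_C_derive_unique. exact H.
Qed.

Lemma cder_ext_loc (f g : C -> C) (z l : C) (d : R) : 0 < d ->
  (forall y, Cmod (y - z) < d -> f y = g y) -> cder f z l -> cder g z l.
Proof.
intros Hd E H. apply cder_eps. intros eps He.
destruct (proj1 (cder_eps _ _ _) H eps He) as (d1 & Hd1 & H1).
exists (Rmin d d1). split; [apply Rmin_pos; assumption|].
intros h Hh. rewrite <- !E.
- apply H1. apply Rlt_le_trans with (1 := Hh). apply Rmin_r.
- replace (z - z)%C with (RtoC 0) by ring. rewrite Cmod_0; exact Hd.
- replace (z + h - z)%C with h by ring. apply Rlt_le_trans with (1 := Hh). apply Rmin_l.
Qed.

Lemma cder_ext (f g : C -> C) (z l : C) :
  (forall y, f y = g y) -> cder f z l -> cder g z l.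
Proof. intros E. apply cder_ext_loc with 1; [lra| intros; apply E]. Qed.

Lemma cder_const (k z : C) : cder (fun _ => k) z 0.
Proof. apply (is_derive_const (K := C_AbsRing) (V := C_NormedModule)). Qed.

Lemma cder_id (z : C) : cder (fun y => y) z 1.
Proof.
apply cder_eps. intros eps He. exists 1; split; [lra|]. intros h _.
replace (z + h - z - h * 1)%C with (RtoC 0) by ring. rewrite Cmod_0.
apply Rmult_le_pos; [lra|apply Cmod_ge_0].
Qed.

Lemma cder_plus (f g : C -> C) (z lf lg : C) :
  cder f z lf -> cder g z lg -> cder (fun y => f y + g y)%C z (lf + lg)%C.
Proof. apply (is_derive_plus (K := C_AbsRing) (V := C_NormedModule)). Qed.

Lemma cder_opp (f : C -> C) (z lf : C) :
  cder f z lf -> cder (fun y => - f y)%C z (- lf)%C.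
Proof. apply (is_derive_opp (K := C_AbsRing) (V := C_NormedModule)). Qed.

Lemma cder_minus (f g : C -> C) (z lf lg : C) :
  cder f z lf -> cder g z lg -> cder (fun y => f y - g y)%C z (lf - lg)%C.
Proof. intros; apply cder_plus; [|apply cder_opp]; assumption. Qed.

Lemma cder_mult (f g : C -> C) (z lf lg : C) :
  cder f z lf -> cder g z lg -> cder (fun y => f y * g y)%C z (lf * g z + f z * lg)%C.
Proof.
intros Hf Hg. apply cder_AbsRing.
apply (is_derive_mult (K := C_AbsRing)); [apply cder_AbsRing, Hf|apply cder_AbsRing, Hg|].
exact Cmult_comm.
Qed.

Lemma cder_comp (f g : C -> C) (z lf lg : C) :
  cder f (g z) lf -> cder g z lg -> cder (fun y => f (g y)) z (lg * lf)%C.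
Proof.
intros Hf Hg. apply (is_derive_comp (K := C_AbsRing) (V := C_NormedModule)); [exact Hf|].
apply cder_AbsRing, Hg.
Qed.

Lemma cder_scal (k : C) (f : C -> C) (z l : C) : cder f z l -> cder (fun y =>
  k * f y)%C z (k * l)%C.
Proof.
intros H. assert (H1 := cder_mult (fun _ => k) f z 0 l (cder_const k z) H).
replace (k * l)%C with (0 * f z + k * l)%C by ring. exact H1.
Qed.

Lemma cder_eq (f : C -> C) (z l l' : C) : cder f z l -> l = l' -> cder f z l'.
Proof. intros H <-; exact H. Qed.

Definition ccont (f : C -> C) (z : C) : Prop :=
  forall eps, 0 < eps -> exists d, 0 < d /\ forall h, Cmod h < d -> Cmod (f (z + h) - f z)%C < eps.

Lemma cder_ccont (f : C -> C) (z l : C) : cder f z l -> ccont f z.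
Proof.
intros H eps He.
destruct (proj1 (cder_eps _ _ _) H 1 Rlt_0_1) as (d & Hd & HH).
assert (Hp : 0 < 2 + Cmod l) by (generalize (Cmod_ge_0 l); lra).
exists (Rmin d (eps / (2 + Cmod l))).
assert (Hq : 0 < eps / (2 + Cmod l)) by (apply Rdiv_lt_0_compat; lra).
split; [apply Rmin_pos; assumption|].
intros h Hh.
assert (h1 : Cmod h < d) by (apply Rlt_le_trans with (1 := Hh), Rmin_l).
assert (h2 : Cmod h < eps / (2 + Cmod l)) by (apply Rlt_le_trans with (1 := Hh), Rmin_r).
specialize (HH h h1).
replace (f (z + h) - f z)%C with ((f (z + h) - f z - h * l) + h * l)%C by ring.
apply Rle_lt_trans with (1 := Cmod_triangle _ _).
rewrite Cmod_mult.
apply Rle_lt_trans with (Cmod h * (2 + Cmod l)); [generalize (Cmod_ge_0 h); nra|].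
apply Rmult_lt_reg_r with (/ (2 + Cmod l)); [apply Rinv_0_lt_compat; lra|].
rewrite Rmult_assoc, Rinv_r by lra. unfold Rdiv in h2. lra.
Qed.

Lemma cder_inv (z : C) : z <> 0 -> cder (fun y => / y)%C z (- (/ z) * (/ z))%C.
Proof.
intros Hz. apply cder_eps. intros eps He.
assert (Hm : 0 < Cmod z) by (apply Cmod_gt_0; exact Hz).
(* The remainder is h^2 / ((z + h) z^2). As |z + h| > |z| / 2, it is at most 2 |h|^2 / |z|^3, and
   |h| < q turns this into eps |h|. *)
set (q := eps * (Cmod z) ^ 3 / 2).
assert (Hq : 0 < q).
{ unfold q. apply Rdiv_lt_0_compat; [|lra]. apply Rmult_lt_0_compat; [lra|apply pow_lt; lra]. }
exists (Rmin (Cmod z / 2) q). split; [apply Rmin_pos; lra|].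
intros h Hh.
assert (h1 : Cmod h < Cmod z / 2) by (apply Rlt_le_trans with (1 := Hh), Rmin_l).
assert (h2 : Cmod h < q) by (apply Rlt_le_trans with (1 := Hh), Rmin_r).
assert (h3 : Cmod z / 2 < Cmod (z + h)) by (generalize (Cmod_tri_rev z h); lra).
assert (Hzh : (z + h)%C <> 0) by (apply Cmod_gt_0; lra).
replace (/ (z + h) - / z - h * (- / z * / z))%C with (h * h * (/ (z + h) * / z * / z))%C
  by (field; auto).
rewrite !Cmod_mult, !Cmod_inv by assumption.
replace (eps * Cmod h) with (Cmod h * eps) by ring.
rewrite Rmult_assoc. apply Rmult_le_compat_l; [apply Cmod_ge_0|].
apply Rle_trans with (q * (/ (Cmod z / 2) * / Cmod z * / Cmod z)).
- apply Rmult_le_compat; [apply Cmod_ge_0| |lra|].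
  + repeat apply Rmult_le_pos; apply Rlt_le, Rinv_0_lt_compat; lra.
  + apply Rmult_le_compat_r; [apply Rlt_le, Rinv_0_lt_compat; lra|].
    apply Rmult_le_compat_r; [apply Rlt_le, Rinv_0_lt_compat; lra|].
    apply Rinv_le_contravar; lra.
- right. unfold q. field. lra.
Qed.

Lemma cder_pow (n : nat) (z : C) : cder (fun y => y ^ (S n))%C z (RtoC (INR (S n)) * z ^ n)%C.
Proof.
induction n as [|n IH].
- apply cder_ext with (fun y => y); [intros; simpl; ring|].
  apply cder_eq with (1 := cder_id z). simpl. ring.
- apply cder_ext with (fun y => y * y ^ S n)%C; [intros; reflexivity|].
  apply cder_eq with (1 := cder_mult _ _ _ _ _ (cder_id z) IH).
  rewrite (S_INR (S n)), RtoC_plus. cbn [Cpow]. ring.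
Qed.

(** * Integrals over the unit interval *)

Definition cint (f : R -> C) (v : C) : Prop := is_RInt (V := C_R_NormedModule) f 0 1 v.

Lemma cint_components (f : R -> C) (v : C) :
  cint f v <-> is_RInt (fun u => Re (f u)) 0 1 (Re v) /\ is_RInt (fun u => Im (f u)) 0 1 (Im v).
Proof.
split.
- intros H. split.
  + apply (is_RInt_fct_extend_fst (U := R_NormedModule) (V := R_NormedModule) f 0 1 v H).
  + apply (is_RInt_fct_extend_snd (U := R_NormedModule) (V := R_NormedModule) f 0 1 v H).
- intros [H1 H2]. destruct v as [x y].
  apply (is_RInt_fct_extend_pair (U := R_NormedModule) (V := R_NormedModule) f 0 1 x y H1 H2).
Qed.

Lemma cint_ext (f g : R -> C) (v : C) :
  (forall u, 0 <= u <= 1 -> f u = g u) -> cint f v -> cint g v.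
Proof.
intros E. apply is_RInt_ext. intros x. rewrite Rmin_left, Rmax_right by lra. intros; apply E; lra.
Qed.

Lemma cint_unique (f : R -> C) (v w : C) : cint f v -> cint f w -> v = w.
Proof.
intros H1 H2. apply cint_components in H1, H2. apply Ceq.
- transitivity (RInt (fun u => Re (f u)) 0 1); [symmetry|]; apply is_RInt_unique;
    [apply H1|apply H2].
- transitivity (RInt (fun u => Im (f u)) 0 1); [symmetry|]; apply is_RInt_unique;
    [apply H1|apply H2].
Qed.

Lemma cint_plus (f g : R -> C) (v w : C) : cint f v -> cint g w -> cint (fun u =>
  f u + g u)%C (v + w)%C.
Proof. apply (is_RInt_plus (V := C_R_NormedModule)). Qed.

Lemma cint_minus (f g : R -> C) (v w : C) : cint f v -> cint g w -> cint (fun u =>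
  f u - g u)%C (v - w)%C.
Proof. apply (is_RInt_minus (V := C_R_NormedModule)). Qed.

Lemma cint_scal (k : C) (f : R -> C) (v : C) : cint f v -> cint (fun u => k * f u)%C (k * v)%C.
Proof.
intros H. apply cint_components in H. destruct H as [H1 H2].
apply cint_components. split.
- apply (is_RInt_ext (fun u => minus (scal (Re k) (Re (f u))) (scal (Im k) (Im (f u))))).
  + intros; reflexivity.
  + apply (is_RInt_minus (V := R_NormedModule)); apply (is_RInt_scal (V := R_NormedModule));
      assumption.
- apply (is_RInt_ext (fun u => plus (scal (Re k) (Im (f u))) (scal (Im k) (Re (f u))))).
  + intros; reflexivity.
  + apply (is_RInt_plus (V := R_NormedModule)); apply (is_RInt_scal (V := R_NormedModule));
      assumption.
Qed.

Lemma cint_const (k : C) : cint (fun _ => k) k.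
Proof.
assert (H := is_RInt_const (V := C_R_NormedModule) 0 1 k).
rewrite Rminus_0_r, (scal_one (V := C_R_NormedModule)) in H. exact H.
Qed.

Lemma Cmod_norm_R (z : C) : norm (V := C_R_NormedModule) z = Cmod z.
Proof. unfold norm; simpl. unfold prod_norm, Cmod. simpl. f_equal. unfold norm, abs; simpl.
  rewrite !Rmult_1_r, <- !Rabs_mult. rewrite !Rabs_pos_eq; auto; nra. Qed.

Lemma cint_bound (f : R -> C) (v : C) (g : R -> R) (D : R) : cint f v ->
  (forall u, 0 <= u <= 1 -> Cmod (f u) <= g u) -> is_RInt g 0 1 D -> Cmod v <= D.
Proof.
intros H B I. rewrite <- Cmod_norm_R.
apply (norm_RInt_le (V := C_R_NormedModule) f g 0 1 v D); auto; [lra|].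
intros. rewrite Cmod_norm_R. apply B; assumption.
Qed.

Lemma cint_bound_const (f : R -> C) (v : C) (D : R) : cint f v ->
  (forall u, 0 <= u <= 1 -> Cmod (f u) <= D) -> Cmod v <= D.
Proof.
intros H B. apply cint_bound with (f := f) (g := fun _ => D); auto.
assert (HD := is_RInt_const (V := R_NormedModule) 0 1 D).
rewrite Rminus_0_r, (scal_one (V := R_NormedModule)) in HD. exact HD.
Qed.

Definition CInt (f : R -> C) : C := (RInt (fun u => Re (f u)) 0 1, RInt (fun u => Im (f u)) 0 1).

Lemma cint_CInt (f : R -> C) (v : C) : cint f v -> CInt f = v.
Proof.
intros H. apply cint_components in H. destruct H.
apply Ceq; apply is_RInt_unique; assumption.
Qed.

Lemma ex_cint (f : R -> C) :
  (forall u, 0 <= u <= 1 -> continuous (U := C_R_NormedModule) f u) -> cint f (CInt f).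
Proof.
intros H.
destruct (ex_RInt_continuous (V := C_R_CompleteNormedModule) f 0 1) as [v Hv].
{ intros z; rewrite Rmin_left, Rmax_right by lra. apply H. }
rewrite (cint_CInt f v Hv). exact Hv.
Qed.

Lemma continuous_eps (f : R -> C) (x : R) :
  (forall eps, 0 < eps -> exists d, 0 < d /\ forall y, Rabs (y - x) < d ->
    Cmod (f y - f x)%C < eps) ->
  continuous (U := C_R_NormedModule) f x.
Proof.
intros H P [e He]. 
destruct (H e (cond_pos e)) as (d & Hd & HH).
exists (mkposreal d Hd). intros y Hy. apply He. 
specialize (HH y Hy).
split.
- apply Rle_lt_trans with (2 := HH). apply Rle_trans with (2 := re_le_Cmod _). right; reflexivity.
- apply Rle_lt_trans with (2 := HH). apply Rle_trans with (2 := im_le_Cmod _). right; reflexivity.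
Qed.

Lemma continuous_lip (f : R -> C) (x K : R) :
  (forall y, Cmod (f y - f x)%C <= K * Rabs (y - x)) -> continuous (U := C_R_NormedModule) f x.
Proof.
intros H. apply continuous_eps. intros eps He.
assert (HK : 0 < Rabs K + 1) by (generalize (Rabs_pos K); lra).
exists (eps / (Rabs K + 1)). split; [apply Rdiv_lt_0_compat; lra|].
intros y Hy. apply Rle_lt_trans with (1 := H y).
apply Rle_lt_trans with ((Rabs K + 1) * Rabs (y - x)).
- apply Rmult_le_compat_r; [apply Rabs_pos|]. generalize (Rle_abs K); lra.
- apply lt_div_mul_l in Hy; [|lra]. exact Hy.
Qed.

Lemma cint_ccont (f : C -> C) (z d : C) :
  (forall u, 0 <= u <= 1 -> ccont f (z + RtoC u * d)%C) ->
  cint (fun u => f (z + RtoC u * d)%C) (CInt (fun u => f (z + RtoC u * d)%C)).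
Proof.
intros H. apply ex_cint. intros u Hu. apply continuous_eps. intros eps He.
destruct (H u Hu eps He) as (e & Hepos & HH).
assert (Hp : 0 < Cmod d + 1) by (generalize (Cmod_ge_0 d); lra).
exists (e / (Cmod d + 1)). split; [apply Rdiv_lt_0_compat; lra|].
intros y Hy.
replace (z + RtoC y * d)%C with (z + RtoC u * d + RtoC (y - u) * d)%C by (rewrite RtoC_minus; ring).
apply HH. rewrite Cmod_mult, Cmod_R.
apply Rle_lt_trans with (Rabs (y - u) * (Cmod d + 1)).
- apply Rmult_le_compat_l; [apply Rabs_pos|lra].
- apply lt_div_mul_r in Hy; [|lra]. exact Hy.
Qed.

Lemma cder_line (F : C -> C) (z d l : C) (u : R) :
  cder F (z + RtoC u * d)%C l ->
  is_derive (K := R_AbsRing) (V := C_R_NormedModule) (fun u => F (z + RtoC u * d)%C) u (d * l)%C.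
Proof.
intros H. split; [apply (is_linear_scal_l (K := R_AbsRing) (V := C_R_NormedModule))|].
intros x Hx.
apply (is_filter_lim_locally_unique (K := R_AbsRing) (V := R_NormedModule)) in Hx; subst x.
intros eps.
assert (Hp : 0 < Cmod d + 1) by (generalize (Cmod_ge_0 d); lra).
assert (He : 0 < eps / (Cmod d + 1)) by (apply Rdiv_lt_0_compat; [apply cond_pos|lra]).
destruct (proj1 (cder_eps _ _ _) H _ He) as (e & Hepos & HH).
assert (He2 : 0 < e / (Cmod d + 1)) by (apply Rdiv_lt_0_compat; lra).
exists (mkposreal _ He2). intros y Hy.
change (Rabs (y - u) < e / (Cmod d + 1)) in Hy.
rewrite Cmod_norm_R.
change (Cmod ((F (z + RtoC y * d)%C - F (z + RtoC u * d)%C) - scal (V :=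
  C_R_NormedModule) (y - u)%R (d * l)%C)%C <= eps * Rabs (y - u)).
replace (scal (V := C_R_NormedModule) (y - u)%R (d * l)%C) with (RtoC (y - u) * d * l)%C.
2: { rewrite <- Cmult_assoc. apply Ceq; unfold scal; simpl; unfold prod_scal, scal; simpl;
  unfold mult; simpl; ring. }
assert (Hd : Cmod (RtoC (y - u) * d)%C < e).
{ rewrite Cmod_mult, Cmod_R.
  apply Rle_lt_trans with (Rabs (y - u) * (Cmod d + 1)).
  - apply Rmult_le_compat_l; [apply Rabs_pos|lra].
  - apply lt_div_mul_r in Hy; [|lra]. exact Hy. }
specialize (HH _ Hd).
replace (z + RtoC u * d + RtoC (y - u) * d)%C with (z + RtoC y * d)%C in HH by (rewrite RtoC_minus;
  ring).
apply Rle_trans with (1 := HH).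
rewrite Cmod_mult, Cmod_R.
apply Rle_trans with (eps / (Cmod d + 1) * (Rabs (y - u) * (Cmod d + 1))).
- apply Rmult_le_compat_l; [lra|]. apply Rmult_le_compat_l; [apply Rabs_pos|lra].
- right. field. lra.
Qed.

Lemma cder_line_Re (F : C -> C) (z d l : C) (u : R) :
  cder F (z + RtoC u * d)%C l ->
  is_derive (K := R_AbsRing) (V := R_NormedModule) (fun u =>
    Re (F (z + RtoC u * d)%C)) u (Re (d * l)%C).
Proof.
intros H. destruct (cder_line _ _ _ _ _ H) as [_ H1].
split; [apply (is_linear_scal_l (K := R_AbsRing) (V := R_NormedModule))|].
intros x Hx eps. specialize (H1 x Hx eps).
destruct H1 as [e He]. exists e. intros y Hy. specialize (He y Hy).
apply Rle_trans with (2 := He). rewrite Cmod_norm_R.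
apply Rle_trans with (2 := re_le_Cmod _). right; reflexivity.
Qed.

Lemma cint_FTC (F f : C -> C) (z d : C) :
  (forall u, 0 <= u <= 1 -> cder F (z + RtoC u * d)%C (f (z + RtoC u * d)%C)) ->
  (forall u, 0 <= u <= 1 -> ccont f (z + RtoC u * d)%C) ->
  cint (fun u => d * f (z + RtoC u * d))%C (F (z + d) - F z)%C.
Proof.
intros HF Hf.
assert (H := is_RInt_derive (V := C_R_CompleteNormedModule) (fun u =>
  F (z + RtoC u * d)%C) (fun u => d * f (z + RtoC u * d))%C 0 1).
rewrite Rmin_left, Rmax_right in H by lra.
replace (F (z + d) - F z)%C with (minus (G := C_R_CompleteNormedModule) (F (z + RtoC 1 * d)%C) (F
  (z + RtoC 0 * d)%C)).
- apply H.
  + intros x Hx. apply cder_line. apply HF; exact Hx.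
  + intros x Hx. apply continuous_eps. intros eps He.
    assert (Hp : 0 < Cmod d + 1) by (generalize (Cmod_ge_0 d); lra).
    assert (He1 : 0 < eps / (Cmod d + 1)) by (apply Rdiv_lt_0_compat; lra).
    destruct (Hf x Hx _ He1) as (e & Hepos & HH).
    exists (e / (Cmod d + 1)). split; [apply Rdiv_lt_0_compat; lra|].
    intros y Hy.
    replace (d * f (z + RtoC y * d) - d * f (z + RtoC x * d))%C with (d * (f (z + RtoC y * d) - f
      (z + RtoC x * d)))%C by ring.
    rewrite Cmod_mult.
    replace (z + RtoC y * d)%C with (z + RtoC x * d + RtoC (y - x) * d)%C by (rewrite RtoC_minus;
      ring).
    assert (Hd : Cmod (RtoC (y - x) * d)%C < e).
    { rewrite Cmod_mult, Cmod_R.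
      apply Rle_lt_trans with (Rabs (y - x) * (Cmod d + 1)).
      - apply Rmult_le_compat_l; [apply Rabs_pos|lra].
      - apply lt_div_mul_r in Hy; [|lra]. exact Hy. }
    specialize (HH _ Hd).
    apply Rle_lt_trans with (Cmod d * (eps / (Cmod d + 1))).
    * apply Rmult_le_compat_l; [apply Cmod_ge_0|lra].
    * apply Rlt_le_trans with ((Cmod d + 1) * (eps / (Cmod d + 1))); [apply Rmult_lt_compat_r;
        lra|].
      right; field; lra.
- change ((F (z + RtoC 1 * d) - F (z + RtoC 0 * d))%C = (F (z + d) - F z)%C).
  f_equal; [f_equal; ring|f_equal; f_equal; ring].
Qed.

(* Apply the real mean value theorem to [Re (conj w * f)], where [w] is the increment of [f]. *)
Lemma cder_lip (f : C -> C) (z d : C) (g : R -> C) (D : R) :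
  (forall u, 0 <= u <= 1 -> cder f (z + RtoC u * d)%C (g u)) ->
  (forall u, 0 <= u <= 1 -> Cmod (g u) <= D) -> Cmod (f (z + d) - f z)%C <= D * Cmod d.
Proof.
intros Hf Hg.
set (w := (f (z + d) - f z)%C).
destruct (Req_dec (Cmod w) 0) as [E|E].
{ rewrite E. apply Rmult_le_pos; [|apply Cmod_ge_0].
  apply Rle_trans with (2 := Hg 0 ltac:(lra)). apply Cmod_ge_0. }
assert (Hw : 0 < Cmod w) by (generalize (Cmod_ge_0 w); lra).
destruct (MVT_gen (fun u => Re (Cconj w * f (z + RtoC u * d))%C) 0 1 (fun u =>
  Re (Cconj w * (d * g u))%C)) as (c & Hc & HE).
- rewrite Rmin_left, Rmax_right by lra. intros x Hx.
  assert (H := cder_line_Re _ _ _ _ _ (cder_scal (Cconj w) _ _ _ (Hf x ltac:(lra)))).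
  replace (Cconj w * (d * g x))%C with (d * (Cconj w * g x))%C by ring. exact H.
- rewrite Rmin_left, Rmax_right by lra. intros x Hx.
  assert (H := cder_line_Re _ _ _ _ _ (cder_scal (Cconj w) _ _ _ (Hf x ltac:(lra)))).
  apply continuity_pt_filterlim. apply (ex_derive_continuous (K := R_AbsRing) (V :=
    R_NormedModule)).
  eexists; exact H.
- rewrite Rmin_left, Rmax_right in Hc by lra.
  assert (HL : Re (Cconj w * f (z + RtoC 1 * d))%C - Re (Cconj w * f (z + RtoC 0 * d))%C = Cmod w *
    Cmod w).
  { replace (z + RtoC 1 * d)%C with (z + d)%C by ring. replace (z + RtoC 0 * d)%C with z by ring.
    transitivity (Re (Cconj w * w)%C).
    - unfold w at 4. simpl. ring.
    - replace (Cmod w * Cmod w) with (Re (RtoC (Cmod w ^ 2))) by (simpl; ring).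
      rewrite Cmod2_conj. f_equal. ring. }
  rewrite HL, Rminus_0_r, Rmult_1_r in HE.
  assert (HB : Cmod w * Cmod w <= Cmod w * (Cmod d * D)).
  { rewrite HE. apply Rle_trans with (1 := Re_le_Cmod _).
    rewrite !Cmod_mult, Cmod_conj. apply Rmult_le_compat_l; [lra|].
    apply Rmult_le_compat_l; [apply Cmod_ge_0|]. apply Hg; exact Hc. }
  apply Rmult_le_reg_l in HB; lra.
Qed.

(** Converse of [cint_FTC]: the mean of g over the segment from z to z + h differs from g z by at
    most K |h|. It serves for functions known only through an integral formula for their increments,
    such as [Clog] and the entire part of zeta. *)
Lemma cder_of_cint (f g : C -> C) (z : C) (r K : R) : 0 < r ->
  (forall h, Cmod h < r -> exists v, cint (fun u => g (z + RtoC u * h)%C) v /\ f (z + h)%C = (f z +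
    h * v)%C) ->
  (forall h, Cmod h < r -> Cmod (g (z + h) - g z)%C <= K * Cmod h) ->
  cder f z (g z).
Proof.
intros Hr H HK. apply cder_eps. intros eps He.
assert (Hp : 0 < Rabs K + 1) by (generalize (Rabs_pos K); lra).
assert (Hq : 0 < eps / (Rabs K + 1)) by (apply Rdiv_lt_0_compat; lra).
exists (Rmin r (eps / (Rabs K + 1))). split; [apply Rmin_pos; assumption|].
intros h Hh.
assert (h1 : Cmod h < r) by (apply Rlt_le_trans with (1 := Hh), Rmin_l).
assert (h2 : Cmod h < eps / (Rabs K + 1)) by (apply Rlt_le_trans with (1 := Hh), Rmin_r).
destruct (H h h1) as (v & Hv & E). rewrite E.
replace (f z + h * v - f z - h * g z)%C with (h * (v - g z))%C by ring.
rewrite Cmod_mult, Rmult_comm. apply Rmult_le_compat_r; [apply Cmod_ge_0|].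
apply (cint_bound_const _ _ _ (cint_minus _ _ _ _ Hv (cint_const (g z)))).
intros u Hu.
assert (Hu' : Cmod (RtoC u * h)%C <= Cmod h).
{ rewrite Cmod_mult, Cmod_R, Rabs_pos_eq by lra. generalize (Cmod_ge_0 h). nra. }
apply Rle_trans with (1 := HK _ (Rle_lt_trans _ _ _ Hu' h1)).
apply Rle_trans with ((Rabs K + 1) * (eps / (Rabs K + 1))).
- apply Rle_trans with ((Rabs K + 1) * Cmod (RtoC u * h)%C).
  + apply Rmult_le_compat_r; [apply Cmod_ge_0|]. generalize (Rle_abs K); lra.
  + apply Rmult_le_compat_l; lra.
- right; field; lra.
Qed.

(** * Finite sums, exponential and logarithm *)

Definition csum (f : nat -> C) (n : nat) : C := sum_n (G := C_AbelianMonoid) f n.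

Lemma csum_0 (f : nat -> C) : csum f 0 = f O.
Proof. apply sum_O. Qed.

Lemma csum_S (f : nat -> C) (n : nat) : csum f (S n) = (csum f n + f (S n))%C.
Proof. apply (sum_Sn (G := C_AbelianMonoid)). Qed.

Lemma csum_ext (f g : nat -> C) (n : nat) :
  (forall k, (k <= n)%nat -> f k = g k) -> csum f n = csum g n.
Proof. apply (sum_n_ext_loc (G := C_AbelianMonoid)). Qed.

Lemma csum_scal (c : C) (f : nat -> C) (n : nat) : csum (fun k => c * f k)%C n = (c * csum f n)%C.
Proof. induction n; rewrite ?csum_0, ?csum_S; [reflexivity|]. rewrite IHn; ring. Qed.

Lemma csum_bound (f : nat -> C) (g : nat -> R) (n : nat) :
  (forall k, (k <= n)%nat -> Cmod (f k) <= g k) -> Cmod (csum f n) <= sum_n g n.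
Proof.
induction n; intros H; rewrite ?csum_0, ?csum_S, ?sum_O, ?sum_Sn; [apply H; lia|].
apply Rle_trans with (1 := Cmod_triangle _ _).
apply Rplus_le_compat; [apply IHn; intros; apply H; lia|apply H; lia].
Qed.

Lemma csum_split (f : nat -> C) (n m : nat) :
  csum f (n + S m) = (csum f n + csum (fun k => f (S n + k)%nat) m)%C.
Proof.
induction m.
- replace (n + 1)%nat with (S n) by lia. rewrite csum_S, csum_0. f_equal. f_equal. lia.
- replace (n + S (S m))%nat with (S (n + S m)) by lia. rewrite !csum_S, IHm.
  replace (S n + S m)%nat with (S (n + S m)) by lia. ring.
Qed.

Lemma csum_shift (f : nat -> C) (n : nat) : csum f (S n) = (f O + csum (fun k => f (S k)) n)%C.
Proof.
induction n; [rewrite csum_S, !csum_0; reflexivity|].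
rewrite csum_S, IHn, csum_S. ring.
Qed.

Lemma cint_csum (f : nat -> R -> C) (v : nat -> C) (n : nat) :
  (forall k, (k <= n)%nat -> cint (f k) (v k)) -> cint (fun u => csum (fun k =>
    f k u) n) (csum v n).
Proof.
induction n; intros H.
- rewrite csum_0. apply cint_ext with (f O); [intros; now rewrite csum_0|apply H; lia].
- rewrite csum_S. apply cint_ext with (fun u => csum (fun k => f k u) n + f (S n) u)%C;
  [intros; now rewrite csum_S|].
  apply cint_plus; [apply IHn; intros; apply H; lia|apply H; lia].
Qed.

Lemma cder_csum (f g : nat -> C -> C) (n : nat) (z : C) :
  (forall k, (k <= n)%nat -> cder (f k) z (g k z)) ->
  cder (fun y => csum (fun k => f k y) n) z (csum (fun k => g k z) n).
Proof.
induction n; intros H.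
- rewrite csum_0. apply cder_ext with (f O); [intros; now rewrite csum_0|apply H; lia].
- rewrite csum_S. apply cder_ext with (fun u => csum (fun k => f k u) n + f (S n) u)%C;
  [intros; now rewrite csum_S|].
  apply cder_plus; [apply IHn; intros; apply H; lia|apply H; lia].
Qed.

Lemma Cexp_add (x y : C) : Cexp (x + y)%C = (Cexp x * Cexp y)%C.
Proof.
destruct x as [a b], y as [c d]. unfold Cexp; simpl.
rewrite exp_plus, cos_plus, sin_plus. apply Ceq; simpl; ring.
Qed.

Lemma Cexp_0 : Cexp 0 = RtoC 1.
Proof. unfold Cexp; simpl. rewrite exp_0, cos_0, sin_0. apply Ceq; simpl; ring. Qed.

Lemma Cexp_RtoC (x : R) : Cexp (RtoC x) = RtoC (exp x).
Proof. unfold Cexp; simpl. rewrite cos_0, sin_0. apply Ceq; simpl; ring. Qed.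

Lemma Cmod_Cexp (z : C) : Cmod (Cexp z) = exp (Re z).
Proof.
unfold Cmod, Cexp; simpl.
replace (_ + _) with (exp (Re z) * exp (Re z) * (Rsqr (sin (Im z)) + Rsqr (cos (Im z)))) by (unfold
  Rsqr; ring).
rewrite sin2_cos2, Rmult_1_r. apply sqrt_square. apply Rlt_le, exp_pos.
Qed.

Lemma Cexp_neq0 (z : C) : Cexp z <> 0.
Proof. apply Cmod_gt_0. rewrite Cmod_Cexp. apply exp_pos. Qed.

Lemma exp_le_compat (x y : R) : x <= y -> exp x <= exp y.
Proof. intros [H|H]; [apply Rlt_le, exp_increasing, H|rewrite H; apply Rle_refl]. Qed.

Lemma Cmod_Cexp_le (z : C) : Cmod (Cexp z) <= exp (Cmod z).
Proof. rewrite Cmod_Cexp. apply exp_le_compat, Re_le_Cmod. Qed.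

(** Real and imaginary parts have explicit real antiderivatives, so complex differentiability is not
    presupposed; [cder_Cexp] is deduced from this formula. *)
Lemma cint_Cexp (z : C) : cint (fun u => z * Cexp (RtoC u * z))%C (Cexp z - 1)%C.
Proof.
destruct z as [x y]. apply cint_components. split.
- apply (is_RInt_ext (fun u => exp (u * x) * (x * cos (u * y) - y * sin (u * y)))).
  { intros u _. simpl. replace (u * x - 0 * y) with (u * x) by ring.
    replace (u * y + 0 * x) with (u * y) by ring. ring. }
  assert (H := is_RInt_derive (V := R_CompleteNormedModule) (fun u => exp (u * x) * cos (u * y))
   (fun u => exp (u * x) * (x * cos (u * y) - y * sin (u * y))) 0 1).
  evar_last; [apply H|].
  + intros u _. auto_derive; [exact I|]. ring.
  + intros u _. apply (ex_derive_continuous (K := R_AbsRing) (V := R_NormedModule)). auto_derive.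
      exact I.
  + unfold minus, plus, opp; simpl. rewrite !Rmult_0_l, !Rmult_1_l, exp_0, cos_0. ring.
- apply (is_RInt_ext (fun u => exp (u * x) * (x * sin (u * y) + y * cos (u * y)))).
  { intros u _. simpl. replace (u * x - 0 * y) with (u * x) by ring.
    replace (u * y + 0 * x) with (u * y) by ring. ring. }
  assert (H := is_RInt_derive (V := R_CompleteNormedModule) (fun u => exp (u * x) * sin (u * y))
   (fun u => exp (u * x) * (x * sin (u * y) + y * cos (u * y))) 0 1).
  evar_last; [apply H|].
  + intros u _. auto_derive; [exact I|]. ring.
  + intros u _. apply (ex_derive_continuous (K := R_AbsRing) (V := R_NormedModule)). auto_derive.
      exact I.
  + unfold minus, plus, opp; simpl. rewrite !Rmult_0_l, !Rmult_1_l, exp_0, sin_0. ring.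
Qed.

Lemma Cmod_Rmul (u : R) (z : C) : 0 <= u -> Cmod (RtoC u * z)%C = u * Cmod z.
Proof. intros. rewrite Cmod_mult, Cmod_R, Rabs_pos_eq; auto. Qed.

Lemma Cmod_Rmul_le (u : R) (z : C) : 0 <= u <= 1 -> Cmod (RtoC u * z)%C <= Cmod z.
Proof. intros. rewrite Cmod_Rmul by lra. generalize (Cmod_ge_0 z); nra. Qed.

Lemma Cexp_sub1 (z : C) : Cmod (Cexp z - 1)%C <= Cmod z * exp (Cmod z).
Proof.
apply (cint_bound_const _ _ _ (cint_Cexp z)). intros u Hu.
rewrite Cmod_mult. apply Rmult_le_compat_l; [apply Cmod_ge_0|].
apply Rle_trans with (1 := Cmod_Cexp_le _). apply exp_le_compat, Cmod_Rmul_le, Hu.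
Qed.

Lemma cder_Cexp (z : C) : cder Cexp z (Cexp z).
Proof.
assert (H0 : cder Cexp 0 (Cexp 0)).
{ apply cder_of_cint with 1 (exp 1); [lra| |].
  (* The mean over the segment is (exp h - 1) / h, so h = 0 is treated apart. *)
  - intros h Hh. destruct (Req_dec (Cmod h) 0) as [E|E].
    + apply Cmod_eq_0 in E; subst h. exists (Cexp 0). split.
      * apply cint_ext with (fun _ => Cexp 0); [|apply cint_const].
        intros; f_equal; ring.
      * replace (0 + 0)%C with (RtoC 0) by ring. ring.
    + assert (Hn : h <> 0) by (intro E1; apply E; rewrite E1; apply Cmod_0).
      exists (/ h * (Cexp h - 1))%C. split.
      * apply cint_ext with (fun u => / h * (h * Cexp (RtoC u * h)))%C; [|apply cint_scal,
          cint_Cexp].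
        intros u _. replace (0 + RtoC u * h)%C with (RtoC u * h)%C by ring. field. exact Hn.
      * rewrite Cexp_0. replace (0 + h)%C with h by ring. field. exact Hn.
  - intros h Hh. rewrite Cexp_0. replace (0 + h)%C with h by ring.
    apply Rle_trans with (1 := Cexp_sub1 h). rewrite Rmult_comm.
    apply Rmult_le_compat_r; [apply Cmod_ge_0|]. apply exp_le_compat; lra. }
apply cder_ext with (fun y => Cexp z * Cexp (y - z))%C.
{ intros y. rewrite <- Cexp_add. f_equal. ring. }
apply cder_eq with (Cexp z * (1 * Cexp 0))%C; [|rewrite Cexp_0; ring].
apply cder_scal. apply (cder_comp Cexp (fun y => y - z)%C).
- replace (z - z)%C with (RtoC 0) by ring. exact H0.
- apply cder_eq with (1 - 0)%C; [apply cder_minus; [apply cder_id|apply cder_const]|ring].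
Qed.

Definition exp_poly (n : nat) (z : C) : C := csum (fun k => / RtoC (INR (fact k)) * z ^ k)%C n.

Lemma RtoC_neq0 (x : R) : x <> 0 -> RtoC x <> 0.
Proof. intros H E. apply RtoC_inj in E. auto. Qed.

Lemma RtoC_fact_neq0 (k : nat) : RtoC (INR (fact k)) <> 0.
Proof. apply RtoC_neq0, INR_fact_neq_0. Qed.

Lemma cder_exp_poly (n : nat) (z : C) : cder (exp_poly (S n)) z (exp_poly n z).
Proof.
induction n.
- unfold exp_poly. apply cder_ext with (fun y => 1 + y)%C.
  + intros y. rewrite csum_S, csum_0. simpl. field; try (apply RtoC_neq0; lra).
  + apply cder_eq with (0 + 1)%C; [apply cder_plus; [apply cder_const|apply cder_id]|].
    rewrite csum_0. simpl. field; try (apply RtoC_neq0; lra).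
- apply cder_ext with (fun y => exp_poly (S n) y + / RtoC (INR (fact (S (S n)))) * y ^ (S (S n)))%C.
  { intros y. unfold exp_poly at 2. rewrite csum_S. reflexivity. }
  apply cder_eq with (exp_poly n z + / RtoC (INR (fact (S (S n)))) * (RtoC (INR (S (S n))) * z ^ S
    n))%C.
  + apply cder_plus; [exact IHn|]. apply cder_scal, cder_pow.
  + unfold exp_poly at 2. rewrite csum_S. f_equal.
    change (fact (S (S n))) with (S (S n) * fact (S n))%nat. rewrite mult_INR, RtoC_mult.
    field. split; [apply RtoC_neq0, INR_fact_neq_0|apply RtoC_neq0, not_0_INR; lia].
Qed.

Lemma is_RInt_pow01 (n : nat) : is_RInt (fun u => u ^ n) 0 1 (/ INR (S n)).
Proof.
assert (Hn : INR (S n) <> 0) by (apply not_0_INR; lia).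
evar_last.
- apply (is_RInt_derive (V := R_CompleteNormedModule) (fun u => / INR (S n) * u ^ (S n))).
  + intros u _. auto_derive; [exact I|]. cbn [Nat.pred]. field. exact Hn.
  + intros u _. apply (ex_derive_continuous (K := R_AbsRing) (V := R_NormedModule)). auto_derive.
      exact I.
- unfold minus, plus, opp; simpl plus. rewrite pow1, pow_i by lia. simpl. ring.
Qed.

(** The derivative of the remainder of order n + 1 is the remainder of order n. Integrating the
    inductive bound along the segment from 0 to z produces the integral of u^(n+1), which is the
    missing factor 1 / (n + 2). *)
Lemma exp_remainder (n : nat) (z : C) :
  Cmod (Cexp z - exp_poly n z)%C <= Cmod z ^ (S n) / INR (fact (S n)) * exp (Cmod z).
Proof.
revert z; induction n; intros z.
- unfold exp_poly. rewrite csum_0. simpl. rewrite Rmult_1_r.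
  replace (/ RtoC 1 * 1)%C with (RtoC 1) by (field; apply RtoC_neq0; lra).
  unfold Rdiv. rewrite Rinv_1, Rmult_1_r. apply Cexp_sub1.
- assert (HE : (Cexp 0 - exp_poly (S n) 0)%C = 0).
  { rewrite Cexp_0. unfold exp_poly. rewrite csum_shift.
    rewrite (csum_ext _ (fun _ => 0 * 0)%C), csum_scal.
    - simpl. field; try (apply RtoC_neq0; lra).
    - intros k _. simpl. ring. }
  assert (H := cint_FTC (fun y => Cexp y - exp_poly (S n) y)%C (fun y =>
    Cexp y - exp_poly n y)%C 0 z
    (fun u _ => cder_minus _ _ _ _ _ (cder_Cexp _) (cder_exp_poly n _))).
  assert (Hc : forall y, ccont (fun y => Cexp y - exp_poly n y)%C y).
  (* [cder_exp_poly] differentiates only [exp_poly (S n)]; for n = 0 the polynomial is the constant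
     1. *)
  { intros y. destruct n.
    - apply (cder_ccont _ _ (Cexp y - 0)%C). apply cder_minus; [apply cder_Cexp|].
      apply cder_ext with (fun _ => RtoC 1); [|apply cder_const].
      intros w. unfold exp_poly. rewrite csum_0. simpl. field; try (apply RtoC_neq0; lra).
    - apply (cder_ccont _ _ (Cexp y - exp_poly n y)%C). apply cder_minus;
        [apply cder_Cexp|apply cder_exp_poly]. }
  specialize (H (fun u _ => Hc _)). cbv beta in H. rewrite HE in H.
  replace (0 + z)%C with z in H by ring.
  replace (Cexp z - exp_poly (S n) z)%C with (Cexp z - exp_poly (S n) z - 0)%C by ring.
  apply (cint_bound _ _ (fun u => (Cmod z ^ (S (S n)) / INR (fact (S n)) * exp (Cmod z)) * u ^ (S
    n)) _ H).
  + intros u Hu. replace (0 + RtoC u * z)%C with (RtoC u * z)%C by ring.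
    rewrite Cmod_mult.
    apply Rle_trans with (Cmod z * ((u * Cmod z) ^ S n / INR (fact (S n)) * exp (Cmod z))).
    * apply Rmult_le_compat_l; [apply Cmod_ge_0|].
      apply Rle_trans with (1 := IHn _). rewrite Cmod_Rmul by lra.
      apply Rmult_le_compat_l.
      -- apply Rmult_le_pos; [apply pow_le, Rmult_le_pos; [lra|apply Cmod_ge_0]|].
         apply Rlt_le, Rinv_0_lt_compat, INR_fact_lt_0.
      -- apply exp_le_compat. generalize (Cmod_ge_0 z); nra.
    * right. rewrite Rpow_mult_distr. cbn [pow]. field. apply INR_fact_neq_0.
  + evar_last; [apply (is_RInt_scal (V := R_NormedModule)), is_RInt_pow01|].
    change ((Cmod z ^ S (S n) / INR (fact (S n)) * exp (Cmod z)) * / INR (S (S n)) = Cmod z ^ S (S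
      n) / INR (fact (S (S n))) * exp (Cmod z)).
    change (fact (S (S n))) with (S (S n) * fact (S n))%nat. rewrite mult_INR.
    field. split; [apply INR_fact_neq_0|apply not_0_INR; lia].
Qed.

Lemma pow_fact_le_exp (x : R) (k : nat) : 0 <= x -> x ^ k / INR (fact k) <= exp x.
Proof.
intros Hx. apply Rle_trans with (2 := exp_ge_taylor x k Hx).
assert (Hp : forall j, 0 <= x ^ j / INR (fact j)).
{ intros j. apply Rmult_le_pos; [apply pow_le; exact Hx|]. apply Rlt_le, Rinv_0_lt_compat,
  INR_fact_lt_0. }
destruct k; [right; reflexivity|]. rewrite tech5.
assert (0 <= sum_f_R0 (fun j => x ^ j / INR (fact j)) k) by (apply cond_pos_sum; exact Hp). lra.
Qed.

Lemma cos_Carg (z : C) : z <> 0 -> cos (Carg z) = Re z / Cmod z /\ sin (Carg z) = Im z / Cmod z.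
Proof.
intros Hz. assert (Hm : 0 < Cmod z) by (apply Cmod_gt_0; exact Hz).
assert (Hb : -1 <= Re z / Cmod z <= 1).
{ assert (H := re_le_Cmod z). apply Rabs_le_between in H.
  split; [apply Rmult_le_reg_r with (Cmod z)|apply Rmult_le_reg_r with (Cmod z)]; auto;
  unfold Rdiv; rewrite Rmult_assoc, Rinv_l; lra. }
assert (Hs : sqrt (1 - (Re z / Cmod z)²) = Rabs (Im z) / Cmod z).
{ rewrite <- (Rabs_pos_eq (Cmod z)) at 2 by lra. rewrite <- Rabs_div by lra.
  rewrite <- sqrt_Rsqr_abs. f_equal.
  assert (H := Cmod2_alt z). unfold Rsqr.
  apply Rmult_eq_reg_r with (Cmod z ^ 2); [|apply pow_nonzero; lra].
  replace ((1 - Re z / Cmod z * (Re z / Cmod z)) * Cmod z ^ 2) with (Cmod z ^ 2 - Re z ^ 2) by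
    (field; lra).
  transitivity (Im z ^ 2); [lra|field; lra]. }
unfold Carg. destruct (Rle_dec 0 (Im z)) as [Hi|Hi].
- rewrite cos_acos, sin_acos by exact Hb. rewrite Hs, Rabs_pos_eq by exact Hi. auto.
- rewrite cos_neg, sin_neg, cos_acos, sin_acos by exact Hb.
  rewrite Hs, Rabs_left by lra. split; [reflexivity|field; lra].
Qed.

Lemma Cexp_Clog (z : C) : z <> 0 -> Cexp (Clog z) = z.
Proof.
intros Hz. assert (Hm : 0 < Cmod z) by (apply Cmod_gt_0; exact Hz).
destruct (cos_Carg z Hz) as [H1 H2].
unfold Cexp, Clog; simpl. rewrite exp_ln by exact Hm. rewrite H1, H2.
apply Ceq; simpl; field; lra.
Qed.

(** Both arguments lie in (-PI/2, PI/2) and have the same tangent. The arctangent form is smooth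
    across the real axis, where the definition of [Carg] changes case. *)
Lemma Clog_halfplane (z : C) : 0 < Re z ->
  Clog z = (ln (Re z ^ 2 + Im z ^ 2) / 2, atan (Im z / Re z)).
Proof.
intros Hz. assert (Hz0 := Cpos_neq0 z Hz).
assert (Hm : 0 < Cmod z) by (apply Cmod_gt_0; exact Hz0).
destruct (cos_Carg z Hz0) as [H1 H2].
unfold Clog. f_equal.
- rewrite <- Cmod2_alt. simpl. rewrite Rmult_1_r, ln_mult by exact Hm. field.
- assert (HB : - (PI / 2) < Carg z < PI / 2).
  { assert (Hc : 0 < cos (Carg z)) by (rewrite H1; apply Rdiv_lt_0_compat; lra).
    assert (Hac : 0 <= acos (Re z / Cmod z) < PI / 2).
    { split; [apply acos_bound|].
      destruct (Rlt_le_dec (acos (Re z / Cmod z)) (PI / 2)) as [h|h]; auto.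
      assert (Hb := acos_bound (Re z / Cmod z)).
      assert (cos (acos (Re z / Cmod z)) <= 0) by (apply cos_le_0; lra).
      revert Hc; unfold Carg; destruct (Rle_dec 0 (Im z)); rewrite ?cos_neg; lra. }
    unfold Carg; destruct (Rle_dec 0 (Im z)); lra. }
  assert (Ht : tan (Carg z) = Im z / Re z).
  { unfold tan. rewrite H1, H2. field. lra. }
  rewrite <- Ht. symmetry. apply atan_tan; lra.
Qed.

Lemma Clog_RtoC (x : R) : 0 < x -> Clog (RtoC x) = RtoC (ln x).
Proof.
intros Hx. rewrite Clog_halfplane by exact Hx. simpl. unfold RtoC. f_equal.
- rewrite Rmult_0_l, Rplus_0_r, Rmult_1_r, ln_mult by exact Hx. field.
- unfold Rdiv. rewrite Rmult_0_l. apply atan_0.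
Qed.

Lemma Im_Clog_bound (z : C) : 0 < Re z -> Rabs (Im (Clog z)) <= PI / 2.
Proof.
intros Hz. rewrite Clog_halfplane by exact Hz. simpl.
assert (H := atan_bound (Im z / Re z)). apply Rabs_le. lra.
Qed.

Lemma seg_Re_lt (e : R) (z h : C) (u : R) : e < Re z -> e < Re (z + h)%C -> 0 <= u <= 1 ->
  e < Re (z + RtoC u * h)%C.
Proof.
intros H1 H2 Hu. rewrite ?Re_add, Re_Rmul. rewrite ?Re_add in *.
assert (0 <= (1 - u) * (Re z - e)) by (apply Rmult_le_pos; lra).
destruct (Req_dec u 0) as [->|E]; [lra|].
assert (0 < u * (Re z + Re h - e)) by (apply Rmult_lt_0_compat; lra). lra.
Qed.

Lemma seg_Re_le (e : R) (z h : C) (u : R) : e <= Re z -> e <= Re (z + h)%C -> 0 <= u <= 1 ->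
  e <= Re (z + RtoC u * h)%C.
Proof.
intros H1 H2 Hu. rewrite ?Re_add, Re_Rmul. rewrite ?Re_add in *. nra.
Qed.

Lemma cint_Clog (z h : C) : 0 < Re z -> 0 < Re (z + h)%C ->
  cint (fun u => h * / (z + RtoC u * h))%C (Clog (z + h) - Clog z)%C.
Proof.
intros H1 H2.
assert (Hpos := fun u => seg_Re_lt 0 z h u H1 H2).
rewrite !Clog_halfplane by assumption.
destruct z as [x y], h as [p q]. simpl in H1, H2.
assert (Hp : forall u, 0 <= u <= 1 -> 0 < x + u * p).
{ intros u Hu. specialize (Hpos u Hu). simpl in Hpos. replace (x + u * p) with (x + (u * p - 0 *
  q)) by ring. exact Hpos. }
apply cint_components. split.
- apply (is_RInt_ext (fun u => ((x + u * p) * p + (y + u * q) * q) / ((x + u * p) ^ 2 + (y + u * q)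
    ^ 2))).
  { intros u. rewrite Rmin_left, Rmax_right by lra. intros Hu. specialize (Hp u ltac:(lra)). simpl.
    replace (x + (u * p - 0 * q)) with (x + u * p) by ring.
    replace (y + (u * q + 0 * p)) with (y + u * q) by ring.
    assert (Hq1 : 0 < (x + u * p) ^ 2) by (apply pow_lt; lra).
    assert (Hq2 := pow2_ge_0 (y + u * q)).
    simpl in Hq1, Hq2. field. lra. }
  assert (H := is_RInt_derive (V := R_CompleteNormedModule) (fun u =>
    ln ((x + u * p) ^ 2 + (y + u * q) ^ 2) / 2)
   (fun u => ((x + u * p) * p + (y + u * q) * q) / ((x + u * p) ^ 2 + (y + u * q) ^ 2)) 0 1).
  rewrite Rmin_left, Rmax_right in H by lra.
  evar_last; [apply H|].
  + intros u Hu. specialize (Hp u Hu). assert (Hq1 : 0 < (x + u * p) ^ 2) by (apply pow_lt; lra).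
    assert (Hq2 := pow2_ge_0 (y + u * q)).
    auto_derive; [simpl in *; lra|]. field. simpl in *; lra.
  + intros u Hu. specialize (Hp u Hu). apply (ex_derive_continuous (K := R_AbsRing) (V :=
      R_NormedModule)). assert (Hq1 : 0 < (x + u * p) ^ 2) by (apply pow_lt; lra).
    assert (Hq2 := pow2_ge_0 (y + u * q)).
    auto_derive. simpl in *; lra.
  + unfold minus, plus, opp; simpl. rewrite !Rmult_0_l, !Rmult_1_l, !Rplus_0_r. reflexivity.
- apply (is_RInt_ext (fun u => ((x + u * p) * q - (y + u * q) * p) / ((x + u * p) ^ 2 + (y + u * q)
    ^ 2))).
  { intros u. rewrite Rmin_left, Rmax_right by lra. intros Hu. specialize (Hp u ltac:(lra)). simpl.
    replace (x + (u * p - 0 * q)) with (x + u * p) by ring.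
    replace (y + (u * q + 0 * p)) with (y + u * q) by ring.
    assert (Hq1 : 0 < (x + u * p) ^ 2) by (apply pow_lt; lra).
    assert (Hq2 := pow2_ge_0 (y + u * q)).
    simpl in Hq1, Hq2. field. lra. }
  assert (H := is_RInt_derive (V := R_CompleteNormedModule) (fun u =>
    atan ((y + u * q) / (x + u * p)))
   (fun u => ((x + u * p) * q - (y + u * q) * p) / ((x + u * p) ^ 2 + (y + u * q) ^ 2)) 0 1).
  rewrite Rmin_left, Rmax_right in H by lra.
  evar_last; [apply H|].
  + intros u Hu. specialize (Hp u Hu). assert (Hq1 : 0 < (x + u * p) ^ 2) by (apply pow_lt; lra).
    assert (Hq2 := pow2_ge_0 (y + u * q)).
    auto_derive; [lra|]. unfold Rsqr. simpl in Hq1, Hq2. field. repeat split; lra.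
  + intros u Hu. specialize (Hp u Hu). apply (ex_derive_continuous (K := R_AbsRing) (V :=
      R_NormedModule)). assert (Hq1 : 0 < (x + u * p) ^ 2) by (apply pow_lt; lra).
    assert (Hq2 := pow2_ge_0 (y + u * q)).
    auto_derive. simpl in *; lra.
  + unfold minus, plus, opp; simpl. rewrite !Rmult_0_l, !Rmult_1_l, !Rplus_0_r. reflexivity.
Qed.

Lemma cder_Clog (z : C) : 0 < Re z -> cder Clog z (/ z)%C.
Proof.
intros Hz. set (e := Re z / 2). assert (He : 0 < e) by (unfold e; lra).
assert (HR : forall h, Cmod h < e -> e < Re (z + h)%C).
{ intros h Hh. rewrite Re_add. assert (H := re_le_Cmod h).
  apply Rabs_le_between in H. unfold e in *; lra. }
(* The increment of 1/y is -h / (z (z + h)), with |z| >= Re z and |z + h| > e: this gives the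
   Lipschitz constant. *)
apply (cder_of_cint Clog (fun y => / y)%C z e (/ (Re z * e))); auto.
- intros h Hh. specialize (HR h Hh).
  exists (CInt (fun u => / (z + RtoC u * h))%C).
  assert (Hc : cint (fun u => / (z + RtoC u * h))%C (CInt (fun u => / (z + RtoC u * h))%C)).
  { apply (cint_ccont (fun y => / y)%C). intros u Hu. eapply cder_ccont, cder_inv.
    apply Cpos_neq0. apply seg_Re_lt; lra. }
  split; [exact Hc|].
  assert (H := cint_unique _ _ _ (cint_Clog z h Hz ltac:(lra)) (cint_scal h _ _ Hc)).
  rewrite <- H. ring.
- intros h Hh. specialize (HR h Hh).
  assert (n1 := Cpos_neq0 z Hz). assert (n2 := Cpos_neq0 (z + h)%C ltac:(lra)).
  replace (/ (z + h) - / z)%C with (- h * (/ z * / (z + h)))%C by (field; auto).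
  rewrite !Cmod_mult, Cmod_opp, !Cmod_inv by assumption.
  rewrite Rmult_comm. apply Rmult_le_compat_r; [apply Cmod_ge_0|].
  rewrite Rinv_mult. apply Rmult_le_compat.
  + apply Rlt_le, Rinv_0_lt_compat. apply Cmod_gt_0; auto.
  + apply Rlt_le, Rinv_0_lt_compat. apply Cmod_gt_0; auto.
  + apply Rinv_le_contravar; [exact Hz|apply Re_le_Cmod].
  + apply Rinv_le_contravar; [exact He|]. generalize (Re_le_Cmod (z + h)%C); lra.
Qed.

Lemma Cpower_add (w s t : C) : Cpower w (s + t)%C = (Cpower w s * Cpower w t)%C.
Proof. unfold Cpower. rewrite <- Cexp_add. f_equal. ring. Qed.

Lemma Cpower_0 (w : C) : Cpower w 0 = RtoC 1.
Proof. unfold Cpower. rewrite <- Cexp_0. f_equal. ring. Qed.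

Lemma Cpower_1 (w : C) : w <> 0 -> Cpower w 1 = w.
Proof. intros Hw. unfold Cpower. replace (1 * Clog w)%C with (Clog w) by ring. apply Cexp_Clog, Hw.
Qed.

Lemma Cpower_m1 (w : C) : w <> 0 -> Cpower w (- (1)) = (/ w)%C.
Proof.
intros Hw. assert (H := Cpower_add w 1 (- (1))).
replace (1 + - (1))%C with (RtoC 0) in H by ring. rewrite Cpower_0, Cpower_1 in H by exact Hw.
replace (Cpower w (- (1))) with (/ w * (w * Cpower w (- (1))))%C by (field; exact Hw).
rewrite <- H. ring.
Qed.

Lemma Cpower_nat (w : C) (n : nat) : w <> 0 -> Cpower w (RtoC (INR n)) = (w ^ n)%C.
Proof.
intros Hw. induction n; [apply Cpower_0|].
rewrite S_INR, RtoC_plus, Cpower_add, IHn, Cpower_1 by exact Hw. simpl. ring.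
Qed.

Lemma cder_Cpower (z s : C) : 0 < Re z -> cder (fun y => Cpower y s) z (s * (Cpower z s * / z))%C.
Proof.
intros Hz. unfold Cpower.
apply cder_eq with ((s * / z) * Cexp (s * Clog z))%C; [|ring].
apply (cder_comp Cexp (fun y => s * Clog y)%C); [apply cder_Cexp|].
apply cder_scal, cder_Clog, Hz.
Qed.

(** * Complex series and power series *)

Definition cser (a : nat -> C) (l : C) : Prop := is_series (K := C_AbsRing) (V :=
  C_NormedModule) a l.

Definition cps (c : nat -> C) (h l : C) : Prop := is_pseries (K := C_AbsRing) (V :=
  C_NormedModule) c h l.

Lemma cser_eps (a : nat -> C) (l : C) :
  cser a l <-> (forall eps, 0 < eps -> exists N, forall n, (N <= n)%nat ->
    Cmod (csum a n - l)%C < eps).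
Proof.
unfold cser, is_series. 
rewrite (filterlim_locally (U := C_NormedModule) (F := eventually) (sum_n a) l). split.
- intros H eps He.
  (* The balls of [C_NormedModule] bound the two components separately; halving eps pays for the
     factor sqrt 2 < 2 between their maximum and the modulus. *)
  assert (He2 : 0 < eps / 2) by lra.
  destruct (H (mkposreal _ He2)) as [N HN]. exists N. intros n Hn.
  specialize (HN n Hn). destruct HN as [H1 H2].
  change (Rabs (fst (csum a n) - fst l) < eps / 2) in H1.
  change (Rabs (snd (csum a n) - snd l) < eps / 2) in H2.
  apply Rle_lt_trans with (1 := Cmod_2Rmax _).
  change (sqrt 2 * Rmax (Rabs (fst (csum a n) - fst l)) (Rabs (snd (csum a n) - snd l)) < eps).
  assert (Hs : sqrt 2 < 2).
  { rewrite <- (sqrt_square 2) at 2 by lra. apply sqrt_lt_1; lra. }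
  assert (Hs0 := sqrt_pos 2).
  assert (Rmax (Rabs (fst (csum a n) - fst l)) (Rabs (snd (csum a n) - snd l)) < eps / 2) by (apply
    Rmax_lub_lt; assumption).
  assert (0 <= Rmax (Rabs (fst (csum a n) - fst l)) (Rabs (snd (csum a n) - snd l))).
  { apply Rle_trans with (2 := Rmax_l _ _), Rabs_pos. }
  nra.
- intros H eps. destruct (H eps (cond_pos eps)) as [N HN]. exists N. intros n Hn.
  apply C_NormedModule_mixin_compat1. apply HN, Hn.
Qed.

Lemma cps_eps (c : nat -> C) (h l : C) :
  cps c h l <-> (forall eps, 0 < eps -> exists N, forall n, (N <= n)%nat ->
    Cmod (csum (fun k => c k * h ^ k)%C n - l)%C < eps).
Proof.
assert (E : forall n, csum (fun k => c k * h ^ k)%C n = csum (fun k => scal (V :=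
  C_NormedModule) (pow_n h k) (c k)) n).
{ intros n. apply csum_ext. intros k _.
  change (scal (V := C_NormedModule) (pow_n h k) (c k)) with (pow_n h k * c k)%C.
  rewrite Cmult_comm. reflexivity. }
unfold cps, is_pseries. split.
- intros H eps He. destruct (proj1 (cser_eps _ _) H eps He) as [N HN]. exists N.
  intros n Hn. rewrite E. apply HN, Hn.
- intros H. apply cser_eps. intros eps He. destruct (H eps He) as [N HN]. exists N.
  intros n Hn. rewrite <- E. apply HN, Hn.
Qed.

Lemma cps_cser (c : nat -> C) (h l : C) : cps c h l <-> cser (fun k => c k * h ^ k)%C l.
Proof. rewrite cps_eps, cser_eps. reflexivity. Qed.

Lemma cser_ext (a b : nat -> C) (l : C) : (forall n, a n = b n) -> cser a l -> cser b l.
Proof. intros E. apply is_series_ext. exact E. Qed.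

Lemma cser_plus (a b : nat -> C) (l m : C) : cser a l -> cser b m -> cser (fun n =>
  a n + b n)%C (l + m)%C.
Proof. apply (is_series_plus (K := C_AbsRing) (V := C_NormedModule)). Qed.

Lemma cser_minus (a b : nat -> C) (l m : C) : cser a l -> cser b m -> cser (fun n =>
  a n - b n)%C (l - m)%C.
Proof. apply (is_series_minus (K := C_AbsRing) (V := C_NormedModule)). Qed.

Lemma cser_scal (c : C) (a : nat -> C) (l : C) : cser a l -> cser (fun n => c * a n)%C (c * l)%C.
Proof. apply (is_series_scal (K := C_AbsRing) (V := C_NormedModule)). Qed.

Lemma cser_csum (a : nat -> nat -> C) (l : nat -> C) (K : nat) :
  (forall k, (k <= K)%nat -> cser (fun n => a n k) (l k)) -> cser (fun n =>
    csum (a n) K) (csum l K).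
Proof.
induction K; intros H.
- rewrite csum_0. apply cser_ext with (fun n => a n O); [intros; now rewrite csum_0|apply H; lia].
- rewrite csum_S. apply cser_ext with (fun n => csum (a n) K + a n (S K))%C; [intros;
    now rewrite csum_S|].
  apply cser_plus; [apply IHK; intros; apply H; lia|apply H; lia].
Qed.

Lemma Cmod_lim_le (u : nat -> C) (l : C) (B : R) (N0 : nat) :
  (forall eps, 0 < eps -> exists N, forall n, (N <= n)%nat -> Cmod (u n - l)%C < eps) ->
  (forall n, (N0 <= n)%nat -> Cmod (u n) <= B) -> Cmod l <= B.
Proof.
intros H HB. apply le_epsilon. intros eps He.
destruct (H eps He) as [N HN].
specialize (HN (max N N0) (Nat.le_max_l _ _)). specialize (HB (max N N0) (Nat.le_max_r _ _)).
replace l with (u (max N N0) - (u (max N N0) - l))%C by ring.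
apply Rle_trans with (1 := Cmod_tri3 _ _). lra.
Qed.

Lemma Clim_unique (u : nat -> C) (l m : C) :
  (forall eps, 0 < eps -> exists N, forall n, (N <= n)%nat -> Cmod (u n - l)%C < eps) ->
  (forall eps, 0 < eps -> exists N, forall n, (N <= n)%nat -> Cmod (u n - m)%C < eps) -> l = m.
Proof.
intros H1 H2.
assert (E : Cmod (l - m)%C = 0).
{ apply Rle_antisym; [|apply Cmod_ge_0]. apply le_epsilon. intros eps He.
  destruct (H1 (eps / 2)) as [N1 HN1]; [lra|]. destruct (H2 (eps / 2)) as [N2 HN2]; [lra|].
  specialize (HN1 (max N1 N2) (Nat.le_max_l _ _)). specialize (HN2 (max N1 N2) (Nat.le_max_r _ _)).
  rewrite Cmod_sub_sym in HN1.
  assert (H := Cmod_dist_tri l (u (max N1 N2)) m). lra. }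
apply Cmod_eq_0 in E. replace l with ((l - m) + m)%C by ring. rewrite E. ring.
Qed.

Lemma cser_unique (a : nat -> C) (l m : C) : cser a l -> cser a m -> l = m.
Proof. intros H1 H2. apply (Clim_unique (csum a)); apply cser_eps; assumption. Qed.

Lemma cser_bound (a : nat -> C) (l : C) (b : nat -> R) :
  cser a l -> (forall n, Cmod (a n) <= b n) -> ex_series b -> Cmod l <= Series b.
Proof.
intros H Hb Hs. apply (Cmod_lim_le (csum a) l _ 0).
- apply cser_eps, H.
- intros n _. apply Rle_trans with (sum_n b n); [apply csum_bound; intros; apply Hb|].
  rewrite sum_n_Reals. apply sum_incr.
  + apply is_series_Reals. apply Series_correct, Hs.
  + intros k. apply Rle_trans with (2 := Hb k), Cmod_ge_0.
Qed.

Definition CSer (a : nat -> C) : C := (Series (fun n => Re (a n)), Series (fun n => Im (a n))).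

Lemma cser_CSer (a : nat -> C) (b : nat -> R) :
  (forall n, Cmod (a n) <= b n) -> ex_series b -> cser a (CSer a).
Proof.
intros Hb Hs.
assert (H1 : is_series (fun n => Re (a n)) (Series (fun n => Re (a n)))).
{ apply Series_correct. apply (ex_series_le (K := R_AbsRing) (V := R_CompleteNormedModule) _ b);
  [|exact Hs].
  intros n. apply Rle_trans with (2 := Hb n), re_le_Cmod. }
assert (H2 : is_series (fun n => Im (a n)) (Series (fun n => Im (a n)))).
{ apply Series_correct. apply (ex_series_le (K := R_AbsRing) (V := R_CompleteNormedModule) _ b);
  [|exact Hs].
  intros n. apply Rle_trans with (2 := Hb n), im_le_Cmod. }
assert (E1 : forall n, Re (csum a n) = sum_n (fun n => Re (a n)) n).
{ induction n; rewrite ?csum_0, ?csum_S, ?sum_O, ?sum_Sn; [reflexivity|]. rewrite Re_add, IHn.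
  reflexivity. }
assert (E2 : forall n, Im (csum a n) = sum_n (fun n => Im (a n)) n).
{ induction n; rewrite ?csum_0, ?csum_S, ?sum_O, ?sum_Sn; [reflexivity|]. rewrite Im_add, IHn.
  reflexivity. }
unfold cser, is_series. apply (filterlim_locally (U := C_NormedModule)). intros eps.
assert (G1 := proj1 (filterlim_locally (U := R_UniformSpace) _ _) H1 eps).
assert (G2 := proj1 (filterlim_locally (U := R_UniformSpace) _ _) H2 eps).
generalize (filter_and _ _ G1 G2). apply filter_imp. intros n [h1 h2]. split.
- rewrite <- E1 in h1. exact h1.
- rewrite <- E2 in h2. exact h2.
Qed.

(** Cauchy's estimate, used as the size of a power series. Values and remainders inside the disc of
    radius r are bounded in terms of r and M alone, hence uniformly over any set of series sharing
    them. *)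
Definition geo (c : nat -> C) (r M : R) : Prop := forall k, Cmod (c k) * r ^ k <= M.

Lemma geo_M_ge_0 (c : nat -> C) (r M : R) : geo c r M -> 0 <= M.
Proof. intros H. specialize (H O). simpl in H. generalize (Cmod_ge_0 (c O)); lra. Qed.

Lemma geo_le (c : nat -> C) (r r' M M' : R) : 0 < r' <= r -> M <= M' -> geo c r M -> geo c r' M'.
Proof.
intros Hr HM H k. apply Rle_trans with (2 := HM). apply Rle_trans with (2 := H k).
apply Rmult_le_compat_l; [apply Cmod_ge_0|]. apply pow_incr. lra.
Qed.

Lemma geo_term (c : nat -> C) (r M : R) (h : C) (q : R) (k : nat) :
  0 < r -> geo c r M -> Cmod h <= q * r -> 0 <= q -> Cmod (c k * h ^ k)%C <= M * q ^ k.
Proof.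
intros Hr H Hh Hq. rewrite Cmod_mult, Cmod_pow.
apply Rle_trans with (Cmod (c k) * (q * r) ^ k).
- apply Rmult_le_compat_l; [apply Cmod_ge_0|]. apply pow_incr. split; [apply Cmod_ge_0|exact Hh].
- rewrite Rpow_mult_distr. replace (Cmod (c k) * (q ^ k * r ^ k)) with (Cmod (c k) * r ^ k * q ^ k)
    by ring.
  apply Rmult_le_compat_r; [apply pow_le; exact Hq|]. apply H.
Qed.

Lemma sum_geom_le (q : R) (n : nat) : 0 <= q < 1 -> sum_n (fun k => q ^ k) n <= / (1 - q).
Proof.
intros Hq. rewrite sum_n_Reals. rewrite tech3 by lra.
unfold Rdiv. rewrite <- (Rmult_1_l (/ (1 - q))) at 2.
apply Rmult_le_compat_r; [apply Rlt_le, Rinv_0_lt_compat; lra|].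
assert (0 <= q ^ S n) by (apply pow_le; lra). lra.
Qed.

Lemma geo_tail (c : nat -> C) (r M : R) (h : C) (q : R) (n m : nat) :
  0 < r -> geo c r M -> Cmod h <= q * r -> 0 <= q < 1 ->
  Cmod (csum (fun k => c k * h ^ k)%C (n + S m) - csum (fun k => c k * h ^ k)%C n)%C <=
    M * q ^ S n / (1 - q).
Proof.
intros Hr H Hh Hq. rewrite csum_split.
match goal with |- Cmod (?a + ?b - ?a)%C <= _ => replace (a + b - a)%C with b by ring end.
apply Rle_trans with (sum_n (fun k => M * q ^ S n * q ^ k) m).
- apply csum_bound. intros k _. apply Rle_trans with (1 := geo_term c r M h q _ Hr H Hh (proj1 Hq)).
  rewrite pow_add. right; ring.
- rewrite (sum_n_mult_l (K := R_AbsRing) (M * q ^ S n) (fun k => q ^ k)).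
  apply Rmult_le_compat_l; [|apply sum_geom_le; exact Hq].
  apply Rmult_le_pos; [apply (geo_M_ge_0 _ _ _ H)|apply pow_le; lra].
Qed.

Lemma cps_remainder (c : nat -> C) (r M : R) (h l : C) (q : R) (n : nat) :
  0 < r -> geo c r M -> Cmod h <= q * r -> 0 <= q < 1 -> cps c h l ->
  Cmod (l - csum (fun k => c k * h ^ k)%C n)%C <= M * q ^ S n / (1 - q).
Proof.
intros Hr H Hh Hq Hl.
apply (Cmod_lim_le (fun m => csum (fun k => c k * h ^ k)%C m - csum (fun k =>
  c k * h ^ k)%C n)%C _ _ (S n)).
- intros eps He. destruct (proj1 (cps_eps _ _ _) Hl eps He) as [N HN]. exists N. intros m Hm.
  specialize (HN m Hm). 
  match goal with |- Cmod (?a - ?b - (?l - ?b))%C < _ => replace (a - b - (l - b))%C with (a - l)%C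
    by ring end.
  exact HN.
- intros m Hm. replace m with (n + S (m - S n))%nat by lia. apply geo_tail with r; auto.
Qed.

Lemma cps_bound (c : nat -> C) (r M : R) (h l : C) (q : R) :
  0 < r -> geo c r M -> Cmod h <= q * r -> 0 <= q < 1 -> cps c h l -> Cmod l <= M / (1 - q).
Proof.
intros Hr H Hh Hq Hl.
apply (Cmod_lim_le (csum (fun k => c k * h ^ k)%C) l _ 0).
- apply cps_eps, Hl.
- intros n _. apply Rle_trans with (sum_n (fun k => M * q ^ k) n).
  + apply csum_bound. intros k _. apply geo_term with r; auto; lra.
  + rewrite (sum_n_mult_l (K := R_AbsRing) M (fun k => q ^ k)).
    apply Rmult_le_compat_l; [apply (geo_M_ge_0 _ _ _ H)|apply sum_geom_le; exact Hq].
Qed.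

Lemma cps_of_remainder (c : nat -> C) (h l : C) (B q : R) : 0 <= q < 1 ->
  (forall n, Cmod (l - csum (fun k => c k * h ^ k)%C n)%C <= B * q ^ n) -> cps c h l.
Proof.
intros Hq H. apply cps_eps. intros eps He.
assert (HB : 0 < Rabs B + 1) by (generalize (Rabs_pos B); lra).
destruct (pow_lt_1_zero q ltac:(rewrite Rabs_pos_eq; lra) (eps / (Rabs B + 1))) as [N HN].
{ apply Rdiv_lt_0_compat; lra. }
exists N. intros n Hn. specialize (HN n Hn). rewrite Rabs_pos_eq in HN by (apply pow_le; lra).
rewrite Cmod_sub_sym. apply Rle_lt_trans with (1 := H n).
apply Rle_lt_trans with ((Rabs B + 1) * q ^ n).
- apply Rmult_le_compat_r; [apply pow_le; lra|]. generalize (Rle_abs B); lra.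
- apply lt_div_mul_l in HN; [|lra]. exact HN.
Qed.

Lemma cps_unique (c : nat -> C) (h l m : C) : cps c h l -> cps c h m -> l = m.
Proof. intros H1 H2. apply cps_cser in H1, H2. apply (cser_unique _ _ _ H1 H2). Qed.

Lemma cps_plus (c d : nat -> C) (h l m : C) : cps c h l -> cps d h m -> cps (fun k =>
  c k + d k)%C h (l + m)%C.
Proof.
intros H1 H2. apply cps_cser in H1, H2. apply cps_cser.
apply cser_ext with (2 := cser_plus _ _ _ _ H1 H2). intros; ring.
Qed.

Lemma cps_minus (c d : nat -> C) (h l m : C) : cps c h l -> cps d h m -> cps (fun k =>
  c k - d k)%C h (l - m)%C.
Proof.
intros H1 H2. apply cps_cser in H1, H2. apply cps_cser.
apply cser_ext with (2 := cser_minus _ _ _ _ H1 H2). intros; ring.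
Qed.

Lemma cps_scal (k0 : C) (c : nat -> C) (h l : C) : cps c h l -> cps (fun k =>
  k0 * c k)%C h (k0 * l)%C.
Proof.
intros H1. apply cps_cser in H1. apply cps_cser.
apply cser_ext with (2 := cser_scal k0 _ _ H1). intros; ring.
Qed.

Lemma cps_at_0 (c : nat -> C) : cps c 0 (c O).
Proof.
apply cps_eps. intros eps He. exists O. intros n _.
replace (csum (fun k => c k * 0 ^ k)%C n) with (c O).
- replace (c O - c O)%C with (RtoC 0) by ring. rewrite Cmod_0. exact He.
- induction n; [rewrite csum_0; simpl; ring|]. rewrite csum_S, <- IHn. simpl. ring.
Qed.

(* The coefficients of [(z + h) * f h], where [c] are those of [f]. *)
Definition mul_coef (z : C) (c : nat -> C) (k : nat) : C :=
  match k with O => z * c O | S j => z * c (S j) + c j end%C.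

Lemma cps_mul_coef (z : C) (c : nat -> C) (h l : C) : cps c h l ->
  cps (mul_coef z c) h ((z + h) * l)%C.
Proof.
intros H.
assert (H' := proj1 (cps_eps _ _ _) H).
assert (E : forall n, csum (fun k => mul_coef z c k * h ^ k)%C (S n)
  = (z * csum (fun k => c k * h ^ k) (S n) + h * csum (fun k => c k * h ^ k) n)%C).
{ induction n.
  - rewrite !csum_S, !csum_0. simpl. ring.
  - rewrite csum_S, IHn, (csum_S _ (S n)), (csum_S _ n). simpl. ring. }
apply cps_eps. intros eps He.
assert (Hp : 0 < Cmod z + Cmod h + 1) by (generalize (Cmod_ge_0 z) (Cmod_ge_0 h); lra).
destruct (H' (eps / (Cmod z + Cmod h + 1))) as [N HN]; [apply Rdiv_lt_0_compat; lra|].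
exists (S N). intros n Hn. destruct n; [lia|]. rewrite E.
assert (h1 := HN n ltac:(lia)). assert (h2 := HN (S n) ltac:(lia)).
match goal with |- Cmod (z * ?a + h * ?b - _)%C < _ =>
  replace (z * a + h * b - (z + h) * l)%C with (z * (a - l) + h * (b - l))%C by ring end.
apply Rle_lt_trans with (1 := Cmod_triangle _ _). rewrite !Cmod_mult.
set (d := eps / (Cmod z + Cmod h + 1)) in *.
assert (Hd : 0 < d) by (apply Rdiv_lt_0_compat; lra).
apply Rle_lt_trans with (Cmod z * d + Cmod h * d).
- apply Rplus_le_compat; apply Rmult_le_compat_l; try apply Cmod_ge_0; lra.
- apply Rlt_le_trans with ((Cmod z + Cmod h + 1) * d); [nra|]. unfold d. right; field; lra.
Qed.

Lemma geo_mul_coef (z : C) (c : nat -> C) (r M : R) : 0 < r -> geo c r M ->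
  geo (mul_coef z c) r ((Cmod z + r) * M).
Proof.
intros Hr H k. assert (HM := geo_M_ge_0 _ _ _ H).
destruct k; simpl mul_coef.
- rewrite Cmod_mult. specialize (H O). simpl in *. generalize (Cmod_ge_0 z) (Cmod_ge_0 (c O)). nra.
- apply Rle_trans with ((Cmod z * Cmod (c (S k)) + Cmod (c k)) * r ^ S k).
  + apply Rmult_le_compat_r; [apply pow_le; lra|]. rewrite <- Cmod_mult. apply Cmod_triangle.
  + assert (H1 := H (S k)). assert (H2 := H k).
    replace ((Cmod z * Cmod (c (S k)) + Cmod (c k)) * r ^ S k) with
     (Cmod z * (Cmod (c (S k)) * r ^ S k) + r * (Cmod (c k) * r ^ k)) by (simpl; ring).
    rewrite Rmult_plus_distr_r.
    apply Rplus_le_compat; apply Rmult_le_compat_l; auto; [apply Cmod_ge_0|lra].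
Qed.

Lemma cps_terms_bounded (c : nat -> C) (h l : C) : cps c h l -> exists M, geo c (Cmod h) M.
Proof.
intros H. destruct (proj1 (cps_eps _ _ _) H 1 Rlt_0_1) as [N HN].
set (a := fun k => Cmod (c k) * Cmod h ^ k).
assert (Ha : forall k, a k = Cmod (c k * h ^ k)%C) by (intros; unfold a; rewrite Cmod_mult,
  Cmod_pow; reflexivity).
assert (Ha0 : forall k, 0 <= a k) by (intros; rewrite Ha; apply Cmod_ge_0).
assert (Hb : forall n, (n <= N)%nat -> a n <= sum_n a N).
{ assert (Hg : forall n, 0 <= sum_n a n).
  { induction n; rewrite ?sum_O, ?sum_Sn; auto. specialize (Ha0 (S n)). change (0 <=
    sum_n a n + a (S n)). lra. }
  clear HN. induction N; intros n Hn.
  - replace n with O by lia. rewrite sum_O. apply Rle_refl.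
  - rewrite sum_Sn. change (a n <= sum_n a N + a (S N)). destruct (Nat.eq_dec n (S N)) as [->|E].
    + specialize (Hg N). lra.
    + specialize (IHN n ltac:(lia)). specialize (Ha0 (S N)). lra. }
exists (sum_n a N + 2). intros k. change (a k <= sum_n a N + 2).
destruct (le_lt_dec k N) as [Hk|Hk].
- specialize (Hb k Hk). lra.
- destruct k; [lia|].
  assert (h1 := HN k ltac:(lia)). assert (h2 := HN (S k) ltac:(lia)). rewrite csum_S in h2.
  rewrite Ha.
  replace (c (S k) * h ^ S k)%C with ((csum (fun k => c k * h ^ k) k + c (S k) * h ^ S k - l) -
    (csum (fun k => c k * h ^ k) k - l))%C by ring.
  apply Rle_trans with (1 := Cmod_tri3 _ _).
  specialize (Hb N (le_n _)). specialize (Ha0 N). lra.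
Qed.

Definition analytic_geo_at (f : C -> C) (z : C) : Prop :=
  exists c r M, 0 < r /\ geo c r M /\ forall h, Cmod h < r -> cps c h (f (z + h)%C).

(** Convergence at the single point r / 2 bounds the terms there, which already is Cauchy's estimate
    with radius r / 2. *)
Lemma analytic_geo (f : C -> C) (z : C) : C_analytic_at f z -> analytic_geo_at f z.
Proof.
intros (c & r & Hr & H).
assert (H' : forall h, Cmod h < r -> cps c h (f (z + h)%C)).
{ intros h Hh. assert (E : (z + h - z)%C = h) by ring.
  specialize (H (z + h)%C). rewrite E in H. exact (H Hh). }
assert (Hm : Cmod (RtoC (r / 2)) = r / 2) by (rewrite Cmod_R; apply Rabs_pos_eq; lra).
destruct (cps_terms_bounded c (RtoC (r / 2)) (f (z + RtoC (r / 2))%C)) as [M HM].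
{ apply H'. rewrite Hm. lra. }
rewrite Hm in HM. exists c, (r / 2), M. split; [lra|]. split; [exact HM|].
intros h Hh. apply H'. lra.
Qed.

Lemma analytic_intro (f : C -> C) (z : C) (c : nat -> C) (r : R) : 0 < r ->
  (forall h, Cmod h < r -> cps c h (f (z + h)%C)) -> C_analytic_at f z.
Proof.
intros Hr H. exists c, r. split; [exact Hr|]. intros y Hy. specialize (H (y - z)%C Hy).
rewrite Cadd_sub in H. exact H.
Qed.

Lemma cps_cder (f : C -> C) (z : C) (c : nat -> C) (r M : R) : 0 < r -> geo c r M ->
  (forall h, Cmod h < r -> cps c h (f (z + h)%C)) -> cder f z (c 1%nat).
Proof.
intros Hr HM H. assert (HM0 := geo_M_ge_0 _ _ _ HM).
assert (E0 : f z = c O).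
{ assert (H0 := H 0 ltac:(rewrite Cmod_0; exact Hr)). replace (z + 0)%C with z in H0 by ring.
  apply (cps_unique _ _ _ _ H0 (cps_at_0 c)). }
apply cder_eps. intros eps He.
(* With q = |h| / r < 1/2 the remainder after the linear term is at most M q^2 / (1 - q) <= 2 M
   |h|^2 / r^2. The + 1 keeps the denominator positive when M = 0. *)
set (d := Rmin (r / 2) (eps * r ^ 2 / (2 * M + 1))).
assert (Hd : 0 < d).
{ apply Rmin_pos; [lra|]. apply Rdiv_lt_0_compat; [|lra]. apply Rmult_lt_0_compat; [lra|].
  apply pow_lt; lra. }
exists d. split; [exact Hd|]. intros h Hh.
assert (h1 : Cmod h < r / 2) by (apply Rlt_le_trans with (1 := Hh), Rmin_l).
assert (h2 : Cmod h < eps * r ^ 2 / (2 * M + 1)) by (apply Rlt_le_trans with (1 := Hh), Rmin_r).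
set (q := Cmod h / r).
assert (Hq : 0 <= q < / 2) by (apply Cmod_ratio_half; assumption).
assert (HR := cps_remainder c r M h _ q 1 Hr HM ltac:(unfold q; right; field;
  lra) ltac:(lra) (H h ltac:(lra))).
rewrite csum_S, csum_0 in HR. rewrite E0.
replace (f (z + h) - c O - h * c 1%nat)%C with (f (z + h) - (c O * h ^ 0 + c 1%nat * h ^ 1))%C by
  (simpl; ring).
apply Rle_trans with (1 := HR).
apply Rle_trans with (M * q ^ 2 / (/ 2)).
- apply Rmult_le_compat_l; [apply Rmult_le_pos; [lra|apply pow_le; lra]|].
  apply Rinv_le_contravar; lra.
- unfold Rdiv. rewrite Rinv_inv. unfold q.
  replace (M * (Cmod h / r) ^ 2 * 2) with ((2 * M) * Cmod h / r ^ 2 * Cmod h) by (field; lra).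
  apply Rmult_le_compat_r; [apply Cmod_ge_0|].
  apply Rmult_le_reg_r with (r ^ 2); [apply pow_lt; lra|].
  unfold Rdiv. rewrite Rmult_assoc, Rinv_l, Rmult_1_r by (apply pow_nonzero; lra).
  apply Rle_trans with ((2 * M + 1) * Cmod h); [generalize (Cmod_ge_0 h); nra|].
  apply lt_div_mul_l in h2; [|lra]. lra.
Qed.

Lemma analytic_cder (f : C -> C) (z : C) : C_analytic_at f z -> cder f z (C_derive f z).
Proof.
intros H. destruct (analytic_geo f z H) as (c & r & M & Hr & HM & Hc).
assert (Hd := cps_cder f z c r M Hr HM Hc).
rewrite (cder_C_derive _ _ _ Hd). exact Hd.
Qed.

Lemma analytic_plus (f g : C -> C) (z : C) :
  C_analytic_at f z -> C_analytic_at g z -> C_analytic_at (fun s => f s + g s)%C z.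
Proof.
intros (c & r & Hr & H) (d & r' & Hr' & H').
exists (fun k => c k + d k)%C, (Rmin r r'). split; [apply Rmin_pos; assumption|].
intros y Hy. apply cps_plus; [apply H|apply H'].
- apply Rlt_le_trans with (1 := Hy), Rmin_l.
- apply Rlt_le_trans with (1 := Hy), Rmin_r.
Qed.

Lemma analytic_scal (k0 : C) (f : C -> C) (z : C) :
  C_analytic_at f z -> C_analytic_at (fun s => k0 * f s)%C z.
Proof.
intros (c & r & Hr & H). exists (fun k => k0 * c k)%C, r. split; [exact Hr|].
intros y Hy. apply cps_scal, H, Hy.
Qed.

Lemma analytic_ext (f g : C -> C) (z : C) (r : R) : 0 < r ->
  (forall y, Cmod (y - z)%C < r -> f y = g y) -> C_analytic_at f z -> C_analytic_at g z.
Proof.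
intros Hr E (c & r' & Hr' & H). exists c, (Rmin r r'). split; [apply Rmin_pos; assumption|].
intros y Hy. rewrite <- E; [apply H|].
- apply Rlt_le_trans with (1 := Hy), Rmin_r.
- apply Rlt_le_trans with (1 := Hy), Rmin_l.
Qed.

Lemma analytic_minus (f g : C -> C) (z : C) :
  C_analytic_at f z -> C_analytic_at g z -> C_analytic_at (fun s => f s - g s)%C z.
Proof.
intros Hf Hg. apply analytic_ext with (fun s => f s + (- (1)) * g s)%C 1; [lra|intros; ring|].
apply analytic_plus; [exact Hf|apply analytic_scal, Hg].
Qed.

Lemma analytic_const (k0 z : C) : C_analytic_at (fun _ => k0) z.
Proof.
apply analytic_intro with (fun k => match k with O => k0 | S _ => 0 end) 1; [lra|].
intros h _. apply cps_eps. intros eps He. exists O. intros n _.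
replace (csum _ n) with k0.
- replace (k0 - k0)%C with (RtoC 0) by ring. rewrite Cmod_0. exact He.
- induction n; [rewrite csum_0; simpl; ring|]. rewrite csum_S, <- IHn. ring.
Qed.

Lemma analytic_mul_id (f : C -> C) (z : C) : C_analytic_at f z -> C_analytic_at (fun s =>
  s * f s)%C z.
Proof.
intros (c & r & Hr & H). exists (mul_coef z c), r. split; [exact Hr|]. intros y Hy.
assert (H1 := cps_mul_coef z c (y - z)%C (f y) (H y Hy)). rewrite Cadd_sub in H1. exact H1.
Qed.

Lemma analytic_shift (f : C -> C) (w z : C) :
  C_analytic_at f (z + w)%C -> C_analytic_at (fun s => f (s + w)%C) z.
Proof.
intros (c & r & Hr & H). exists c, r. split; [exact Hr|]. intros y Hy.
specialize (H (y + w)%C). replace (y + w - (z + w))%C with (y - z)%C in H by ring. apply H, Hy.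
Qed.

(** * The identity theorem along a segment *)

Lemma cps_coef0 (c : nat -> C) (r M : R) : 0 < r -> geo c r M ->
  (forall d, 0 < d -> exists h : C, h <> 0 /\ Cmod h < d /\ cps c h 0) -> c O = 0.
Proof.
intros Hr HM H. assert (HM0 := geo_M_ge_0 _ _ _ HM). apply Cmod_eq_0.
apply Rle_antisym; [|apply Cmod_ge_0]. apply le_epsilon. intros eps He.
destruct (H (Rmin (r / 2) (eps * r / (2 * M + 1)))) as (h & _ & Hh & Hc).
{ apply Rmin_pos; [lra|]. apply Rdiv_lt_0_compat; [|lra]. apply Rmult_lt_0_compat; lra. }
assert (h1 : Cmod h < r / 2) by (apply Rlt_le_trans with (1 := Hh), Rmin_l).
assert (h2 : Cmod h < eps * r / (2 * M + 1)) by (apply Rlt_le_trans with (1 := Hh), Rmin_r).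
set (q := Cmod h / r).
assert (Hq : 0 <= q < / 2) by (apply Cmod_ratio_half; assumption).
assert (HR := cps_remainder c r M h _ q 0 Hr HM ltac:(unfold q; right; field; lra) ltac:(lra) Hc).
rewrite csum_0 in HR. simpl in HR. replace (0 - c O * 1)%C with (- c O)%C in HR by ring.
rewrite Cmod_opp in HR. rewrite Rplus_0_l. apply Rle_trans with (1 := HR).
rewrite Rmult_1_r. apply Rle_trans with (M * q / (/ 2)).
- apply Rmult_le_compat_l; [apply Rmult_le_pos; lra|]. apply Rinv_le_contravar; lra.
- unfold Rdiv. rewrite Rinv_inv. unfold q.
  apply Rmult_le_reg_r with r; [lra|]. replace (M * (Cmod h / r) * 2 * r) with (2 * M * Cmod h) by
    (field; lra).
  apply Rle_trans with ((2 * M + 1) * Cmod h); [generalize (Cmod_ge_0 h); nra|].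
  apply lt_div_mul_l in h2; [|lra]. lra.
Qed.

(** Once c 0 = 0, dividing by h gives the series with coefficients c (k + 1), which has the same
    nonzero zeros and satisfies Cauchy's estimate with M / r. The induction on k therefore
    quantifies over c and M. *)
Lemma cps_coef_zero (k : nat) : forall (c : nat -> C) (r M : R), 0 < r -> geo c r M ->
  (forall d, 0 < d -> exists h : C, h <> 0 /\ Cmod h < d /\ cps c h 0) -> c k = 0.
Proof.
induction k; intros c r M Hr HM H; [apply (cps_coef0 c r M); assumption|].
assert (H0 := cps_coef0 c r M Hr HM H).
apply (IHk (fun k => c (S k)) r (M / r) Hr).
- intros j. apply Rmult_le_reg_r with r; [lra|].
  replace (M / r * r) with M by (field; lra). apply Rle_trans with (2 := HM (S j)). simpl. right;
    ring.
- intros d Hd. destruct (H d Hd) as (h & Hn & Hh & Hc). exists h. split; [exact Hn|]. split;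
    [exact Hh|].
  apply cps_eps. intros eps He.
  assert (Hm : 0 < Cmod h) by (apply Cmod_gt_0; exact Hn).
  destruct (proj1 (cps_eps _ _ _) Hc (eps * Cmod h)) as [N HN]; [apply Rmult_lt_0_compat; lra|].
  exists N. intros n Hn'. specialize (HN (S n) ltac:(lia)).
  rewrite csum_shift, H0 in HN.
  rewrite (csum_ext _ (fun k => h * (c (S k) * h ^ k))%C) in HN by (intros; simpl; ring).
  rewrite csum_scal in HN.
  match type of HN with Cmod (?a + h * ?b - RtoC 0)%C < _ =>
    replace (a + h * b - 0)%C with (h * (b - 0))%C in HN by ring end.
  rewrite Cmod_mult, Rmult_comm in HN. apply Rmult_lt_reg_r in HN; auto.
Qed.

Definition zero_near (f : C -> C) (z : C) : Prop :=
  exists d, 0 < d /\ forall y, Cmod (y - z)%C < d -> f y = 0.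

Lemma isolated_zeros (f : C -> C) (z : C) : C_analytic_at f z ->
  (forall d, 0 < d -> exists y, y <> z /\ Cmod (y - z)%C < d /\ f y = 0) -> zero_near f z.
Proof.
intros Ha H. destruct (analytic_geo f z Ha) as (c & r & M & Hr & HM & Hc).
assert (HZ : forall k, c k = 0).
{ intros k. apply (cps_coef_zero k c r M Hr HM). intros d Hd.
  destruct (H (Rmin d r)) as (y & Hy & Hyd & Hf); [apply Rmin_pos; assumption|].
  exists (y - z)%C. split; [|split].
  - intros E. apply Hy. rewrite <- (Cadd_sub z y), E. ring.
  - apply Rlt_le_trans with (1 := Hyd), Rmin_l.
  - assert (Hlt : Cmod (y - z)%C < r) by (apply Rlt_le_trans with (1 := Hyd), Rmin_r).
    specialize (Hc _ Hlt). rewrite Cadd_sub, Hf in Hc. exact Hc. }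
exists r. split; [exact Hr|]. intros y Hy. specialize (Hc _ Hy). rewrite Cadd_sub in Hc.
symmetry. apply (cps_unique c (y - z)%C); [|exact Hc].
apply cps_eps. intros eps He. exists O. intros n _.
rewrite (csum_ext _ (fun _ => 0 * 0)%C) by (intros; rewrite HZ; ring). rewrite csum_scal.
replace (0 * csum (fun _ => 0) n - 0)%C with (RtoC 0) by ring. rewrite Cmod_0. exact He.
Qed.

(** Connectedness of the segment, by a supremum argument. Let s be the supremum of the parameters up
    to which f vanishes near every point. Zeros accumulate at g s, so f vanishes near g s by
    [isolated_zeros]; then s < 1 could be increased. *)
Lemma identity_segment (f : C -> C) (z d : C) :
  (forall u, 0 <= u <= 1 -> C_analytic_at f (z + RtoC u * d)%C) ->
  zero_near f z -> f (z + d)%C = 0.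
Proof.
intros Ha H0.
destruct (Req_dec (Cmod d) 0) as [E|Hd].
{ apply Cmod_eq_0 in E. subst d. replace (z + 0)%C with z by ring.
  destruct H0 as (e & He & H). apply H. replace (z - z)%C with (RtoC 0) by ring. rewrite Cmod_0;
    exact He. }
assert (Hd0 : 0 < Cmod d) by (generalize (Cmod_ge_0 d); lra).
set (g := fun u => (z + RtoC u * d)%C).
assert (Hg : forall u v, Cmod (g u - g v)%C = Rabs (u - v) * Cmod d).
{ intros u v. unfold g. replace (z + RtoC u * d - (z + RtoC v * d))%C with (RtoC (u - v) * d)%C by
  (rewrite RtoC_minus; ring).
  rewrite Cmod_mult, Cmod_R. reflexivity. }
set (P := fun u => 0 <= u <= 1 /\ forall v, 0 <= v <= u -> zero_near f (g v)).
assert (P0 : P 0).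
{ split; [lra|]. intros v Hv. replace v with 0 by lra. unfold g.
  replace (z + RtoC 0 * d)%C with z by ring. exact H0. }
destruct (completeness P) as [s [Hub Hlub]].
{ exists 1. intros u [Hu _]. lra. }
{ exists 0. exact P0. }
assert (Hs : 0 <= s <= 1).
{ split; [apply Hub, P0|]. apply Hlub. intros u [Hu _]; lra. }
assert (Hlt : forall v, 0 <= v < s -> zero_near f (g v)).
{ intros v Hv. destruct (Classical_Prop.classic (exists u, P u /\ v < u)) as [(u & [_ Hu] &
  Hvu)|Hn].
  - apply Hu. lra.
  - exfalso. assert (s <= v); [|lra]. apply Hlub. intros u Hu.
    destruct (Rle_lt_dec u v); auto. exfalso. apply Hn. exists u; auto. }
assert (Hz : zero_near f (g s)).
{ destruct (Req_dec s 0) as [->|Hs0]; [apply P0; lra|].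
  apply isolated_zeros; [apply Ha; exact Hs|]. intros e He.
  (* A parameter just below s: it stays in [0, s), and its point lies within e / 2 of g s. *)
  set (v := s - Rmin (s / 2) (e / (2 * Cmod d))).
  assert (He2 : 0 < e / (2 * Cmod d)) by (apply Rdiv_lt_0_compat; lra).
  assert (Hmin : 0 < Rmin (s / 2) (e / (2 * Cmod d))) by (apply Rmin_pos; lra).
  assert (Hm1 := Rmin_l (s / 2) (e / (2 * Cmod d))). assert (Hm2 :=
    Rmin_r (s / 2) (e / (2 * Cmod d))).
  assert (Hv : Cmod (g v - g s)%C < e).
  { rewrite Hg. unfold v. rewrite Rabs_left by lra.
    apply Rle_lt_trans with (e / (2 * Cmod d) * Cmod d); [apply Rmult_le_compat_r; lra|].
    replace (e / (2 * Cmod d) * Cmod d) with (e / 2) by (field; lra). lra. }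
  exists (g v). split; [|split; [exact Hv|]].
  - intros E. assert (E1 := Hg v s). rewrite E in E1. replace (g s - g s)%C with (RtoC 0) in E1 by
      ring.
    rewrite Cmod_0 in E1. unfold v in E1. rewrite Rabs_left in E1 by lra. nra.
  - destruct (Hlt v) as (e' & He' & HH); [unfold v; lra|]. apply HH.
    replace (g v - g v)%C with (RtoC 0) by ring. rewrite Cmod_0; exact He'. }
destruct Hz as (e & He & HH).
assert (Hclose : forall v, Rabs (v - s) < e / (2 * Cmod d) -> zero_near f (g v)).
{ intros v Hv. exists (e / 2). split; [lra|]. intros y Hy. apply HH.
  apply Rle_lt_trans with (1 := Cmod_dist_tri y (g v) (g s)). rewrite Hg.
  apply Rmult_lt_compat_r with (r := Cmod d) in Hv; [|lra].
  replace (e / (2 * Cmod d) * Cmod d) with (e / 2) in Hv by (field; lra). lra. }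
assert (He2 : 0 < e / (2 * Cmod d)) by (apply Rdiv_lt_0_compat; lra).
destruct (Req_dec s 1) as [E1|N1].
- specialize (HH (g s)). rewrite E1 in HH. unfold g in HH. replace (z + RtoC 1 * d)%C with (z +
    d)%C in HH by ring.
  apply HH. replace (z + d - (z + d))%C with (RtoC 0) by ring. rewrite Cmod_0; exact He.
- exfalso. set (s' := s + Rmin (1 - s) (e / (4 * Cmod d))).
  assert (He4 : 0 < e / (4 * Cmod d)) by (apply Rdiv_lt_0_compat; lra).
  assert (Hmin : 0 < Rmin (1 - s) (e / (4 * Cmod d))) by (apply Rmin_pos; lra).
  assert (Hm1 := Rmin_l (1 - s) (e / (4 * Cmod d))). assert (Hm2 :=
    Rmin_r (1 - s) (e / (4 * Cmod d))).
  assert (H4 : e / (2 * Cmod d) = 2 * (e / (4 * Cmod d))) by (field; lra).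
  assert (HP : P s').
  { split; [unfold s'; lra|]. intros v Hv. destruct (Rlt_le_dec v s) as [h|h]; [apply Hlt; lra|].
    apply Hclose. rewrite Rabs_pos_eq by lra. unfold s' in Hv. lra. }
  specialize (Hub s' HP). unfold s' in Hub. lra.
Qed.

Lemma identity_halfplane (f : C -> C) (A B : R) (s : C) :
  (forall z, A < Re z -> C_analytic_at f z) -> (forall z, B < Re z -> f z = 0) -> A < Re s ->
    f s = 0.
Proof.
(* The unit disc around this point lies in Re > B, so f vanishes near the starting point of the
   segment. *)
intros Ha H0 Hs. set (z := RtoC (Rmax A B + 1)).
assert (Hm1 := Rmax_l A B). assert (Hm2 := Rmax_r A B).
replace s with (z + (s - z))%C by ring. apply identity_segment.
- intros u Hu. apply Ha. apply seg_Re_lt; [unfold z; simpl; lra|rewrite Cadd_sub;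
    exact Hs|exact Hu].
- exists 1. split; [lra|]. intros y Hy. apply H0. assert (H1 := re_le_Cmod (y - z)%C).
  apply Rabs_le_between in H1.
  rewrite Re_sub in H1. unfold z in *. rewrite Re_RtoC in H1. lra.
Qed.

(** * Families of analytic functions depending on a parameter *)

Lemma ex_cint_lip (f : R -> C) (K : R) :
  (forall u v, 0 <= u <= 1 -> 0 <= v <= 1 -> Cmod (f u - f v)%C <= K * Rabs (u - v)) ->
    cint f (CInt f).
Proof.
(* Clamping to [0, 1] extends f to a Lipschitz function on the line, as [ex_cint] requires two-sided
   continuity at the end points. *)
intros H. set (cl := fun u => Rmax 0 (Rmin 1 u)).
assert (Hcl : forall u, 0 <= cl u <= 1).
{ intros u. unfold cl. split; [apply Rmax_l|]. apply Rmax_lub; [lra|apply Rmin_l]. }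
assert (Hid : forall u, 0 <= u <= 1 -> cl u = u).
{ intros u Hu. unfold cl. rewrite Rmin_right, Rmax_right; lra. }
assert (Hlip : forall u v, Rabs (cl u - cl v) <= Rabs (u - v)).
{ intros u v. unfold cl, Rmax, Rmin. repeat destruct Rle_dec; unfold Rabs;
  repeat destruct Rcase_abs; lra. }
assert (Hc : cint (fun u => f (cl u)) (CInt (fun u => f (cl u)))).
{ apply ex_cint. intros u _. apply (continuous_lip _ _ (Rabs K)). intros y.
  apply Rle_trans with (1 := H _ _ (Hcl y) (Hcl u)).
  apply Rle_trans with (Rabs K * Rabs (cl y - cl u)).
  - apply Rmult_le_compat_r; [apply Rabs_pos|apply Rle_abs].
  - apply Rmult_le_compat_l; [apply Rabs_pos|apply Hlip]. }
assert (Hf : cint f (CInt (fun u => f (cl u)))).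
{ revert Hc. apply cint_ext. intros u Hu. rewrite Hid; auto. }
rewrite (cint_CInt _ _ Hf). exact Hf.
Qed.

Lemma CInt_ext (f g : R -> C) : (forall u, 0 <= u <= 1 -> f u = g u) -> CInt f = CInt g.
Proof.
intros E. unfold CInt. f_equal; apply RInt_ext; intros u; rewrite Rmin_left, Rmax_right by lra;
intros Hu; rewrite E; auto; lra.
Qed.

Lemma CInt_eq (f g : R -> C) (v : C) : cint f v -> (forall u, 0 <= u <= 1 -> f u = g u) ->
  CInt g = v.
Proof. intros H E. apply cint_CInt. revert H. apply cint_ext, E. Qed.

Lemma geo_plus (c d : nat -> C) (r M M' : R) : 0 < r -> geo c r M -> geo d r M' ->
  geo (fun k => c k + d k)%C r (M + M').
Proof.
intros Hr H1 H2 k. specialize (H1 k). specialize (H2 k).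
apply Rle_trans with ((Cmod (c k) + Cmod (d k)) * r ^ k).
- apply Rmult_le_compat_r; [apply pow_le; lra|apply Cmod_triangle].
- lra.
Qed.

Lemma geo_scal (w : C) (c : nat -> C) (r M B : R) : 0 < r -> geo c r M -> Cmod w <= B ->
  geo (fun k => w * c k)%C r (B * M).
Proof.
intros Hr H Hw k. rewrite Cmod_mult, Rmult_assoc.
apply Rmult_le_compat; [apply Cmod_ge_0| |exact Hw|apply H].
apply Rmult_le_pos; [apply Cmod_ge_0|apply pow_le; lra].
Qed.

Lemma geo_ext (c d : nat -> C) (r M : R) : (forall k, c k = d k) -> geo c r M -> geo d r M.
Proof. intros E H k. rewrite <- E. apply H. Qed.

Section PowerSeriesIntegral.

Variables (c : nat -> R -> C) (r M L : R).
Hypothesis r_pos : 0 < r.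
Hypothesis c_geo : forall u, 0 <= u <= 1 -> geo (fun k => c k u) r M.
Hypothesis c_lip : forall u v, 0 <= u <= 1 -> 0 <= v <= 1 ->
  geo (fun k => c k u - c k v)%C r (L * Rabs (u - v)).

Lemma cint_coef (k : nat) : cint (c k) (CInt (c k)).
Proof.
apply ex_cint_lip with (L / r ^ k). intros u v Hu Hv.
apply Rmult_le_reg_r with (r ^ k); [apply pow_lt, r_pos|].
apply Rle_trans with (1 := c_lip u v Hu Hv k). right. field. apply pow_nonzero; lra.
Qed.

Lemma geo_cint_coef : geo (fun k => CInt (c k)) r M.
Proof.
intros k. apply Rmult_le_reg_r with (/ r ^ k); [apply Rinv_0_lt_compat, pow_lt, r_pos|].
rewrite Rmult_assoc, Rinv_r, Rmult_1_r by (apply pow_nonzero; lra).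
apply (cint_bound_const _ _ _ (cint_coef k)). intros u Hu.
apply Rmult_le_reg_r with (r ^ k); [apply pow_lt, r_pos|].
rewrite Rmult_assoc, Rinv_l, Rmult_1_r by (apply pow_nonzero; lra). apply c_geo, Hu.
Qed.

(** The remainder M q^(n+1) / (1 - q) does not depend on u, so it survives integration.
    Integrability of f comes from the Lipschitz bound on the coefficients: [cps_bound] transfers it
    to the sum. *)
Lemma cps_cint (h : C) (f : R -> C) : Cmod h < r ->
  (forall u, 0 <= u <= 1 -> cps (fun k => c k u) h (f u)) ->
  cint f (CInt f) /\ cps (fun k => CInt (c k)) h (CInt f).
Proof.
intros Hh Hf. set (q := Cmod h / r).
assert (Hq : 0 <= q < 1) by (apply Cmod_ratio; assumption).
assert (Hhq : Cmod h <= q * r) by (unfold q; right; field; lra).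
assert (Hi : cint f (CInt f)).
{ apply ex_cint_lip with (L / (1 - q)). intros u v Hu Hv.
  apply Rle_trans with (L * Rabs (u - v) / (1 - q)); [|right; field; lra].
  apply (cps_bound (fun k => c k u - c k v)%C r _ h); auto. apply cps_minus; auto. }
split; [exact Hi|].
apply cps_of_remainder with (M * q / (1 - q)) q; [exact Hq|]. intros n.
apply Rle_trans with (M * q ^ S n / (1 - q)); [|simpl; right; field; lra].
apply (cint_bound_const (fun u => f u - csum (fun k => c k u * h ^ k) n)%C).
- apply cint_minus; [exact Hi|].
  apply (cint_csum (fun k u => c k u * h ^ k)%C). intros k _. rewrite Cmult_comm.
  apply cint_ext with (fun u => h ^ k * c k u)%C; [intros; ring|]. apply cint_scal, cint_coef.
- intros u Hu. apply cps_remainder with r; auto.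
Qed.

End PowerSeriesIntegral.

Definition Box (e R0 : R) (a : C) : Prop := e <= Re a /\ Cmod a <= R0.

(* Uniformity on boxes allows integration over the parameter [a]; the Lipschitz condition, unlike
   mere continuity, passes through such integrals at no cost. *)
Definition analytic_family (F : C -> C -> C) (s0 : C) : Prop :=
  forall e R0, 0 < e -> exists (r M : R) (c : nat -> C -> C), 0 < r /\
    (forall a, Box e R0 a -> geo (fun k => c k a) r M) /\
    (forall a b, Box e R0 a -> Box e R0 b -> geo (fun k => c k a - c k b)%C r (M * Cmod (a - b)%C))
      /\
    (forall a h, Box e R0 a -> Cmod h < r -> cps (fun k => c k a) h (F (s0 + h)%C a)).

Lemma Box_self (a : C) : Box (Re a) (Cmod a) a.
Proof. split; apply Rle_refl. Qed.

Lemma Box_seg (e R0 : R) (a h : C) (u : R) : Box e R0 a -> Box e R0 (a + h)%C -> 0 <= u <= 1 ->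
  Box e R0 (a + RtoC u * h)%C.
Proof.
intros [H1 H2] [H3 H4] Hu. split; [apply seg_Re_le; assumption|].
replace (a + RtoC u * h)%C with (RtoC (1 - u) * a + RtoC u * (a + h))%C by (rewrite RtoC_minus;
  ring).
apply Rle_trans with (1 := Cmod_triangle _ _). rewrite !Cmod_Rmul by lra.
assert ((1 - u) * Cmod a <= (1 - u) * R0) by (apply Rmult_le_compat_l; lra).
assert (u * Cmod (a + h)%C <= u * R0) by (apply Rmult_le_compat_l; lra). lra.
Qed.

Lemma Box_pair (a b : C) : 0 < Re a -> 0 < Re b ->
  exists e R0, 0 < e /\ Box e R0 a /\ Box e R0 b.
Proof.
intros Ha Hb. exists (Rmin (Re a) (Re b)), (Rmax (Cmod a) (Cmod b)).
split; [apply Rmin_pos; assumption|]. split; split.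
- apply Rmin_l.
- apply Rmax_l.
- apply Rmin_r.
- apply Rmax_r.
Qed.

Lemma family_analytic (F : C -> C -> C) (s0 a : C) : analytic_family F s0 -> 0 < Re a ->
  C_analytic_at (fun s => F s a) s0.
Proof.
intros H Ha. destruct (H (Re a) (Cmod a) Ha) as (r & M & c & Hr & _ & _ & Hc).
apply analytic_intro with (fun k => c k a) r; [exact Hr|]. intros h Hh. apply Hc;
  [apply Box_self|exact Hh].
Qed.

Lemma family_coef (F : C -> C -> C) (s0 a : C) (c : nat -> C) (r M : R) : 0 < r -> geo c r M ->
  (forall h, Cmod h < r -> cps c h (F (s0 + h)%C a)) ->
  F s0 a = c O /\ cder (fun s => F s a) s0 (c 1%nat) /\ C_derive (fun s => F s a) s0 = c 1%nat.
Proof.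
intros Hr HM H.
assert (Hd := cps_cder (fun s => F s a) s0 c r M Hr HM H).
split; [|split; [exact Hd|apply cder_C_derive, Hd]].
assert (H0 := H 0 ltac:(rewrite Cmod_0; exact Hr)). replace (s0 + 0)%C with s0 in H0 by ring.
apply (cps_unique _ _ _ _ H0 (cps_at_0 c)).
Qed.

Lemma family_lip (F : C -> C -> C) (s0 : C) (e R0 : R) : analytic_family F s0 -> 0 < e -> exists K,
  forall a b, Box e R0 a -> Box e R0 b -> Cmod (F s0 a - F s0 b)%C <= K * Cmod (a - b)%C /\
   Cmod (C_derive (fun s => F s a) s0 - C_derive (fun s => F s b) s0)%C <= K * Cmod (a - b)%C.
Proof.
intros H He. destruct (H e R0 He) as (r & M & c & Hr & H1 & H2 & H3).
exists (Rabs M + Rabs M / r). intros a b Ha Hb.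
destruct (family_coef F s0 a _ r M Hr (H1 a Ha) (fun h => H3 a h Ha)) as (Ea0 & _ & Ea1).
destruct (family_coef F s0 b _ r M Hr (H1 b Hb) (fun h => H3 b h Hb)) as (Eb0 & _ & Eb1).
rewrite Ea0, Eb0, Ea1, Eb1.
assert (G0 := H2 a b Ha Hb O). assert (G1 := H2 a b Ha Hb 1%nat). simpl in G0, G1.
assert (Hm := Rle_abs M). assert (Hm0 := Rabs_pos M). assert (Hab := Cmod_ge_0 (a - b)%C).
assert (Hd : 0 <= Rabs M / r) by (apply Rmult_le_pos; [lra|apply Rlt_le, Rinv_0_lt_compat; lra]).
assert (HMa : M * Cmod (a - b)%C <= Rabs M * Cmod (a - b)%C) by (apply Rmult_le_compat_r; lra).
assert (Hda : 0 <= Rabs M / r * Cmod (a - b)%C) by (apply Rmult_le_pos; lra).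
assert (Hma : 0 <= Rabs M * Cmod (a - b)%C) by (apply Rmult_le_pos; lra).
split; [lra|].
apply Rmult_le_reg_r with r; [lra|].
replace ((Rabs M + Rabs M / r) * Cmod (a - b)%C * r) with (Rabs M * Cmod (a - b)%C * r + Rabs M *
  Cmod (a - b)%C) by (field; lra).
assert (0 <= Rabs M * Cmod (a - b)%C * r) by (apply Rmult_le_pos; lra). lra.
Qed.

(** Bound 1 and Lipschitz constant 1 let the weight be absorbed without enlarging Cauchy's constant
    M. The instances are 1 (translation identity) and 1 - u (Taylor formula). *)
Definition weight (w : R -> R) : Prop :=
  (forall u, 0 <= u <= 1 -> Rabs (w u) <= 1) /\
  (forall u v, 0 <= u <= 1 -> 0 <= v <= 1 -> Rabs (w u - w v) <= Rabs (u - v)).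

Lemma weight_1 : weight (fun _ => 1).
Proof.
split; intros; [rewrite Rabs_R1; lra|]. rewrite Rminus_diag, Rabs_R0. apply Rabs_pos.
Qed.

Lemma weight_1m : weight (fun u => 1 - u).
Proof.
split; intros; [apply Rabs_le; lra|]. replace (1 - u - (1 - v)) with (- (u - v)) by ring.
rewrite Rabs_Ropp. lra.
Qed.

Definition lip_path (e R0 K : R) (phi : R -> C) : Prop :=
  (forall u, 0 <= u <= 1 -> Box e R0 (phi u)) /\
  (forall u v, 0 <= u <= 1 -> 0 <= v <= 1 -> Cmod (phi u - phi v)%C <= K * Rabs (u - v)).

Lemma seg_path (e R0 : R) (a h : C) : Box e R0 a -> Box e R0 (a + h)%C ->
  lip_path e R0 (Cmod h) (fun u => a + RtoC u * h)%C.
Proof.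
intros Ha Hh. split; [intros; apply Box_seg; assumption|]. intros u v _ _.
replace (a + RtoC u * h - (a + RtoC v * h))%C with (RtoC (u - v) * h)%C by (rewrite RtoC_minus;
  ring).
rewrite Cmod_mult, Cmod_R. right; ring.
Qed.

Lemma path_coef_geo (c : nat -> C -> C) (w : R -> R) (phi : R -> C) (e R0 K r M : R) :
  0 < r -> weight w -> lip_path e R0 K phi ->
  (forall a, Box e R0 a -> geo (fun k => c k a) r M) ->
  forall u, 0 <= u <= 1 -> geo (fun k => RtoC (w u) * c k (phi u))%C r M.
Proof.
intros Hr [Hw1 _] [Hp1 _] H1 u Hu. rewrite <- (Rmult_1_l M).
apply geo_scal; [exact Hr|apply H1, Hp1, Hu|]. rewrite Cmod_R. apply Hw1, Hu.
Qed.

Lemma path_coef_lip (c : nat -> C -> C) (w : R -> R) (phi : R -> C) (e R0 K r M : R) :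
  0 < r -> weight w -> lip_path e R0 K phi ->
  (forall a, Box e R0 a -> geo (fun k => c k a) r M) ->
  (forall a b, Box e R0 a -> Box e R0 b -> geo (fun k => c k a - c k b)%C r (M * Cmod (a - b)%C)) ->
  forall u v, 0 <= u <= 1 -> 0 <= v <= 1 ->
  geo (fun k => RtoC (w u) * c k (phi u) - RtoC (w v) * c k (phi v))%C r ((M + M * K) * Rabs (u -
    v)).
Proof.
intros Hr [Hw1 Hw2] [Hp1 Hp2] H1 H2 u v Hu Hv.
assert (HM := geo_M_ge_0 _ _ _ (H1 _ (Hp1 u Hu))).
apply geo_ext with (fun k => RtoC (w u - w v) * c k (phi v) + RtoC (w u) * (c k (phi u) - c k (phi
  v)))%C.
{ intros k. rewrite RtoC_minus. ring. }
apply geo_le with r (Rabs (u - v) * M + 1 * (M * Cmod (phi u - phi v)%C)); [lra| |].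
- assert (M * Cmod (phi u - phi v)%C <= M * (K * Rabs (u - v))) by (apply Rmult_le_compat_l; auto).
    lra.
- apply geo_plus; [exact Hr| |]; apply geo_scal; auto; rewrite Cmod_R; auto.
Qed.

(** The integrals of the Taylor coefficients are the Taylor coefficients of the integral. Reading
    off the coefficient of index 1 gives differentiation in s under the integral sign. *)
Lemma family_path (F : C -> C -> C) (s0 : C) (w : R -> R) (phi : R -> C) (e R0 K : R) :
  analytic_family F s0 -> 0 < e -> weight w -> lip_path e R0 K phi ->
  C_analytic_at (fun s => CInt (fun u => RtoC (w u) * F s (phi u))%C) s0 /\
  cint (fun u => RtoC (w u) * F s0 (phi u))%C (CInt (fun u => RtoC (w u) * F s0 (phi u))%C) /\
  cint (fun u => RtoC (w u) * C_derive (fun s => F s (phi u)) s0)%C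
   (CInt (fun u => RtoC (w u) * C_derive (fun s => F s (phi u)) s0)%C) /\
  cder (fun s => CInt (fun u => RtoC (w u) * F s (phi u))%C) s0
   (CInt (fun u => RtoC (w u) * C_derive (fun s => F s (phi u)) s0)%C).
Proof.
intros H He Hw Hp. destruct (H e R0 He) as (r & M & c & Hr & H1 & H2 & H3).
assert (G1 := path_coef_geo c w phi e R0 K r M Hr Hw Hp H1).
assert (G2 := path_coef_lip c w phi e R0 K r M Hr Hw Hp H1 H2).
destruct Hp as [Hp1 Hp2].
assert (G3 : forall h, Cmod h < r -> cint (fun u => RtoC (w u) * F (s0 + h) (phi u))%C (CInt (fun u
  => RtoC (w u) * F (s0 + h) (phi u))%C)
   /\ cps (fun k => CInt (fun u => RtoC (w u) * c k (phi u))%C) h (CInt (fun u =>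
     RtoC (w u) * F (s0 + h) (phi u))%C)).
{ intros h Hh. apply (cps_cint (fun k u => RtoC (w u) * c k (phi u))%C r M _ Hr G1 G2 h _ Hh).
  intros u Hu. apply cps_scal. apply H3; auto. }
assert (Ga : geo (fun k => CInt (fun u => RtoC (w u) * c k (phi u))%C) r M).
{ apply (geo_cint_coef (fun k u => RtoC (w u) * c k (phi u))%C r M _ Hr G1 G2). }
assert (Hd := cps_cder (fun s => CInt (fun u => RtoC (w u) * F s (phi u))%C) s0 _ r M Hr Ga (fun h
  Hh => proj2 (G3 h Hh))).
cbv beta in Hd.
assert (E : CInt (fun u => RtoC (w u) * c 1%nat (phi u))%C = CInt (fun u =>
  RtoC (w u) * C_derive (fun s => F s (phi u)) s0)%C).
{ apply CInt_ext. intros u Hu. f_equal. symmetry.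
  apply (family_coef F s0 (phi u) (fun k => c k (phi u)) r M Hr (H1 _ (Hp1 u Hu)) (fun h =>
    H3 _ h (Hp1 u Hu))). }
split; [|split; [|split]].
- apply analytic_intro with (1 := Hr) (2 := fun h Hh => proj2 (G3 h Hh)).
- destruct (G3 0) as [G4 _]; [rewrite Cmod_0; exact Hr|]. replace (s0 + 0)%C with s0 in G4 by ring.
    exact G4.
- rewrite <- E. generalize (cint_coef (fun k u => RtoC (w u) * c k (phi u))%C r _ Hr G2 1%nat).
  apply cint_ext. intros u Hu. f_equal. symmetry.
  apply (family_coef F s0 (phi u) (fun k => c k (phi u)) r M Hr (H1 _ (Hp1 u Hu)) (fun h =>
    H3 _ h (Hp1 u Hu))).
- rewrite <- E. exact Hd.
Qed.

Lemma Box_plus_unit (e R0 : R) (a : C) (u : R) : Box e R0 a -> 0 <= u <= 1 ->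
  Box e (R0 + 1) (a + RtoC u)%C.
Proof.
intros [H1 H2] Hu. split; [rewrite Re_add, Re_RtoC; lra|].
apply Rle_trans with (1 := Cmod_triangle _ _). rewrite Cmod_R, Rabs_pos_eq by lra. lra.
Qed.

Lemma family_int (F : C -> C -> C) (s0 w0 : C) (w : R -> R) : analytic_family F (s0 + w0)%C ->
  weight w ->
  analytic_family (fun s a => CInt (fun u => RtoC (w u) * F (s + w0) (a + RtoC u))%C) s0.
Proof.
intros H Hw e R0 He.
(* The path a + u leaves the box of radius R0 by at most 1. The Lipschitz constant stays M because
   both parameters are translated by the same u. *)
destruct (H e (R0 + 1) He) as (r & M & c & Hr & H1 & H2 & H3).
assert (Hp : forall a, Box e R0 a -> lip_path e (R0 + 1) 1 (fun u => a + RtoC u)%C).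
{ intros a Ha. split; [intros u Hu; apply Box_plus_unit; assumption|]. intros u v _ _.
  replace (a + RtoC u - (a + RtoC v))%C with (RtoC (u - v)) by (rewrite RtoC_minus; ring).
  rewrite Cmod_R. right; ring. }
exists r, M, (fun k a => CInt (fun u => RtoC (w u) * c k (a + RtoC u))%C).
assert (G1 := fun a Ha => path_coef_geo c w _ _ _ _ r M Hr Hw (Hp a Ha) H1).
assert (G2 := fun a Ha => path_coef_lip c w _ _ _ _ r M Hr Hw (Hp a Ha) H1 H2).
split; [exact Hr|]. split; [|split].
- intros a Ha. apply (geo_cint_coef (fun k u => RtoC (w u) * c k (a + RtoC u))%C r M _ Hr (G1 a Ha)
    (G2 a Ha)).
- intros a b Ha Hb k.
  assert (Hi := cint_minus _ _ _ _ (cint_coef (fun k u => RtoC (w u) * c k (a + RtoC u))%C r _ Hr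
    (G2 a Ha) k)
     (cint_coef (fun k u => RtoC (w u) * c k (b + RtoC u))%C r _ Hr (G2 b Hb) k)).
  apply Rmult_le_reg_r with (/ r ^ k); [apply Rinv_0_lt_compat, pow_lt; lra|].
  rewrite Rmult_assoc, Rinv_r, Rmult_1_r by (apply pow_nonzero; lra).
  apply (cint_bound_const _ _ _ Hi). intros u Hu.
  apply Rmult_le_reg_r with (r ^ k); [apply pow_lt; lra|].
  rewrite Rmult_assoc, Rinv_l, Rmult_1_r by (apply pow_nonzero; lra).
  replace (RtoC (w u) * c k (a + RtoC u) - RtoC (w u) * c k (b + RtoC u))%C
   with (RtoC (w u) * (c k (a + RtoC u) - c k (b + RtoC u)))%C by ring.
  assert (G := H2 _ _ (Box_plus_unit e R0 a u Ha Hu) (Box_plus_unit e R0 b u Hb Hu)).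
  replace (a + RtoC u - (b + RtoC u))%C with (a - b)%C in G by ring.
  rewrite <- (Rmult_1_l (M * _)).
  apply (geo_scal _ _ _ _ _ Hr G). rewrite Cmod_R. apply Hw, Hu.
- intros a h Ha Hh.
  apply (cps_cint (fun k u => RtoC (w u) * c k (a + RtoC u))%C r M _ Hr (G1 a Ha) (G2 a Ha) h _ Hh).
  intros u Hu. apply cps_scal. replace (s0 + h + w0)%C with (s0 + w0 + h)%C by ring.
  apply H3; [apply Box_plus_unit; assumption|exact Hh].
Qed.

Lemma family_mul_id (F : C -> C -> C) (s0 : C) : analytic_family F s0 ->
  analytic_family (fun s a => s * F s a)%C s0.
Proof.
intros H e R0 He. destruct (H e R0 He) as (r & M & c & Hr & H1 & H2 & H3).
exists r, ((Cmod s0 + r) * M), (fun k a => mul_coef s0 (fun k => c k a) k).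
split; [exact Hr|]. split; [|split].
- intros a Ha. apply geo_mul_coef; auto.
- intros a b Ha Hb. rewrite Rmult_assoc.
  apply geo_ext with (mul_coef s0 (fun k => c k a - c k b)%C).
  + intros [|k]; simpl; ring.
  + apply geo_mul_coef; auto.
- intros a h Ha Hh. apply cps_mul_coef. auto.
Qed.

Lemma family_plus (F G : C -> C -> C) (s0 : C) : analytic_family F s0 -> analytic_family G s0 ->
  analytic_family (fun s a => F s a + G s a)%C s0.
Proof.
intros HF HG e R0 He. 
destruct (HF e R0 He) as (r & M & c & Hr & H1 & H2 & H3).
destruct (HG e R0 He) as (r' & M' & c' & Hr' & H1' & H2' & H3').
assert (Hm : 0 < Rmin r r') by (apply Rmin_pos; assumption).
assert (Hml := Rmin_l r r'). assert (Hmr := Rmin_r r r').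
exists (Rmin r r'), (M + M'), (fun k a => c k a + c' k a)%C.
split; [exact Hm|]. split; [|split].
- intros a Ha. apply geo_plus; [exact Hm| |].
  + apply geo_le with r M; auto; lra.
  + apply geo_le with r' M'; auto; lra.
- intros a b Ha Hb. rewrite Rmult_plus_distr_r.
  apply geo_ext with (fun k => (c k a - c k b) + (c' k a - c' k b))%C; [intros; ring|].
  apply geo_plus; [exact Hm| |].
  + apply geo_le with r (M * Cmod (a - b)%C); auto; lra.
  + apply geo_le with r' (M' * Cmod (a - b)%C); auto; lra.
- intros a h Ha Hh. apply cps_plus; [apply H3|apply H3']; auto; lra.
Qed.

(** * Complex powers *)

Lemma cps_Cexp (z : C) : cps (fun k => / RtoC (INR (fact k)))%C z (Cexp z).
Proof.
(* From (2|z|)^(n+1) / (n+1)! <= exp (2|z|): the doubled argument leaves the factor (1/2)^(n+1). *)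
apply cps_of_remainder with (exp (2 * Cmod z) * exp (Cmod z)) (/ 2); [lra|]. intros n.
apply Rle_trans with (1 := exp_remainder n z).
replace (exp (2 * Cmod z) * exp (Cmod z) * (/ 2) ^ n) with ((exp (2 * Cmod z) * (/ 2) ^ n) * exp
  (Cmod z)) by ring.
apply Rmult_le_compat_r; [apply Rlt_le, exp_pos|].
assert (H := pow_fact_le_exp (2 * Cmod z) (S n) ltac:(generalize (Cmod_ge_0 z); lra)).
rewrite Rpow_mult_distr in H.
apply Rle_trans with ((2 ^ S n * Cmod z ^ S n / INR (fact (S n))) * (/ 2) ^ S n).
- right. rewrite pow_inv. field. split; [apply pow_nonzero; lra|apply INR_fact_neq_0].
- apply Rmult_le_compat; [| |exact H|].
  + apply Rmult_le_pos; [|apply Rlt_le, Rinv_0_lt_compat, INR_fact_lt_0].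
    apply Rmult_le_pos; [apply pow_le; lra|apply pow_le, Cmod_ge_0].
  + apply pow_le; lra.
  + simpl. assert (0 <= (/ 2) ^ n) by (apply pow_le; lra). lra.
Qed.

Definition pow_coef (s z : C) (k : nat) : C :=
  (/ RtoC (INR (fact k)) * (- Clog z) ^ k * Cpower z (- s))%C.

Lemma cps_Cpower (s z h : C) : cps (pow_coef s z) h (Cpower z (- (s + h))%C).
Proof.
replace (Cpower z (- (s + h))%C) with (Cpower z (- s) * Cexp (h * - Clog z))%C.
2: { unfold Cpower. rewrite <- Cexp_add. f_equal. ring. }
apply cps_cser. assert (H := proj1 (cps_cser _ _ _) (cps_Cexp (h * - Clog z)%C)).
apply cser_ext with (2 := cser_scal (Cpower z (- s)) _ _ H).
intros k. cbv beta. unfold pow_coef. rewrite Cpow_mult_l. ring.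
Qed.

(** Bounds all [pow_coef s z k] at once, because |Clog z|^k / k! <= exp |Clog z|; thus radius 1
    serves for every family of powers. The terms in PI come from |arg z| <= PI/2. The price is the
    factor exp |ln |z||, about one power of |z|. *)
Definition pow_bound (s z : C) : R :=
  exp (PI + Rabs (Im s) * PI) * exp (Rabs (ln (Cmod z)) - Re s * ln (Cmod z)).

Lemma Cmod_Clog_le (z : C) : 0 < Re z -> Cmod (Clog z) <= Rabs (ln (Cmod z)) + PI / 2.
Proof.
intros Hz. assert (H := Im_Clog_bound z Hz).
replace (Clog z) with (RtoC (ln (Cmod z)) + Ci * RtoC (Im (Clog z)))%C.
- apply Rle_trans with (1 := Cmod_triangle _ _). rewrite Cmod_mult, !Cmod_R, Cmod_Ci. lra.
- apply Ceq; unfold Clog; simpl; ring.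
Qed.

Lemma Cmod_Cpower_le (s z : C) : 0 < Re z ->
  Cmod (Cpower z (- s)%C) <= exp (- Re s * ln (Cmod z) + Rabs (Im s) * (PI / 2)).
Proof.
intros Hz. unfold Cpower. rewrite Cmod_Cexp. apply exp_le_compat.
assert (H := Im_Clog_bound z Hz).
replace (Re (- s * Clog z)%C) with (- Re s * Re (Clog z) + Im s * Im (Clog z)) by (destruct s,
  (Clog z); simpl; ring).
change (Re (Clog z)) with (ln (Cmod z)).
apply Rplus_le_compat_l. apply Rle_trans with (1 := Rle_abs _). rewrite Rabs_mult.
apply Rmult_le_compat_l; [apply Rabs_pos|exact H].
Qed.

Lemma pow_coef_bound (s z : C) (k : nat) : 0 < Re z -> Cmod (pow_coef s z k) <= pow_bound s z.
Proof.
intros Hz. assert (HPI := PI_RGT_0). unfold pow_coef, pow_bound.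
rewrite !Cmod_mult, Cmod_inv, Cmod_pow, Cmod_opp, Cmod_R by apply RtoC_fact_neq0.
rewrite (Rabs_pos_eq (INR (fact k))) by (apply Rlt_le, INR_fact_lt_0).
apply Rle_trans with (exp (Rabs (ln (Cmod z)) + PI / 2) * exp (- Re s * ln (Cmod z) + Rabs (Im s) *
  (PI / 2))).
- apply Rmult_le_compat; [|apply Cmod_ge_0| |apply Cmod_Cpower_le, Hz].
  + apply Rmult_le_pos; [apply Rlt_le, Rinv_0_lt_compat, INR_fact_lt_0|apply pow_le, Cmod_ge_0].
  + rewrite Rmult_comm. apply Rle_trans with (1 := pow_fact_le_exp _ k (Cmod_ge_0 _)).
    apply exp_le_compat, Cmod_Clog_le, Hz.
- rewrite <- !exp_plus. apply exp_le_compat. assert (0 <= Rabs (Im s)) by apply Rabs_pos.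
  assert (0 <= Rabs (Im s) * PI) by (apply Rmult_le_pos; lra). lra.
Qed.

(** Writing c_k for [pow_coef s z k], the derivative in z is -(c_(k-1) + s c_k) / z. It is again a
    combination of coefficients, so its bound does not grow with k. *)
Lemma cder_pow_coef (s z : C) (k : nat) : 0 < Re z ->
  exists l, cder (fun y => pow_coef s y k) z l /\ Cmod l <= (1 + Cmod s) * pow_bound s z / Re z.
Proof.
intros Hz. assert (Hz0 := Cpos_neq0 z Hz).
assert (HL := cder_opp _ _ _ (cder_Clog z Hz)). assert (HP := cder_Cpower z (- s)%C Hz).
assert (Hbound : forall l b, l = (b * / z)%C -> Cmod b <= (1 + Cmod s) * pow_bound s z ->
   Cmod l <= (1 + Cmod s) * pow_bound s z / Re z).
{ intros l b -> Hb. rewrite Cmod_mult, Cmod_inv by exact Hz0.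
  apply Rmult_le_compat; [apply Cmod_ge_0|apply Rlt_le, Rinv_0_lt_compat, Cmod_gt_0, Hz0|exact Hb|].
  apply Rinv_le_contravar; [exact Hz|apply Re_le_Cmod]. }
assert (Hs := Cmod_ge_0 s).
destruct k.
- exists (- s * pow_coef s z 0 * / z)%C. split.
  + apply cder_ext with (fun y => Cpower y (- s)).
    { intros y. unfold pow_coef. simpl. field; try (apply RtoC_neq0; lra). }
    apply cder_eq with (1 := HP). unfold pow_coef. simpl. field; try exact Hz0.
  + apply (Hbound _ _ eq_refl). rewrite Cmod_mult, Cmod_opp.
    assert (Hb := pow_coef_bound s z 0 Hz). assert (0 <= Cmod (pow_coef s z 0)) by apply Cmod_ge_0.
      nra.
- exists ((- pow_coef s z k - s * pow_coef s z (S k)) * / z)%C. split.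
  + unfold pow_coef at 1.
    assert (Hpw := cder_comp (fun y => y ^ S k)%C (fun y => - Clog y)%C z _ _ (cder_pow k _) HL).
    apply cder_eq with (1 := cder_mult _ _ _ _ _ (cder_scal (/ RtoC (INR (fact (S k)))) _ _ _ Hpw)
      HP).
    unfold pow_coef. change (fact (S k)) with (S k * fact k)%nat. rewrite mult_INR, RtoC_mult.
    field. repeat split; first [exact Hz0|apply RtoC_fact_neq0|apply RtoC_neq0, not_0_INR; lia].
  + apply (Hbound _ _ eq_refl).
    apply Rle_trans with (1 := Cmod_tri3 _ _). rewrite Cmod_opp, Cmod_mult.
    assert (Hb := pow_coef_bound s z k Hz). assert (Hb1 := pow_coef_bound s z (S k) Hz).
    assert (0 <= Cmod (pow_coef s z (S k))) by apply Cmod_ge_0. nra.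
Qed.

Lemma pow_coef_lip (s z d : C) (k : nat) (D : R) :
  (forall u, 0 <= u <= 1 -> 0 < Re (z + RtoC u * d)%C /\
    (1 + Cmod s) * pow_bound s (z + RtoC u * d)%C / Re (z + RtoC u * d)%C <= D) ->
  Cmod (pow_coef s (z + d)%C k - pow_coef s z k)%C <= D * Cmod d.
Proof.
intros H.
assert (H' : forall u, exists l, 0 <= u <= 1 -> cder (fun y =>
  pow_coef s y k) (z + RtoC u * d)%C l /\ Cmod l <= D).
{ intros u. destruct (Classical_Prop.classic (0 <= u <= 1)) as [Hu|Hu].
  - destruct (H u Hu) as [H1 H2]. destruct (cder_pow_coef s _ k H1) as (l & Hl & Hb).
    exists l. intros _. split; [exact Hl|lra].
  - exists 0. intros; contradiction. }
(* [cder_lip] takes the derivative as a function of u, so one is chosen at each u. *)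
set (g := fun u => proj1_sig (constructive_indefinite_description _ (H' u))).
apply (cder_lip (fun y => pow_coef s y k) z d g D).
- intros u Hu. unfold g. destruct constructive_indefinite_description as [l Hl]. apply Hl, Hu.
- intros u Hu. unfold g. destruct constructive_indefinite_description as [l Hl]. apply Hl, Hu.
Qed.

Lemma ln_Cmod_box (e R0 : R) (a : C) : 0 < e -> Box e R0 a -> Rabs (ln (Cmod a)) <=
  Rabs (ln e) + Rabs (ln R0).
Proof.
intros He [H1 H2]. assert (H3 := Re_le_Cmod a).
assert (L1 : ln e <= ln (Cmod a)) by (apply ln_le; lra).
assert (L2 : ln (Cmod a) <= ln R0) by (apply ln_le; lra).
unfold Rabs; repeat destruct Rcase_abs; lra.
Qed.

Lemma pow_bound_box (e R0 : R) (s : C) : 0 < e ->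
  exists K, 0 < K /\ forall a, Box e R0 a -> pow_bound s a <= K.
Proof.
intros He. set (B := Rabs (ln e) + Rabs (ln R0)).
exists (exp (PI + Rabs (Im s) * PI) * exp (B + Rabs (Re s) * B)).
split; [apply Rmult_lt_0_compat; apply exp_pos|]. intros a Ha.
unfold pow_bound. apply Rmult_le_compat_l; [apply Rlt_le, exp_pos|]. apply exp_le_compat.
assert (H := ln_Cmod_box e R0 a He Ha). fold B in H.
assert (H1 : - (Re s * ln (Cmod a)) <= Rabs (Re s) * B).
{ rewrite Ropp_mult_distr_l. apply Rle_trans with (1 := Rle_abs _). rewrite Rabs_mult, Rabs_Ropp.
  apply Rmult_le_compat_l; [apply Rabs_pos|exact H]. }
lra.
Qed.

Lemma family_Cpower (s0 : C) : analytic_family (fun s a => Cpower a (- s)%C) s0.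
Proof.
intros e R0 He. destruct (pow_bound_box e R0 s0 He) as (K & HK & HB).
assert (Hs := Cmod_ge_0 s0).
exists 1, (K + (1 + Cmod s0) * K / e), (fun k a => pow_coef s0 a k).
assert (Hp : 0 <= (1 + Cmod s0) * K / e).
{ apply Rmult_le_pos; [apply Rmult_le_pos; lra|apply Rlt_le, Rinv_0_lt_compat; lra]. }
split; [lra|]. split; [|split].
- intros a Ha k. rewrite pow1, Rmult_1_r.
  apply Rle_trans with (1 := pow_coef_bound s0 a k ltac:(destruct Ha; lra)). specialize (HB a Ha).
    lra.
- intros a b Ha Hb k. rewrite pow1, Rmult_1_r.
  apply Rle_trans with ((1 + Cmod s0) * K / e * Cmod (a - b)%C).
  + replace a with (b + (a - b))%C at 1 by ring. apply pow_coef_lip. intros u Hu.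
    assert (Hbox := Box_seg e R0 b (a - b)%C u Hb ltac:(rewrite Cadd_sub; exact Ha) Hu).
    assert (Hre := proj1 Hbox). split; [lra|].
    apply Rmult_le_compat; [|apply Rlt_le, Rinv_0_lt_compat; lra| |apply Rinv_le_contravar; lra].
    * apply Rmult_le_pos; [lra|]. apply Rlt_le, Rmult_lt_0_compat; apply exp_pos.
    * apply Rmult_le_compat_l; [lra|apply HB, Hbox].
  + apply Rmult_le_compat_r; [apply Cmod_ge_0|lra].
- intros a h _ _. apply cps_Cpower.
Qed.

(** * The Hurwitz series *)

Lemma ex_series_inv_sqr : ex_series (fun n => / (INR n + 1) ^ 2).
Proof.
apply (ex_series_le (K := R_AbsRing) (V := R_CompleteNormedModule) _ (fun n =>
  2 * (/ (INR n + 1) - / (INR n + 2)))).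
- intros n. assert (Hn := pos_INR n). change (Rabs (/ (INR n + 1) ^ 2) <=
    2 * (/ (INR n + 1) - / (INR n + 2))).
  assert (H2 : 0 < (INR n + 1) ^ 2) by (apply pow_lt; lra).
  rewrite Rabs_pos_eq by (apply Rlt_le, Rinv_0_lt_compat, H2).
  replace (2 * (/ (INR n + 1) - / (INR n + 2))) with (/ ((INR n + 1) * (INR n + 2) / 2)) by (field;
    lra).
  apply Rinv_le_contravar; nra.
- apply ex_series_scal with (c := 2) (a := fun n => / (INR n + 1) - / (INR n + 2)).
  exists 1. apply is_series_Reals. intros eps He.
  destruct (archimed_cor1 eps He) as (N & HN & HN0). exists N. intros n Hn.
  assert (E : forall n, sum_f_R0 (fun n => / (INR n + 1) - / (INR n + 2)) n = 1 - / (INR n + 2)).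
  { clear. induction n; [simpl; field|]. rewrite tech5, IHn, S_INR. assert (Hn := pos_INR n).
    field. lra. }
  rewrite E. unfold Rdist. replace (1 - / (INR n + 2) - 1) with (- / (INR n + 2)) by ring.
  assert (Hn0 := pos_INR n). rewrite Rabs_Ropp, Rabs_pos_eq by (apply Rlt_le, Rinv_0_lt_compat;
    lra).
  apply Rle_lt_trans with (2 := HN). apply Rinv_le_contravar; [apply lt_0_INR; lia|].
  apply le_INR in Hn. lra.
Qed.

(** Weierstrass' double series theorem: the Cauchy constants m n are summable, so the remainders of
    the individual power series add up to one geometric remainder. *)
Lemma cps_series (c : nat -> nat -> C) (ck : nat -> C) (m : nat -> R) (r : R) (h F : C) (f : nat ->
  C) :
  0 < r -> ex_series m -> (forall n, geo (c n) r (m n)) -> (forall k, cser (fun n =>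
    c n k) (ck k)) ->
  Cmod h < r -> (forall n, cps (c n) h (f n)) -> cser f F -> cps ck h F.
Proof.
intros Hr Hm Hc Hk Hh Hf HF. set (q := Cmod h / r).
assert (Hq : 0 <= q < 1) by (apply Cmod_ratio; assumption).
assert (Hhq : Cmod h <= q * r) by (unfold q; right; field; lra).
apply cps_of_remainder with (Series m * q / (1 - q)) q; [exact Hq|]. intros K.
assert (H1 : cser (fun n => f n - csum (fun k => c n k * h ^ k) K)%C (F - csum (fun k =>
  ck k * h ^ k) K)%C).
{ apply cser_minus; [exact HF|]. apply (cser_csum (fun n k => c n k * h ^ k)%C). intros k _.
  rewrite Cmult_comm. apply cser_ext with (fun n => h ^ k * c n k)%C; [intros; ring|].
    apply cser_scal, Hk. }
apply Rle_trans with (Series (fun n => m n * (q ^ S K / (1 - q)))).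
- apply (cser_bound _ _ _ H1).
  + intros n. apply Rle_trans with (1 := cps_remainder (c n) r (m n) h (f n) q K Hr (Hc n) Hhq Hq
      (Hf n)).
    right; unfold Rdiv; ring.
  + apply ex_series_scal_r, Hm.
- rewrite Series_scal_r. simpl. right; field; lra.
Qed.

Lemma Re_natp (n : nat) (a : C) : Re (RtoC (INR n) + a)%C = INR n + Re a.
Proof. reflexivity. Qed.

(** [pow_bound] behaves like |z|^(1 - Re s), one power worse than z^(-s). Quadratic decay therefore
    asks for Re s >= 3. *)
Lemma pow_bound_series (e : R) (s : C) : 0 < e -> 3 <= Re s ->
  exists K, 0 < K /\ forall n z, INR n + e <= Re z -> pow_bound s z <= K * / (INR n + 1) ^ 2.
Proof.
(* Chosen so that n + e >= min(e, 1) (n + 1), which gives ln |z| >= l + ln (n + 1). *)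
intros He Hs. set (l := ln (Rmin e 1)).
assert (Hmin : 0 < Rmin e 1) by (apply Rmin_pos; lra).
assert (Hm1 := Rmin_l e 1). assert (Hm2 := Rmin_r e 1).
assert (Hl : l <= 0) by (unfold l; rewrite <- ln_1; apply ln_le; lra).
exists (exp (PI + Rabs (Im s) * PI) * exp (- (Re s + 1) * l)).
split; [apply Rmult_lt_0_compat; apply exp_pos|]. intros n z Hz.
assert (Hn := pos_INR n).
unfold pow_bound. rewrite Rmult_assoc. apply Rmult_le_compat_l; [apply Rlt_le, exp_pos|].
assert (Hln : l + ln (INR n + 1) <= ln (Cmod z)).
{ unfold l. rewrite <- ln_mult by lra. apply ln_le; [apply Rmult_lt_0_compat; lra|].
  apply Rle_trans with (2 := Re_le_Cmod z). nra. }
assert (Hln0 : 0 <= ln (INR n + 1)) by (rewrite <- ln_1; apply ln_le; lra).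
replace (/ (INR n + 1) ^ 2) with (exp (- 2 * ln (INR n + 1))).
2: { replace (-2 * ln (INR n + 1)) with (- (ln (INR n + 1) + ln (INR n + 1))) by ring.
  rewrite exp_Ropp, exp_plus, exp_ln by lra. f_equal. ring. }
rewrite <- exp_plus. apply exp_le_compat.
assert (Ha : Rabs (ln (Cmod z)) <= ln (Cmod z) - 2 * l) by (unfold Rabs; destruct Rcase_abs; lra).
assert ((Re s - 1) * (l + ln (INR n + 1)) <= (Re s - 1) * ln (Cmod z)) by (apply Rmult_le_compat_l;
  lra).
assert (2 * ln (INR n + 1) <= (Re s - 1) * ln (INR n + 1)) by (apply Rmult_le_compat_r; lra).
lra.
Qed.

(** The coefficients are the sums over n of [pow_coef s0 (n + a)], dominated together with their
    Lipschitz constants by multiples of 1 / (n + 1)^2. Any right half-plane is a sufficient start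
    for the continuation; 3 is what the crude [pow_bound] yields. *)
Lemma family_Hurwitz (zeta : C -> C -> C) (s0 : C) : is_Hurwitz_zeta zeta -> 3 < Re s0 ->
  analytic_family zeta s0.
Proof.
intros Hz Hs e R0 He.
destruct (pow_bound_series e s0 He ltac:(lra)) as (K & HK & HB).
assert (Hs0 := Cmod_ge_0 s0).
set (D := (1 + Cmod s0) * K / e).
assert (HD : 0 <= D).
{ apply Rmult_le_pos; [apply Rmult_le_pos; lra|apply Rlt_le, Rinv_0_lt_compat; lra]. }
set (m := fun n => / (INR n + 1) ^ 2).
assert (Hm0 : forall n, 0 <= m n).
{ intros n. apply Rlt_le, Rinv_0_lt_compat, pow_lt. generalize (pos_INR n); lra. }
assert (HmK : forall c, ex_series (fun n => c * m n)) by (intros c; exact (ex_series_scal_l (K :=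
  R_AbsRing) (V := R_NormedModule) c m ex_series_inv_sqr)).
set (S := Series m).
assert (HS : 0 <= S).
{ assert (Hle : forall n, Cmod (RtoC (m n)) <= m n) by (intros n; rewrite Cmod_R, Rabs_pos_eq;
  auto; lra).
  apply Rle_trans with (1 := Cmod_ge_0 (CSer (fun n => RtoC (m n)))).
  apply (cser_bound _ _ m (cser_CSer _ m Hle ex_series_inv_sqr));
    [exact Hle|apply ex_series_inv_sqr]. }
assert (Hc : forall a n k, Box e R0 a -> Cmod (pow_coef s0 (RtoC (INR n) + a)%C k) <= K * m n).
{ intros a n k [Ha _]. apply Rle_trans with (1 := pow_coef_bound s0 (RtoC (INR n) + a)%C k
  ltac:(rewrite Re_natp; generalize (pos_INR n); lra)).
  apply HB. rewrite Re_natp. lra. }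
assert (Hcs : forall a k, Box e R0 a -> cser (fun n => pow_coef s0 (RtoC (INR n) + a)%C k) (CSer
  (fun n => pow_coef s0 (RtoC (INR n) + a)%C k))).
{ intros a k Ha. apply cser_CSer with (fun n => K * m n); [|apply HmK]. intros n. apply Hc, Ha. }
exists 1, (K * S + D * S), (fun k a => CSer (fun n => pow_coef s0 (RtoC (INR n) + a)%C k)).
split; [lra|]. split; [|split].
- intros a Ha k. rewrite pow1, Rmult_1_r.
  apply Rle_trans with (Series (fun n => K * m n)).
  + apply (cser_bound _ _ _ (Hcs a k Ha)); [|apply HmK]. intros n. apply Hc, Ha.
  + rewrite Series_scal_l. fold S. assert (0 <= D * S) by (apply Rmult_le_pos; lra). lra.
- intros a b Ha Hb k. rewrite pow1, Rmult_1_r.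
  apply Rle_trans with (Series (fun n => (D * Cmod (a - b)%C) * m n)).
  + apply (cser_bound _ _ _ (cser_minus _ _ _ _ (Hcs a k Ha) (Hcs b k Hb))); [|apply HmK].
    intros n. replace (D * Cmod (a - b)%C * m n) with (D * m n * Cmod (a - b)%C) by ring.
    replace (RtoC (INR n) + a)%C with ((RtoC (INR n) + b) + (a - b))%C by ring.
    apply pow_coef_lip. intros u Hu.
    assert (Hre : INR n + e <= Re (RtoC (INR n) + b + RtoC u * (a - b))%C).
    { apply seg_Re_le; [rewrite Re_natp; destruct Hb; lra| |exact Hu].
      replace (RtoC (INR n) + b + (a - b))%C with (RtoC (INR n) + a)%C by ring. rewrite Re_natp;
        destruct Ha; lra. }
    assert (Hn := pos_INR n). split; [lra|].
    apply Rle_trans with ((1 + Cmod s0) * (K * m n) / e); [|unfold D; right; field; lra].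
    apply Rmult_le_compat; [|apply Rlt_le, Rinv_0_lt_compat; lra| |apply Rinv_le_contravar; lra].
    * apply Rmult_le_pos; [lra|]. apply Rlt_le, Rmult_lt_0_compat; apply exp_pos.
    * apply Rmult_le_compat_l; [lra|]. apply HB, Hre.
  + rewrite Series_scal_l. fold S. assert (0 <= K * S) by (apply Rmult_le_pos; lra).
    assert (Hab := Cmod_ge_0 (a - b)%C). assert (0 <= K * S * Cmod (a - b)%C) by (apply
      Rmult_le_pos; lra). lra.
- intros a h Ha Hh.
  apply (cps_series (fun n k => pow_coef s0 (RtoC (INR n) + a)%C k) _ (fun n => K * m n) 1 h _
     (fun n => Cpower (RtoC (INR n) + a)%C (- (s0 + h))%C)); [lra|apply HmK| | |exact Hh| |].
  + intros n k. rewrite pow1, Rmult_1_r. apply Hc, Ha.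
  + intros k. apply Hcs, Ha.
  + intros n. apply cps_Cpower.
  + apply (Hz a); [destruct Ha; lra|]. rewrite Re_add. assert (Hr := re_le_Cmod h).
    apply Rabs_le_between in Hr. lra.
Qed.

(** * Termwise integration and the base identities *)

Lemma cser_tail (a : nat -> C) (l : C) (m : nat -> R) (N : nat) :
  cser a l -> (forall n, Cmod (a n) <= m n) -> ex_series m ->
  Cmod (l - csum a N)%C <= Series m - sum_n m N.
Proof.
intros Hl Ha Hm.
apply (Cmod_lim_le (fun n => csum a n - csum a N)%C _ _ (S N)).
- intros eps He. destruct (proj1 (cser_eps _ _) Hl eps He) as [N1 H1]. exists N1. intros n Hn.
  replace (csum a n - csum a N - (l - csum a N))%C with (csum a n - l)%C by ring. apply H1, Hn.
- intros n Hn. replace n with (N + S (n - S N))%nat by lia. rewrite csum_split.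
  replace (csum a N + csum (fun k => a (S N + k)%nat) (n - S N) - csum a N)%C with (csum (fun k =>
    a (S N + k)%nat) (n - S N)) by ring.
  apply Rle_trans with (sum_n (fun k => m (S N + k)%nat) (n - S N)); [apply csum_bound; intros;
    apply Ha|].
  assert (E : forall j, sum_n m (N + S j) = sum_n m N + sum_n (fun k => m (S N + k)%nat) j).
  { induction j.
    - replace (N + 1)%nat with (S N) by lia. rewrite sum_Sn, sum_O, Nat.add_0_r. reflexivity.
    - replace (N + S (S j))%nat with (S (N + S j)) by lia. rewrite sum_Sn, IHj, sum_Sn.
      replace (S N + S j)%nat with (S (N + S j)) by lia. unfold plus; simpl. ring. }
  specialize (E (n - S N)%nat).
  assert (Hle : sum_n m (N + S (n - S N)) <= Series m).
  { rewrite sum_n_Reals. apply sum_incr; [apply is_series_Reals, Series_correct, Hm|].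
    intros k. apply Rle_trans with (2 := Ha k), Cmod_ge_0. }
  lra.
Qed.

Lemma cser_cint (f : nat -> R -> C) (g : R -> C) (I : nat -> C) (v : C) (m : nat -> R) :
  (forall n, cint (f n) (I n)) -> cint g v -> (forall u, 0 <= u <= 1 -> cser (fun n =>
    f n u) (g u)) ->
  (forall n u, 0 <= u <= 1 -> Cmod (f n u) <= m n) -> ex_series m -> cser I v.
Proof.
intros Hf Hg Hs Hb Hm. apply cser_eps. intros eps He.
assert (H := Series_correct m Hm). apply is_series_Reals in H.
destruct (H eps He) as [N HN]. exists N. intros n Hn. specialize (HN n Hn).
rewrite Cmod_sub_sym.
apply Rle_lt_trans with (Series m - sum_n m n).
- apply (cint_bound_const _ _ _ (cint_minus _ _ _ _ Hg (cint_csum f I n (fun k _ => Hf k)))).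
  intros u Hu. apply cser_tail; auto.
- rewrite sum_n_Reals. unfold Rdist in HN. apply Rabs_lt_between in HN. lra.
Qed.

Lemma Cpower_bound_series (e : R) (s : C) : 0 < e -> 3 <= Re s ->
  exists K, 0 < K /\ forall n z, INR n + e <= Re z -> Cmod (Cpower z (- s)%C) <=
    K * / (INR n + 1) ^ 2.
Proof.
intros He Hs. destruct (pow_bound_series e s He Hs) as (K & HK & H). exists K. split; [exact HK|].
intros n z Hz. apply Rle_trans with (2 := H n z Hz).
assert (Hp := pow_coef_bound s z 0 ltac:(generalize (pos_INR n); lra)).
replace (Cpower z (- s)) with (pow_coef s z 0); [exact Hp|].
unfold pow_coef. simpl. field; try (apply RtoC_neq0; lra).
Qed.

Lemma ex_series_scal_inv_sqr (K : R) : ex_series (fun n => K * / (INR n + 1) ^ 2).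
Proof. exact (ex_series_scal_l (K := R_AbsRing) (V := R_NormedModule) K _ ex_series_inv_sqr). Qed.

Lemma Cpower_succ (z s : C) : 0 < Re z -> Cpower z (1 - s)%C = (z * Cpower z (- s))%C.
Proof.
intros Hz. replace (1 - s)%C with (1 + - s)%C by ring. rewrite Cpower_add, Cpower_1; [reflexivity|].
apply Cpos_neq0, Hz.
Qed.

Lemma Cpower_succ' (z s : C) : 0 < Re z -> Cpower z (- s)%C = (z * Cpower z (- (s + 1)))%C.
Proof.
intros Hz. rewrite <- Cpower_succ by exact Hz. f_equal. ring.
Qed.

Lemma cint_Cpower (a h s : C) : 0 < Re a -> 0 < Re (a + h)%C ->
  cint (fun u => h * (- s * Cpower (a + RtoC u * h) (- (s + 1))))%C (Cpower (a + h) (- s) - Cpower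
    a (- s))%C.
Proof.
intros Ha Hh.
assert (Hp := fun u => seg_Re_lt 0 a h u Ha Hh).
apply (cint_FTC (fun z => Cpower z (- s)) (fun z => - s * Cpower z (- (s + 1)))%C).
- intros u Hu. apply cder_eq with (1 := cder_Cpower _ _ (Hp u Hu)).
  rewrite (Cpower_succ' _ s) by auto. field. apply Cpos_neq0; auto.
- intros u Hu. eapply cder_ccont. apply cder_scal, cder_Cpower; auto.
Qed.

(** For Re s > 1 this is the integral of z^(-s) from a to infinity. It carries the whole pole of
    zeta at s = 1. *)
Definition pole_part (s a : C) : C := (Cpower a (1 - s) / (s - 1))%C.

Lemma cint_pole_part (a h s : C) : 0 < Re a -> 0 < Re (a + h)%C -> s <> RtoC 1 ->
  cint (fun u => Cpower (a + RtoC u * h) (- s))%C (CInt (fun u =>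
    Cpower (a + RtoC u * h) (- s))%C) /\
  (pole_part s (a + h) - pole_part s a = - (h * CInt (fun u => Cpower (a + RtoC u * h) (- s))))%C.
Proof.
intros Ha Hh Hs.
assert (Hp := fun u => seg_Re_lt 0 a h u Ha Hh).
assert (Hc : cint (fun u => Cpower (a + RtoC u * h) (- s))%C (CInt (fun u =>
  Cpower (a + RtoC u * h) (- s))%C)).
{ apply (cint_ccont (fun z => Cpower z (- s))). intros u Hu. eapply cder_ccont, cder_Cpower; auto. }
split; [exact Hc|].
assert (Hs1 : (s - 1)%C <> 0).
{ intros E. apply Hs. replace s with (s - 1 + 1)%C by ring. rewrite E. ring. }
assert (H := cint_Cpower a h (s - 1)%C Ha Hh).
assert (H2 := cint_scal (h * - (s - 1))%C _ _ Hc).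
assert (H3 : cint (fun u => h * - (s - 1) * Cpower (a + RtoC u * h) (- s))%C (Cpower (a + h) (- (s
  - 1)) - Cpower a (- (s - 1)))%C).
{ revert H. apply cint_ext. intros u _. replace (s - 1 + 1)%C with s by ring. ring. }
assert (E := cint_unique _ _ _ H3 H2).
unfold pole_part. replace (1 - s)%C with (- (s - 1))%C by ring.
replace (Cpower (a + h) (- (s - 1)) / (s - 1) - Cpower a (- (s - 1)) / (s - 1))%C with
 ((Cpower (a + h) (- (s - 1)) - Cpower a (- (s - 1))) / (s - 1))%C by (field; exact Hs1).
rewrite E. field. exact Hs1.
Qed.

Lemma Cneq_re (x y : C) : Re x <> Re y -> x <> y.
Proof. intros H E; apply H; rewrite E; reflexivity. Qed.

Lemma cint_by_parts (a s : C) : 0 < Re a ->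
  cint (fun u => RtoC (1 - u) * (s * Cpower (a + RtoC u) (- (s + 1))) + Cpower (a + RtoC u) (-
    s))%C (Cpower a (- s)).
Proof.
intros Ha.
assert (Hp : forall u, 0 <= u <= 1 -> 0 < Re (a + RtoC u * 1)%C).
{ intros u Hu. replace (a + RtoC u * 1)%C with (a + RtoC u)%C by ring. rewrite Re_add, Re_RtoC.
  lra. }
(* The weight 1 - u is written as 1 + a - z at z = a + u, so that the integrand is the derivative of
   -(1 + a - z) z^(-s), a function of z as [cint_FTC] expects. *)
apply cint_ext with (fun u => 1 * ((1 + a - (a + RtoC u * 1)) * (s * Cpower (a + RtoC u * 1) (- (s
  + 1))) + Cpower (a + RtoC u * 1) (- s)))%C.
2: replace (Cpower a (- s)) with (- ((1 + a - (a + 1)) * Cpower (a + 1) (- s)) - - ((1 + a - a) *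
  Cpower a (- s)))%C by ring.
2: apply (cint_FTC (fun z => - ((1 + a - z) * Cpower z (- s)))%C
  (fun z => (1 + a - z) * (s * Cpower z (- (s + 1))) + Cpower z (- s))%C a 1).
- intros u _. replace (a + RtoC u * 1)%C with (a + RtoC u)%C by ring. rewrite RtoC_minus. ring.
- intros u Hu. specialize (Hp u Hu). set (z := (a + RtoC u * 1)%C) in *.
  assert (D1 : cder (fun z => 1 + a - z)%C z (- (1))%C).
  { apply cder_eq with (0 - 1)%C; [apply cder_minus; [apply cder_const|apply cder_id]|ring]. }
  apply cder_eq with (1 := cder_opp _ _ _ (cder_mult _ _ _ _ _ D1 (cder_Cpower z (- s)%C Hp))).
  rewrite (Cpower_succ' z s) by exact Hp. field. apply Cpos_neq0, Hp.
- intros u Hu. specialize (Hp u Hu). set (z := (a + RtoC u * 1)%C) in *.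
  eapply cder_ccont. apply cder_plus; [|apply cder_Cpower, Hp].
  apply cder_mult; [apply cder_minus; [apply cder_const|apply cder_id]|apply cder_scal,
    cder_Cpower, Hp].
Qed.

Lemma cint_scal_inv (k : C) (f : R -> C) (v : C) : k <> 0 -> cint (fun u => k * f u)%C v ->
  cint f (/ k * v)%C.
Proof.
intros Hk H. apply cint_ext with (2 := cint_scal (/ k) _ _ H). intros u _. field. exact Hk.
Qed.

(** Integrate by parts on each interval from n + a to n + a + 1. The boundary values (n + a)^(-s)
    sum to zeta s a, and the remaining integrals of z^(-s) are differences of pole parts, which
    telescope to [pole_part s a]. *)
Lemma Hurwitz_recursion (zeta : C -> C -> C) (s a : C) : is_Hurwitz_zeta zeta -> 4 < Re s ->
  0 < Re a ->
  cint (fun u => RtoC (1 - u) * zeta (s + 1) (a + RtoC u))%C (CInt (fun u =>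
    RtoC (1 - u) * zeta (s + 1) (a + RtoC u))%C) /\
  (s * CInt (fun u => RtoC (1 - u) * zeta (s + 1) (a + RtoC u)) = zeta s a - pole_part s a)%C.
Proof.
intros Hz Hs Ha.
assert (Hs0 : s <> 0) by (apply Cneq_re; rewrite Re_RtoC; lra).
assert (Hs1 : s <> RtoC 1) by (apply Cneq_re; rewrite Re_RtoC; lra).
assert (Hs1' : (s - 1)%C <> 0) by (apply Cneq_re; rewrite Re_sub, !Re_RtoC; lra).
assert (Hp : lip_path (Re a) (Cmod a + 1) (Cmod 1) (fun u => a + RtoC u * 1)%C).
{ apply seg_path; [split; [lra|lra]|]. split; [rewrite Re_add, Re_RtoC; lra|].
  apply Rle_trans with (1 := Cmod_triangle _ _). rewrite Cmod_1. lra. }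
destruct (family_path zeta (s + 1)%C (fun u => 1 - u) _ _ _ _ 
  (family_Hurwitz zeta (s + 1)%C Hz ltac:(rewrite Re_add, Re_RtoC;
    lra)) Ha weight_1m Hp) as (_ & Hi & _ & _).
assert (E : CInt (fun u => RtoC (1 - u) * zeta (s + 1) (a + RtoC u * 1))%C = CInt (fun u =>
  RtoC (1 - u) * zeta (s + 1) (a + RtoC u))%C).
{ apply CInt_ext. intros u _. do 2 f_equal. ring. }
rewrite E in Hi.
assert (Hi' : cint (fun u => RtoC (1 - u) * zeta (s + 1) (a + RtoC u))%C (CInt (fun u =>
  RtoC (1 - u) * zeta (s + 1) (a + RtoC u))%C)).
{ revert Hi. apply cint_ext. intros u _. do 2 f_equal. ring. }
split; [exact Hi'|].
set (v := CInt (fun u => RtoC (1 - u) * zeta (s + 1) (a + RtoC u))%C) in *.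
destruct (Cpower_bound_series (Re a) (s + 1)%C Ha) as (K & HK & HB); [rewrite Re_add, Re_RtoC;
  lra|].
set (b := fun n => (RtoC (INR n) + a)%C).
assert (Hb : forall n, 0 < Re (b n)) by (intros n; unfold b; rewrite Re_natp;
  generalize (pos_INR n); lra).
assert (Hb1 : forall n, (b n + 1)%C = b (S n)) by (intros n; unfold b; rewrite S_INR, RtoC_plus;
  ring).
set (I := fun n => (/ s * (Cpower (b n) (- s) + (pole_part s (b (S n)) - pole_part s (b n))))%C).
assert (HI : forall n, cint (fun u => RtoC (1 - u) * Cpower (b n + RtoC u) (- (s + 1)))%C (I n)).
{ intros n. unfold I. apply cint_scal_inv; [exact Hs0|].
  destruct (cint_pole_part (b n) 1 s (Hb n) ltac:(rewrite Hb1; apply Hb) Hs1) as [H1 H2].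
  rewrite Hb1 in H2. rewrite H2.
    assert (H3 := cint_minus _ _ _ _ (cint_by_parts (b n) s (Hb n)) H1).
  replace (Cpower (b n) (- s) + - (1 * CInt (fun u => Cpower (b n + RtoC u * 1) (- s))))%C
   with (Cpower (b n) (- s) - CInt (fun u => Cpower (b n + RtoC u * 1) (- s)))%C by ring.
  revert H3. apply cint_ext. intros u _. replace (b n + RtoC u * 1)%C with (b n + RtoC u)%C by
    ring. ring. }
assert (HsI : cser I v).
{ apply (cser_cint (fun n u => RtoC (1 - u) * Cpower (b n + RtoC u) (- (s + 1)))%C
    (fun u => RtoC (1 - u) * zeta (s + 1) (a + RtoC u))%C I v (fun n => K * / (INR n + 1) ^ 2)).
  - exact HI.
  - exact Hi'.
  - intros u Hu. apply cser_scal.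
    assert (H := proj1 (Hz (a + RtoC u)%C ltac:(rewrite Re_add, Re_RtoC;
      lra)) (s + 1)%C ltac:(rewrite Re_add, Re_RtoC; lra)).
    revert H. apply cser_ext. intros n. unfold b. f_equal. ring.
  - intros n u Hu. rewrite Cmod_Rmul by lra.
    assert (HBn := HB n (b n + RtoC u)%C ltac:(unfold b; rewrite Re_add, Re_natp, Re_RtoC; lra)).
    assert (Hge := Cmod_ge_0 (Cpower (b n + RtoC u) (- (s + 1)))). nra.
  - apply ex_series_scal_inv_sqr. }
apply (cser_unique (fun n => s * I n)%C); [apply cser_scal, HsI|].
assert (Hzs := proj1 (Hz a Ha) s ltac:(lra)).
apply cser_ext with (fun n => Cpower (b n) (- s) - (pole_part s (b n) - pole_part s (b (S n))))%C.
{ intros n. unfold I. field. exact Hs0. }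
apply cser_minus; [exact Hzs|].
assert (Htel : forall n, csum (fun n => pole_part s (b n) - pole_part s (b (S n)))%C n = (pole_part
  s a - pole_part s (b (S n)))%C).
{ induction n; [rewrite csum_0; f_equal; f_equal; unfold b; simpl; ring|]. rewrite csum_S, IHn.
  ring. }
apply cser_eps. intros eps He.
(* The end of the telescope has exponent 1 - s; bounding it requires Re (s - 1) >= 3, which is where
   4 < Re s enters. *)
destruct (Cpower_bound_series (Re a) (s - 1)%C Ha) as (K' & HK' & HB'); [rewrite Re_sub, Re_RtoC;
  lra|].
assert (Hm : 0 < Cmod (s - 1)%C) by (apply Cmod_gt_0, Hs1').
assert (He' : 0 < eps * Cmod (s - 1)%C / K') by (apply Rdiv_lt_0_compat;
  [apply Rmult_lt_0_compat|]; lra).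
destruct (archimed_cor1 _ He') as (N & HN & HN0). exists N. intros n Hn.
rewrite Htel.
replace (pole_part s a - pole_part s (b (S n)) - pole_part s a)%C with (- pole_part s (b (S n)))%C
  by ring.
rewrite Cmod_opp. unfold pole_part. rewrite Cmod_div by exact Hs1'.
replace (1 - s)%C with (- (s - 1))%C by ring.
assert (HBn := HB' (S n) (b (S n)) ltac:(unfold b; rewrite Re_natp; lra)).
apply Rmult_lt_reg_r with (Cmod (s - 1)%C); [exact Hm|].
unfold Rdiv. rewrite Rmult_assoc, Rinv_l, Rmult_1_r by lra.
apply Rle_lt_trans with (1 := HBn).
assert (HNn := le_INR _ _ Hn). assert (HNp : 0 < INR N) by (apply lt_0_INR; lia).
assert (H3 : / (INR (S n) + 1) ^ 2 <= / INR N).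
{ apply Rinv_le_contravar; [exact HNp|]. rewrite S_INR. nra. }
apply Rmult_lt_reg_r with (/ K'); [apply Rinv_0_lt_compat, HK'|].
replace (K' * / (INR (S n) + 1) ^ 2 * / K') with (/ (INR (S n) + 1) ^ 2) by (field; split;
  [lra|generalize (pos_INR (S n)); lra]).
unfold Rdiv in HN. lra.
Qed.

(** The fundamental theorem of calculus for each (n + z)^(-s) along the segment from a to a + h,
    then termwise integration under the majorant K / (n + 1)^2. *)
Lemma Hurwitz_translation (zeta : C -> C -> C) (s a h : C) : is_Hurwitz_zeta zeta -> 3 < Re s ->
  0 < Re a -> 0 < Re (a + h)%C ->
  cint (fun u => zeta (s + 1) (a + RtoC u * h))%C (CInt (fun u =>
    zeta (s + 1) (a + RtoC u * h))%C) /\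
  (zeta s (a + h) - zeta s a = - (s * (h * CInt (fun u => zeta (s + 1) (a + RtoC u * h)))))%C.
Proof.
intros Hz Hs Ha Hh.
destruct (Box_pair a (a + h)%C Ha Hh) as (e & R0 & He & Hba & Hbh).
assert (Hp := seg_path e R0 a h Hba Hbh).
destruct (family_path zeta (s + 1)%C (fun _ => 1) _ _ _ _ 
  (family_Hurwitz zeta (s + 1)%C Hz ltac:(rewrite Re_add, Re_RtoC;
    lra)) He weight_1 Hp) as (_ & Hi & _ & _).
assert (E : CInt (fun u => RtoC 1 * zeta (s + 1) (a + RtoC u * h))%C = CInt (fun u =>
  zeta (s + 1) (a + RtoC u * h))%C).
{ apply CInt_ext. intros u _. ring. }
rewrite E in Hi.
assert (Hi' : cint (fun u => zeta (s + 1) (a + RtoC u * h))%C (CInt (fun u =>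
  zeta (s + 1) (a + RtoC u * h))%C)).
{ revert Hi. apply cint_ext. intros u _. ring. }
split; [exact Hi'|].
destruct (Cpower_bound_series e (s + 1)%C He) as (K & HK & HB); [rewrite Re_add, Re_RtoC; lra|].
set (b := fun n => (RtoC (INR n) + a)%C).
assert (Hb : forall n u, 0 <= u <= 1 -> INR n + e <= Re (b n + RtoC u * h)%C).
{ intros n u Hu. unfold b. destruct Hba as [Hba _]; destruct Hbh as [Hbh _]. apply seg_Re_le.
  - rewrite Re_natp; lra.
  - replace (RtoC (INR n) + a + h)%C with (RtoC (INR n) + (a + h))%C by ring. rewrite Re_natp; lra.
  - exact Hu. }
assert (HI : forall n, cint (fun u => (- (s * h)) * Cpower (b n + RtoC u * h) (- (s + 1)))%C
  (Cpower (b n + h) (- s) - Cpower (b n) (- s))%C).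
{ intros n. assert (Hn := pos_INR n).
  assert (H1 : 0 < Re (b n)) by (unfold b; rewrite Re_natp; lra).
  assert (H2 : 0 < Re (b n + h)%C).
  { unfold b. replace (RtoC (INR n) + a + h)%C with (RtoC (INR n) + (a + h))%C by ring.
    rewrite Re_natp; lra. }
  apply cint_ext with (2 := cint_Cpower (b n) h s H1 H2). intros u _. ring. }
apply (cser_unique (fun n => Cpower (b n + h) (- s) - Cpower (b n) (- s))%C).
- apply cser_minus.
  + assert (H := proj1 (Hz (a + h)%C Hh) s ltac:(lra)).
    revert H. apply cser_ext. intros n. unfold b. f_equal. ring.
  + apply (Hz a Ha). lra.
- replace (- (s * (h * CInt (fun u => zeta (s + 1) (a + RtoC u * h)))))%C
   with ((- (s * h)) * CInt (fun u => zeta (s + 1) (a + RtoC u * h)))%C by ring.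
  apply (cser_cint (fun n u => (- (s * h)) * Cpower (b n + RtoC u * h) (- (s + 1)))%C
    (fun u => (- (s * h)) * zeta (s + 1) (a + RtoC u * h))%C _ _ (fun n =>
      Cmod (s * h)%C * K * / (INR n + 1) ^ 2)).
  + exact HI.
  + apply cint_scal, Hi'.
  + intros u Hu. apply cser_scal.
    assert (H := proj1 (Hz (a + RtoC u * h)%C ltac:(apply seg_Re_lt;
      assumption)) (s + 1)%C ltac:(rewrite Re_add, Re_RtoC; lra)).
    revert H. apply cser_ext. intros n. unfold b. f_equal. ring.
  + intros n u Hu. rewrite Cmod_mult, Cmod_opp, Rmult_assoc. apply Rmult_le_compat_l;
      [apply Cmod_ge_0|].
    apply HB, Hb, Hu.
  + apply ex_series_scal_inv_sqr.
Qed.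

Lemma cser_shift (a : nat -> C) (l : C) : cser a l -> cser (fun n => a (S n)) (l - a O)%C.
Proof.
intros H. apply cser_eps. intros eps He. destruct (proj1 (cser_eps _ _) H eps He) as [N HN].
exists N. intros n Hn. specialize (HN (S n) ltac:(lia)). rewrite csum_shift in HN.
replace (csum (fun n => a (S n)) n - (l - a O))%C with (a O + csum (fun n =>
  a (S n)) n - l)%C by ring. exact HN.
Qed.

Lemma Hurwitz_shift_base (zeta : C -> C -> C) (s a : C) : is_Hurwitz_zeta zeta -> 1 < Re s ->
  0 < Re a ->
  zeta s (a + 1)%C = (zeta s a - Cpower a (- s))%C.
Proof.
intros Hz Hs Ha.
assert (H1 := proj1 (Hz a Ha) s Hs).
assert (H2 := proj1 (Hz (a + 1)%C ltac:(rewrite Re_add, Re_RtoC; lra)) s Hs).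
apply (cser_unique _ _ _ H2).
assert (H3 := cser_shift _ _ H1). cbv beta in H3.
replace (RtoC (INR 0) + a)%C with a in H3 by (simpl; ring).
revert H3. apply cser_ext. intros n. f_equal. rewrite S_INR, RtoC_plus. ring.
Qed.

(** * The entire part of the Hurwitz zeta function *)

Lemma analytic_inv_sub1 (s : C) : s <> RtoC 1 -> C_analytic_at (fun s => / (s - 1))%C s.
Proof.
intros Hs. set (w := (s - 1)%C).
assert (Hw : w <> 0).
{ intros E. apply Hs. replace s with (w + 1)%C by (unfold w; ring). rewrite E. ring. }
assert (Hm : 0 < Cmod w) by (apply Cmod_gt_0, Hw).
apply analytic_intro with (fun k => / w * (- / w) ^ k)%C (Cmod w); [exact Hm|].
intros h Hh. replace (s + h - 1)%C with (w + h)%C by (unfold w; ring).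
assert (Hwh : (w + h)%C <> 0) by (apply Cmod_gt_0; generalize (Cmod_tri_rev w h); lra).
set (q := Cmod h / Cmod w).
assert (Hq : 0 <= q < 1) by (apply Cmod_ratio; assumption).
apply cps_of_remainder with (/ Cmod (w + h)%C * q) q; [exact Hq|]. intros n.
assert (E : (/ (w + h) - csum (fun k => / w * (- / w) ^ k * h ^ k) n = / (w + h) * (- (h / w)) ^ S
  n)%C).
{ induction n.
  - rewrite csum_0. simpl. field. auto.
  - rewrite csum_S. replace (/ (w + h) - (csum (fun k => / w * (- / w) ^ k * h ^ k) n + / w * (- /
      w) ^ S n * h ^ S n))%C
     with ((/ (w + h) - csum (fun k => / w * (- / w) ^ k * h ^ k) n) - / w * (- / w) ^ S n * h ^ S
       n)%C by ring.
    rewrite IHn. replace (/ w * (- / w) ^ S n * h ^ S n)%C with (/ w * (- (h / w)) ^ S n)%C.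
    + rewrite (Cpow_S _ (S n)). field. auto.
    + rewrite <- Cmult_assoc, <- Cpow_mult_l. do 2 f_equal. field. exact Hw. }
rewrite E, Cmod_mult, Cmod_inv, Cmod_pow, Cmod_opp, Cmod_div by assumption. fold q. simpl. right;
  ring.
Qed.

(** The pole part at a = 1 is 1 / (s - 1), and its increment from 1 to a is -(a - 1) times an
    integral of powers, which is analytic in s by [family_path]. No product of power series is
    formed. *)
Lemma analytic_pole_part (a s : C) : 0 < Re a -> s <> RtoC 1 -> C_analytic_at (fun s =>
  pole_part s a) s.
Proof.
intros Ha Hs.
destruct (Box_pair 1 a ltac:(rewrite Re_RtoC; lra) Ha) as (e & R0 & He & H1 & H2).
rewrite <- (Cadd_sub 1 a) in H2.
assert (Hf := family_path (fun s a => Cpower a (- s)) s (fun _ =>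
  1) _ _ _ _ (family_Cpower s) He weight_1 (seg_path e R0 1 (a - 1)%C H1 H2)).
assert (Hw : (s - 1)%C <> 0).
{ intros E. apply Hs. replace s with (s - 1 + 1)%C by ring. rewrite E. ring. }
assert (Hm : 0 < Cmod (s - 1)%C) by (apply Cmod_gt_0, Hw).
apply analytic_ext with (fun s => / (s - 1) + (- (a - 1)) * CInt (fun u =>
  RtoC 1 * Cpower (1 + RtoC u * (a - 1)) (- s)))%C (Cmod (s - 1)%C); [exact Hm| |].
- intros y Hy.
  assert (Hy1 : y <> RtoC 1).
  { intros E. rewrite E, Cmod_sub_sym in Hy. lra. }
  destruct (cint_pole_part 1 (a - 1)%C y ltac:(rewrite Re_RtoC; lra) ltac:(rewrite Cadd_sub;
    exact Ha) Hy1) as [_ E].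
  rewrite Cadd_sub in E.
  replace (pole_part y a) with (pole_part y 1 + (pole_part y a - pole_part y 1))%C by ring.
    rewrite E.
  assert (E1 : pole_part y 1 = (/ (y - 1))%C).
  { unfold pole_part, Cpower. rewrite Clog_RtoC, ln_1 by lra.
    replace ((1 - y) * RtoC 0)%C with (RtoC 0) by ring.
    rewrite Cexp_0. unfold Cdiv. ring. }
  rewrite E1. rewrite (CInt_ext (fun u => RtoC 1 * Cpower (1 + RtoC u * (a - 1)) (- y))%C (fun u =>
    Cpower (1 + RtoC u * (a - 1)) (- y))%C) by (intros; ring).
  ring.
- apply analytic_plus; [apply analytic_inv_sub1, Hs|]. apply analytic_scal. apply Hf.
Qed.

(* The segment along which the identity theorem is applied starts strictly above or below the real
   axis, on the same side as [s], so that it avoids 1. *)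
Lemma identity_punctured (f : C -> C) (A B : R) (s : C) :
  (forall z, A < Re z -> z <> RtoC 1 -> C_analytic_at f z) -> (forall z, B < Re z -> f z = 0) ->
  A < Re s -> s <> RtoC 1 -> f s = 0.
Proof.
intros Ha H0 Hs Hs1. set (x := Rmax A B + 1). assert (Hm1 := Rmax_l A B). assert (Hm2 :=
  Rmax_r A B).
assert (Hex : exists y, 0 < y * y /\ forall u, 0 <= u < 1 -> y + u * (Im s - y) <> 0).
{ destruct (Rle_lt_dec 0 (Im s)).
  - exists 1. split; [lra|]. intros u Hu. assert (0 <= u * Im s) by (apply Rmult_le_pos; lra). lra.
  - exists (-1). split; [lra|]. intros u Hu. assert (u * Im s <= 0) by nra. lra. }
destruct Hex as (y & Hy & Hu).
set (z := (x, y) : C).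
rewrite <- (Cadd_sub z s). apply identity_segment.
- intros u Hu01. apply Ha.
  + apply seg_Re_lt; [simpl; unfold x; lra|rewrite Cadd_sub; exact Hs|exact Hu01].
  + destruct (Req_dec u 1) as [->|Hn]; [replace (z + RtoC 1 * (s - z))%C with s by ring;
      exact Hs1|].
    intros E. apply (Hu u ltac:(lra)). apply (f_equal Im) in E. rewrite Im_RtoC in E.
    apply eq_trans with (2 := E). destruct s. simpl. ring.
- exists 1. split; [lra|]. intros w Hw. apply H0. assert (H1 := re_le_Cmod (w - z)%C).
  apply Rabs_le_between in H1. rewrite Re_sub in H1. change (Re z) with x in H1. unfold x in *. lra.
Qed.

Lemma Hurwitz_shift (zeta : C -> C -> C) (s a : C) : is_Hurwitz_zeta zeta -> 0 < Re a ->
  s <> RtoC 1 ->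
  zeta s (a + 1)%C = (zeta s a - Cpower a (- s))%C.
Proof.
intros Hz Ha Hs.
assert (Ha1 : 0 < Re (a + 1)%C) by (rewrite Re_add, Re_RtoC; lra).
assert (E : (zeta s (a + 1) - (zeta s a - Cpower a (- s)) = 0)%C).
{ apply (identity_punctured (fun s => zeta s (a + 1) - (zeta s a - Cpower a (- s)))%C (Re s - 1) 1
  s); [| |lra|exact Hs].
  - intros z _ Hz1. apply analytic_minus; [apply (Hz _ Ha1), Hz1|]. apply analytic_minus;
      [apply (Hz _ Ha), Hz1|].
    apply (family_analytic (fun s a => Cpower a (- s)) z a (family_Cpower z) Ha).
  - intros z Hz1. rewrite Hurwitz_shift_base by auto. ring. }
replace (zeta s (a + 1)%C) with (zeta s (a + 1) - (zeta s a - Cpower a (- s)) + (zeta s a - Cpower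
  a (- s)))%C by ring.
rewrite E. ring.
Qed.

Lemma family_ext (F G : C -> C -> C) (s0 : C) : (forall s a, 0 < Re a -> F s a = G s a) ->
  analytic_family F s0 -> analytic_family G s0.
Proof.
intros E H e R0 He. destruct (H e R0 He) as (r & M & c & Hr & H1 & H2 & H3).
exists r, M, c. repeat split; auto. intros a h Ha Hh. rewrite <- E by (destruct Ha; lra). auto.
Qed.

(** The share of the pole part in the Taylor formula: [pole_part (s + 1) z] is z^(-s) / s, and the
    factor s in front of the integral cancels the denominator. *)
Definition pow_mean (s a : C) : C := CInt (fun u => RtoC (1 - u) * Cpower (a + RtoC u) (- s))%C.

Lemma family_pow_mean (s0 : C) : analytic_family pow_mean s0.
Proof.
apply family_ext with (fun s a => CInt (fun u => RtoC (1 - u) * Cpower (a + RtoC u) (- (s + 0)))%C).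
- intros s a _. apply CInt_ext. intros u _. do 3 f_equal. ring.
- apply (family_int (fun s a => Cpower a (- s)) s0 0 (fun u => 1 - u));
    [apply family_Cpower|apply weight_1m].
Qed.

Lemma unit_path (a : C) : lip_path (Re a) (Cmod a + 1) 1 (fun u => a + RtoC u)%C.
Proof.
split; [intros u Hu; apply Box_plus_unit; [apply Box_self|exact Hu]|]. intros u v _ _.
replace (a + RtoC u - (a + RtoC v))%C with (RtoC (u - v)) by (rewrite RtoC_minus; ring).
rewrite Cmod_R. right; ring.
Qed.

(* For [Y s a = zeta s a - a^(1-s) / (s - 1)], Taylor's formula
   [zeta s a = a^(1-s) / (s - 1) + s * int_0^1 (1 - u) * zeta (s + 1) (a + u) du] reads
   [Y = next_strip Y]; its right-hand side continues [Y] one unit further to the left. *)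
Definition next_strip (Y : C -> C -> C) (s a : C) : C :=
  (pow_mean s a + s * CInt (fun u => RtoC (1 - u) * Y (s + 1) (a + RtoC u)))%C.

Lemma family_next_strip (Y : C -> C -> C) (s0 : C) : analytic_family Y (s0 + 1)%C ->
  analytic_family (next_strip Y) s0.
Proof.
intros H. apply family_plus; [apply family_pow_mean|].
apply (family_mul_id (fun s a => CInt (fun u => RtoC (1 - u) * Y (s + 1) (a + RtoC u))%C)).
apply (family_int Y s0 1 (fun u => 1 - u) H weight_1m).
Qed.

Lemma next_strip_base (zeta Y : C -> C -> C) (s a : C) : is_Hurwitz_zeta zeta -> 4 < Re s ->
  0 < Re a ->
  (forall b, 0 < Re b -> zeta (s + 1)%C b = (Y (s + 1) b + pole_part (s + 1) b)%C) ->
  next_strip Y s a = (zeta s a - pole_part s a)%C.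
Proof.
intros Hz Hs Ha HY. assert (Hs0 : s <> 0) by (apply Cneq_re; rewrite Re_RtoC; lra).
destruct (Hurwitz_recursion zeta s a Hz Hs Ha) as [H1 H2].
destruct (family_path (fun s a => Cpower a (- s)) s (fun u =>
  1 - u) _ _ _ _ (family_Cpower s) Ha weight_1m (unit_path a)) as (_ & H3 & _ & _).
rewrite <- H2. unfold next_strip, pow_mean.
assert (H4 := cint_minus _ _ _ _ H1 (cint_scal (/ s) _ _ H3)).
rewrite (CInt_eq _ (fun u => RtoC (1 - u) * Y (s + 1) (a + RtoC u))%C _ H4).
- field. exact Hs0.
- intros u Hu. cbv beta. rewrite HY by (rewrite Re_add, Re_RtoC; lra).
  unfold pole_part. replace (1 - (s + 1))%C with (- s)%C by ring.
    replace (s + 1 - 1)%C with s by ring. field. exact Hs0.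
Qed.

Lemma entire_part_base (zeta : C -> C -> C) (N : nat) : is_Hurwitz_zeta zeta -> exists Y : C ->
  C -> C,
  (forall s, 4 - INR N < Re s -> analytic_family Y s) /\
  (forall s a, 4 < Re s -> 0 < Re a -> zeta s a = (Y s a + pole_part s a)%C).
Proof.
intros Hz. induction N as [|N (Y & H1 & H2)].
(* By [Hurwitz_recursion] this is zeta minus its pole part. Written as an integral of zeta, it is an
   analytic family by [family_int], and the pole part never has to be treated as a family. *)
- exists (fun s a => s * CInt (fun u => RtoC (1 - u) * zeta (s + 1) (a + RtoC u)))%C. split.
  + intros s Hs. simpl in Hs.
    apply (family_mul_id (fun s a => CInt (fun u => RtoC (1 - u) * zeta (s + 1) (a + RtoC u))%C)).
    apply (family_int zeta s 1 (fun u => 1 - u)); [|apply weight_1m].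
    apply family_Hurwitz; [exact Hz|]. rewrite Re_add, Re_RtoC. lra.
  + intros s a Hs Ha. destruct (Hurwitz_recursion zeta s a Hz Hs Ha) as [_ E]. rewrite E. ring.
- exists (next_strip Y). split.
  + intros s Hs. apply family_next_strip, H1. rewrite Re_add, Re_RtoC. rewrite S_INR in Hs. lra.
  + intros s a Hs Ha. rewrite (next_strip_base zeta Y s a Hz Hs Ha); [ring|].
    intros b Hb. apply H2; [rewrite Re_add, Re_RtoC; lra|exact Hb].
Qed.

(** Only the clause comparing Y with zeta excludes s = 1. The recursion and the translation identity
    hold throughout the half-plane, in particular at s = 0, where the value of Y at 1 appears. *)
Definition entire_part (zeta Y : C -> C -> C) (A : R) : Prop :=
  (forall s, A < Re s -> analytic_family Y s) /\
  (forall s a, A < Re s -> 0 < Re a -> s <> RtoC 1 -> zeta s a = (Y s a + pole_part s a)%C) /\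
  (forall s a, A < Re s -> 0 < Re a -> Y s a = next_strip Y s a) /\
  (forall s a h, A < Re s -> 0 < Re a -> 0 < Re (a + h)%C ->
     (Y s (a + h) - Y s a = - (s * (h * CInt (fun u => Y (s + 1) (a + RtoC u * h)))))%C).

(** Each clause is known for Re s > 4 and continued to Re s > A: on the punctured half-plane for the
    comparison with zeta, on the full one for the identities between values of Y. *)
Lemma entire_part_exists (zeta : C -> C -> C) (A : R) : is_Hurwitz_zeta zeta -> exists Y,
  entire_part zeta Y A.
Proof.
(* S N exceeds |A| + 5, which puts the abscissa 4 - S N to the left of A. *)
intros Hz. destruct (nfloor_ex (Rabs A + 5)) as (N & HN); [generalize (Rabs_pos A); lra|].
destruct (entire_part_base zeta (S N) Hz) as (Y & H1 & H2).
assert (H1' : forall s, A < Re s -> analytic_family Y s).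
{ intros s Hs. apply H1. rewrite S_INR. assert (H := Rabs_maj2 A). lra. }
exists Y. split; [exact H1'|]. split; [|split].
- intros s a Hs Ha Hs1.
  assert (E : (zeta s a - (Y s a + pole_part s a) = 0)%C).
  { apply (identity_punctured (fun s => zeta s a - (Y s a + pole_part s a))%C A 4 s); [|
    |exact Hs|exact Hs1].
    - intros z HzA Hz1. apply analytic_minus; [apply (Hz _ Ha), Hz1|]. apply analytic_plus.
      + apply (family_analytic Y z a); auto.
      + apply analytic_pole_part; assumption.
    - intros z Hz4. rewrite <- H2 by auto. ring. }
  replace (zeta s a) with (zeta s a - (Y s a + pole_part s a) + (Y s a + pole_part s a))%C by ring.
    rewrite E; ring.
- intros s a Hs Ha.
  assert (E : (Y s a - next_strip Y s a = 0)%C).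
  { apply (identity_halfplane (fun s => Y s a - next_strip Y s a)%C A 4 s); [| |exact Hs].
    - intros z HzA. apply analytic_minus; [apply (family_analytic Y z a); auto|].
      apply (family_analytic (next_strip Y) z a); auto. apply family_next_strip, H1'.
        rewrite Re_add, Re_RtoC. lra.
    - intros z Hz4. rewrite (next_strip_base zeta Y z a Hz Hz4 Ha); [rewrite H2 by auto; ring|].
      intros b Hb. apply H2; [rewrite Re_add, Re_RtoC; lra|exact Hb]. }
  replace (Y s a) with (Y s a - next_strip Y s a + next_strip Y s a)%C by ring. rewrite E; ring.
- intros s a h Hs Ha Hh.
  destruct (Box_pair a (a + h)%C Ha Hh) as (e & R0 & He & Hba & Hbh).
  assert (Hp := seg_path e R0 a h Hba Hbh).
  assert (E : (Y s (a + h) - Y s a - - (s * (h * CInt (fun u =>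
    RtoC 1 * Y (s + 1) (a + RtoC u * h)))) = 0)%C).
  { apply (identity_halfplane (fun s => Y s (a + h) - Y s a - - (s * (h * CInt (fun u =>
    RtoC 1 * Y (s + 1) (a + RtoC u * h)))))%C A 4 s); [| |exact Hs].
    - intros z HzA. apply analytic_minus; [apply analytic_minus; apply (family_analytic Y z);
        auto|].
      apply analytic_ext with (fun s => (- h) * (s * CInt (fun u =>
        RtoC 1 * Y (s + 1) (a + RtoC u * h))))%C 1; [lra|intros; ring|].
      apply analytic_scal, analytic_mul_id.
      apply (analytic_shift (fun s => CInt (fun u => RtoC 1 * Y s (a + RtoC u * h))%C)).
      apply (family_path Y (z + 1)%C (fun _ => 1) _ e R0 (Cmod h)); auto; [apply H1';
        rewrite Re_add, Re_RtoC; lra|apply weight_1].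
    - intros z Hz4.
      assert (Hz0 : z <> 0) by (apply Cneq_re; rewrite Re_RtoC; lra).
      assert (Hz1 : z <> RtoC 1) by (apply Cneq_re; rewrite Re_RtoC; lra).
      destruct (Hurwitz_translation zeta z a h Hz ltac:(lra) Ha Hh) as [T1 T2].
      destruct (cint_pole_part a h z Ha Hh Hz1) as [P1 P2].
      assert (T3 := cint_minus _ _ _ _ T1 (cint_scal (/ z) _ _ P1)).
      rewrite (CInt_eq _ (fun u => RtoC 1 * Y (z + 1) (a + RtoC u * h))%C _ T3).
      + rewrite !H2 in T2 by auto.
        replace (Y z (a + h) - Y z a)%C with ((Y z (a + h) + pole_part z (a + h) - (Y z a +
          pole_part z a)) - (pole_part z (a + h) - pole_part z a))%C by ring.
        rewrite T2, P2. field. exact Hz0.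
      + intros u Hu. cbv beta. rewrite H2 by (try rewrite Re_add, Re_RtoC; try lra;
          apply seg_Re_lt; assumption).
        unfold pole_part. replace (1 - (z + 1))%C with (- z)%C by ring.
          replace (z + 1 - 1)%C with z by ring. field. exact Hz0. }
  rewrite (CInt_ext (fun u => RtoC 1 * Y (s + 1) (a + RtoC u * h))%C (fun u =>
    Y (s + 1) (a + RtoC u * h))%C) in E by (intros; ring).
  match type of E with (?x - ?y = _)%C => replace x with (x - y + y)%C by ring end. rewrite E. ring.
Qed.

Definition dY (Y : C -> C -> C) (s a : C) : C := C_derive (fun s => Y s a) s.

Lemma entire_part_cint (zeta Y : C -> C -> C) (A : R) (s a h : C) : entire_part zeta Y A ->
  A < Re s -> 0 < Re a -> 0 < Re (a + h)%C ->
  cint (fun u => Y s (a + RtoC u * h))%C (CInt (fun u => Y s (a + RtoC u * h))%C) /\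
  cint (fun u => dY Y s (a + RtoC u * h))%C (CInt (fun u => dY Y s (a + RtoC u * h))%C) /\
  cder (fun s => CInt (fun u => Y s (a + RtoC u * h))%C) s (CInt (fun u =>
    dY Y s (a + RtoC u * h))%C).
Proof.
intros (H1 & _) Hs Ha Hh.
destruct (Box_pair a (a + h)%C Ha Hh) as (e & R0 & He & Hba & Hbh).
destruct (family_path Y s (fun _ => 1) _ e R0 _ (H1 s Hs) He weight_1 (seg_path e R0 a h Hba Hbh))
  as (_ & G1 & G2 & G3).
assert (E : forall s, CInt (fun u => RtoC 1 * Y s (a + RtoC u * h))%C = CInt (fun u =>
  Y s (a + RtoC u * h))%C) by (intros; apply CInt_ext; intros; ring).
assert (E' : CInt (fun u => RtoC 1 * C_derive (fun s => Y s (a + RtoC u * h)%C) s)%C = CInt (fun u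
  => dY Y s (a + RtoC u * h))%C) by (intros; apply CInt_ext; intros; unfold dY; ring).
rewrite E in G1. rewrite E' in G2, G3. split; [|split].
- revert G1. apply cint_ext. intros; ring.
- revert G2. apply cint_ext. intros; unfold dY; ring.
- revert G3. apply cder_ext. intros y. apply E.
Qed.

(** The translation identity differentiated in s. The product rule applied to its factor s leaves a
    term with Y (s + 1) undifferentiated. *)
Lemma entire_part_dtrans (zeta Y : C -> C -> C) (A : R) (s a h : C) : entire_part zeta Y A ->
  A < Re s -> 0 < Re a -> 0 < Re (a + h)%C ->
  (dY Y s (a + h) - dY Y s a = - (h * CInt (fun u => Y (s + 1) (a + RtoC u * h)) + s * (h * CInt
    (fun u => dY Y (s + 1) (a + RtoC u * h)))))%C.
Proof.
intros HY Hs Ha Hh. destruct (HY) as (H1 & _ & _ & H4).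
assert (D1 : forall b, 0 < Re b -> cder (fun s => Y s b) s (dY Y s b)).
{ intros b Hb. apply analytic_cder, family_analytic; auto. }
destruct (entire_part_cint zeta Y A (s + 1)%C a h HY ltac:(rewrite Re_add, Re_RtoC;
  lra) Ha Hh) as (_ & _ & D2).
assert (D3 := cder_comp (fun s => CInt (fun u => Y s (a + RtoC u * h))%C) (fun s =>
  s + 1)%C s _ _ D2 (cder_plus _ _ _ _ _ (cder_id s) (cder_const 1 s))).
assert (D4 := cder_opp _ _ _ (cder_mult _ _ _ _ _ (cder_id s) (cder_scal h _ _ _ D3))).
assert (D5 := cder_minus _ _ _ _ _ (D1 _ Hh) (D1 _ Ha)).
assert (D6 : cder (fun s => Y s (a + h)%C - Y s a)%C s (- (1 * (h * CInt (fun u =>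
  Y (s + 1) (a + RtoC u * h))) + s * (h * ((1 + 0) * CInt (fun u =>
    dY Y (s + 1) (a + RtoC u * h))))))%C).
{ apply cder_ext_loc with (3 := D4) (d := Re s - A); [lra|].
  intros y Hy. symmetry. apply H4; auto. assert (Hr := re_le_Cmod (y - s)%C).
    apply Rabs_le_between in Hr.
  rewrite Re_sub in Hr. lra. }
apply cder_C_derive in D5. apply cder_C_derive in D6. rewrite D5 in D6. rewrite D6. ring.
Qed.

Lemma ball_Re_pos (a h : C) : Cmod h < Re a / 2 -> Re a / 2 <= Re (a + h)%C.
Proof. intros H. rewrite Re_add. assert (Hr := re_le_Cmod h). apply Rabs_le_between in Hr. lra. Qed.

Lemma entire_part_lip (zeta Y : C -> C -> C) (A : R) (s a : C) : entire_part zeta Y A ->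
  A < Re s -> 0 < Re a ->
  exists K, forall h, Cmod h < Re a / 2 ->
   Cmod (Y s (a + h) - Y s a)%C <= K * Cmod h /\ Cmod (dY Y s (a + h) - dY Y s a)%C <= K * Cmod h.
Proof.
intros (H1 & _) Hs Ha.
destruct (family_lip Y s (Re a / 2) (Cmod a + Re a) (H1 s Hs) ltac:(lra)) as [K HK].
exists K. intros h Hh.
assert (E : (a + h - a)%C = h) by ring. rewrite <- E at 2 4.
apply HK; split.
- apply ball_Re_pos, Hh.
- apply Rle_trans with (1 := Cmod_triangle _ _). lra.
- lra.
- lra.
Qed.

(** Increments in a are integrals of Lipschitz functions, so [cder_of_cint] applies. The stray term
    - Y (s + 1) a in the second derivative is what the digamma term of [g] later compensates. *)
Lemma cder_entire_part (zeta Y : C -> C -> C) (A : R) (s a : C) : entire_part zeta Y A ->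
  A < Re s -> 0 < Re a ->
  cder (fun a => Y s a) a (- (s * Y (s + 1) a))%C /\
  cder (fun a => dY Y s a) a (- (Y (s + 1) a + s * dY Y (s + 1) a))%C.
Proof.
intros HY Hs Ha.
assert (Hs1 : A < Re (s + 1)%C) by (rewrite Re_add, Re_RtoC; lra).
destruct (entire_part_lip zeta Y A (s + 1)%C a HY Hs1 Ha) as [K HK].
assert (Hs0 := Cmod_ge_0 s).
split.
- apply (cder_of_cint _ (fun a => - (s * Y (s + 1) a))%C a (Re a / 2) (Cmod s * K)); [lra| |].
  + intros h Hh. assert (Hh' := ball_Re_pos a h Hh).
    destruct (entire_part_cint zeta Y A (s + 1)%C a h HY Hs1 Ha ltac:(lra)) as (G1 & _ & _).
    exists (- s * CInt (fun u => Y (s + 1) (a + RtoC u * h)))%C. split.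
    * apply cint_ext with (2 := cint_scal (- s)%C _ _ G1). intros; ring.
    * destruct HY as (_ & _ & _ & H4). assert (E := H4 s a h Hs Ha ltac:(lra)).
      replace (Y s (a + h)%C) with (Y s (a + h) - Y s a + Y s a)%C by ring. rewrite E. ring.
  + intros h Hh. replace (- (s * Y (s + 1) (a + h)) - - (s * Y (s + 1) a))%C with (- (s * (Y (s +
      1) (a + h) - Y (s + 1) a)))%C by ring.
    rewrite Cmod_opp, Cmod_mult, Rmult_assoc. apply Rmult_le_compat_l; [exact Hs0|]. apply HK, Hh.
- apply (cder_of_cint _ (fun a => - (Y (s + 1) a + s * dY Y (s + 1) a))%C a (Re a / 2) (K + Cmod s
    * K)); [lra| |].
  + intros h Hh. assert (Hh' := ball_Re_pos a h Hh).
    destruct (entire_part_cint zeta Y A (s + 1)%C a h HY Hs1 Ha ltac:(lra)) as (G1 & G2 & _).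
    exists (- (1) * (CInt (fun u => Y (s + 1) (a + RtoC u * h)) + s * CInt (fun u =>
      dY Y (s + 1) (a + RtoC u * h))))%C. split.
    * apply cint_ext with (2 := cint_scal (- (1))%C _ _ (cint_plus _ _ _ _ G1 (cint_scal s _ _
        G2))). intros; ring.
    * assert (E := entire_part_dtrans zeta Y A s a h HY Hs Ha ltac:(lra)).
      replace (dY Y s (a + h)%C) with (dY Y s (a + h) - dY Y s a + dY Y s a)%C by ring. rewrite E.
        ring.
  + intros h Hh. destruct (HK h Hh) as [K1 K2].
    replace (- (Y (s + 1) (a + h) + s * dY Y (s + 1) (a + h)) - - (Y (s + 1) a + s * dY Y (s + 1)
      a))%C
     with (- ((Y (s + 1) (a + h) - Y (s + 1) a) + s * (dY Y (s + 1) (a + h) - dY Y (s + 1) a)))%C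
       by ring.
    rewrite Cmod_opp. apply Rle_trans with (1 := Cmod_triangle _ _). rewrite Cmod_mult,
      Rmult_plus_distr_r.
    apply Rplus_le_compat; [exact K1|]. rewrite Rmult_assoc. apply Rmult_le_compat_l;
      [exact Hs0|exact K2].
Qed.

(** * Euler's integral on the real half-line *)

Definition gamma_integrand (p x : R) : R := Rpower x (p - 1) * exp (- x).

Lemma gamma_integrand_pos (p x : R) : 0 < gamma_integrand p x.
Proof. apply Rmult_lt_0_compat; apply exp_pos. Qed.

Lemma ln_le_sub1 (y : R) : 0 < y -> ln y <= y - 1.
Proof.
intros Hy. assert (H := exp_ineq1_le (ln y)). rewrite exp_ln in H by exact Hy. lra.
Qed.

(** The tangent of ln at 2p gives p ln x <= x/2 - p + p ln (2p); half of the exponential decay thus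
    absorbs the power of x, at the cost of the constant (2p)^p. *)
Definition gamma_const (p : R) : R := exp (p * ln (2 * p)).

Lemma gamma_integrand_le (p x : R) : 1 <= p -> 0 < x ->
  gamma_integrand p x <= gamma_const p * exp (- (x / 2)).
Proof.
intros Hp Hx. unfold gamma_integrand, gamma_const, Rpower. rewrite <- !exp_plus.
  apply exp_le_compat.
assert (H2p : 0 <= ln (2 * p)) by (rewrite <- ln_1; apply ln_le; lra).
assert (H2p' : 0 <= p * ln (2 * p)) by (apply Rmult_le_pos; lra).
destruct (Rle_lt_dec (ln x) 0) as [h|h]; [nra|].
assert (H := ln_le_sub1 (x / (2 * p)) ltac:(apply Rdiv_lt_0_compat; lra)).
rewrite ln_div in H by lra.
assert (H1 : p * ln x <= p * (x / (2 * p) - 1 + ln (2 * p))) by (apply Rmult_le_compat_l; lra).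
replace (p * (x / (2 * p) - 1 + ln (2 * p))) with (x / 2 - p + p * ln (2 * p)) in H1 by (field;
  lra).
lra.
Qed.

Lemma continuous_gamma_integrand (p x : R) : 0 < x -> continuous (gamma_integrand p) x.
Proof.
intros Hx. apply (ex_derive_continuous (K := R_AbsRing) (V := R_NormedModule)).
unfold gamma_integrand, Rpower. auto_derive. exact Hx.
Qed.

Lemma ex_RInt_gamma (p a b : R) : 0 < a <= b -> ex_RInt (gamma_integrand p) a b.
Proof.
intros H. apply (ex_RInt_continuous (V := R_CompleteNormedModule)). intros z.
rewrite Rmin_left by lra. intros Hz. apply continuous_gamma_integrand. lra.
Qed.

Lemma RInt_gamma_mono (p a b a' b' : R) : 0 < a' <= a -> a <= b <= b' ->
  RInt (gamma_integrand p) a b <= RInt (gamma_integrand p) a' b'.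
Proof.
intros Ha Hb.
assert (P : forall x y, 0 < x <= y -> 0 <= RInt (gamma_integrand p) x y).
{ intros x y Hxy. apply RInt_ge_0; [lra|apply ex_RInt_gamma, Hxy|]. intros; apply Rlt_le,
  gamma_integrand_pos. }
rewrite <- (RInt_Chasles (V := R_CompleteNormedModule) (gamma_integrand p) a' a b') by (apply
  ex_RInt_gamma; lra).
rewrite <- (RInt_Chasles (V := R_CompleteNormedModule) (gamma_integrand p) a b b') by (apply
  ex_RInt_gamma; lra).
unfold plus; simpl. assert (H1 := P a' a ltac:(lra)). assert (H2 := P b b' ltac:(lra)). lra.
Qed.

Lemma is_RInt_exp_half (a b : R) : is_RInt (fun x => exp (- (x / 2))) a b (2 * exp (- (a / 2)) - 2
  * exp (- (b / 2))).
Proof.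
evar_last.
- apply (is_RInt_derive (V := R_CompleteNormedModule) (fun x => - 2 * exp (- (x / 2)))).
  + intros x _. auto_derive; [exact I|]. unfold Rdiv. field.
  + intros x _. apply (ex_derive_continuous (K := R_AbsRing) (V := R_NormedModule)). auto_derive.
      exact I.
- unfold minus, plus, opp; simpl. ring.
Qed.

Lemma RInt_gamma_le (p a b : R) : 1 <= p -> 0 < a <= b -> RInt (gamma_integrand p) a b <=
  2 * gamma_const p.
Proof.
intros Hp Hab.
assert (H := is_RInt_scal (V := R_NormedModule) _ _ _ (gamma_const p) _ (is_RInt_exp_half a b)).
apply Rle_trans with (gamma_const p * (2 * exp (- (a / 2)) - 2 * exp (- (b / 2)))).
- apply (is_RInt_unique (V := R_CompleteNormedModule)) in H.
  change (RInt (fun x => gamma_const p * exp (- (x / 2))) a b = gamma_const p * (2 * exp (- (a /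
    2)) - 2 * exp (- (b / 2)))) in H.
  rewrite <- H. apply RInt_le; [lra|apply ex_RInt_gamma, Hab| |].
  + eexists. apply (is_RInt_scal (V := R_NormedModule) _ _ _ (gamma_const p) _ (is_RInt_exp_half a
      b)).
  + intros x Hx. apply gamma_integrand_le; lra.
- rewrite (Rmult_comm 2 (gamma_const p)). apply Rmult_le_compat_l; [apply Rlt_le, exp_pos|].
  assert (H1 := exp_pos (- (b / 2))). assert (H2 : exp (- (a / 2)) <= 1) by (rewrite <- exp_0;
    apply exp_le_compat; lra). lra.
Qed.

(* Only [1 <= p] is needed, where the integrand is bounded near 0. *)
Definition gamma_lub (p G : R) : Prop :=
  is_lub (fun v => exists a b, 0 < a <= b /\ v = RInt (gamma_integrand p) a b) G.

Lemma gamma_lub_exists (p : R) : 1 <= p -> exists G, gamma_lub p G.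
Proof.
intros Hp. destruct (completeness (fun v => exists a b, 0 < a <=
  b /\ v = RInt (gamma_integrand p) a b)) as [G HG].
- exists (2 * gamma_const p). intros v (a & b & Hab & ->). apply RInt_gamma_le; assumption.
- exists (RInt (gamma_integrand p) 1 1), 1, 1. split; [lra|reflexivity].
- exists G. exact HG.
Qed.

Lemma gamma_lub_approx (p G eps : R) : gamma_lub p G -> 0 < eps ->
  exists a0 b0, 0 < a0 <= b0 /\ forall a b, 0 < a <= a0 -> b0 <= b ->
   G - eps < RInt (gamma_integrand p) a b <= G.
Proof.
intros [Hub Hl] He.
destruct (Classical_Prop.classic (exists a b, 0 < a <= b /\ G - eps < RInt (gamma_integrand p) a
  b)) as [(a0 & b0 & Hab & H)|Hn].
- exists a0, b0. split; [exact Hab|]. intros a b Ha Hb. split.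
  + apply Rlt_le_trans with (1 := H). apply RInt_gamma_mono; lra.
  + apply Hub. exists a, b. split; [lra|reflexivity].
- exfalso. assert (G <= G - eps); [|lra]. apply Hl. intros v (a & b & Hab & ->).
  destruct (Rle_lt_dec (RInt (gamma_integrand p) a b) (G - eps)); auto. exfalso. apply Hn.
    exists a, b; auto.
Qed.

(** The integrand is positive, so the proper integrals grow with the interval, and their limit along
    both filters is their supremum. *)
Lemma CGamma_real (p G : R) : gamma_lub p G -> CGamma (RtoC p) = RtoC G.
Proof.
intros HG. unfold CGamma. apply (is_RInt_gen_unique (V := C_R_CompleteNormedModule)).
intros P [eps HP].
destruct (gamma_lub_approx p G eps HG (cond_pos eps)) as (a0 & b0 & Hab & H).
unfold filtermapi. apply Filter_prod with (fun a => 0 < a <= a0) (fun b => b0 < b).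
- exists (mkposreal a0 (proj1 Hab)). intros y Hy Hy0. change (Rabs (y - 0) < a0) in Hy.
  rewrite Rabs_pos_eq in Hy by lra. lra.
- exists b0. auto.
- intros a b Ha Hb. exists (RtoC (RInt (gamma_integrand p) a b)). split.
  + apply (is_RInt_ext (fun x => RtoC (gamma_integrand p x))).
    * simpl. rewrite Rmin_left by lra. intros x Hx. unfold Cpower. rewrite Clog_RtoC by lra.
      rewrite <- RtoC_minus, <- RtoC_mult, Cexp_RtoC, <- RtoC_mult. reflexivity.
    * apply (is_RInt_fct_extend_pair (U := R_NormedModule) (V := R_NormedModule)); simpl.
      -- apply (RInt_correct (V := R_CompleteNormedModule)), ex_RInt_gamma. lra.
      -- evar_last; [apply (is_RInt_const (V := R_NormedModule))|]. apply (scal_zero_r (V :=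
        R_NormedModule)).
  + apply HP. specialize (H a b Ha ltac:(lra)). split; simpl.
    * change (Rabs (RInt (gamma_integrand p) a b - G) < eps). apply Rabs_lt_between. lra.
    * change (Rabs (0 - 0) < eps). rewrite Rminus_0_r, Rabs_R0. apply cond_pos.
Qed.

Lemma gamma_integrand_succ (p x : R) : 0 < x -> gamma_integrand (p + 1) x = x * gamma_integrand p x.
Proof.
intros Hx. unfold gamma_integrand. replace (p + 1 - 1) with (1 + (p - 1)) by ring.
rewrite Rpower_plus, Rpower_1 by exact Hx. ring.
Qed.

Lemma RInt_gamma_succ (p a b : R) : 0 < a <= b ->
  RInt (gamma_integrand (p + 1)) a b = p * RInt (gamma_integrand p) a b + gamma_integrand (p + 1) a
    - gamma_integrand (p + 1) b.
Proof.
intros Hab.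
assert (H : is_RInt (fun x => p * gamma_integrand p x - gamma_integrand (p + 1) x) a b
  (gamma_integrand (p + 1) b - gamma_integrand (p + 1) a)).
{ apply (is_RInt_derive (V := R_CompleteNormedModule) (gamma_integrand (p + 1))).
  - rewrite Rmin_left, Rmax_right by lra. intros x Hx. rewrite gamma_integrand_succ by lra.
    unfold gamma_integrand, Rpower. auto_derive; [lra|].
    replace ((p + 1 - 1) * ln x) with (ln x + (p - 1) * ln x) by ring. rewrite exp_plus,
      exp_ln by lra. field. lra.
  - rewrite Rmin_left, Rmax_right by lra. intros x Hx.
    apply (continuous_minus (V := R_NormedModule)); [apply (continuous_scal_r (V :=
      R_NormedModule))|]; apply continuous_gamma_integrand; lra. }
assert (H2 := is_RInt_minus (V := R_NormedModule) _ _ _ _ _ _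
  (is_RInt_scal (V := R_NormedModule) _ _ _ p _ (RInt_correct (V :=
    R_CompleteNormedModule) _ _ _ (ex_RInt_gamma p a b Hab)))
  (RInt_correct (V := R_CompleteNormedModule) _ _ _ (ex_RInt_gamma (p + 1) a b Hab))).
apply (is_RInt_unique (V := R_CompleteNormedModule)) in H. apply (is_RInt_unique (V :=
  R_CompleteNormedModule)) in H2.
assert (E : p * RInt (gamma_integrand p) a b - RInt (gamma_integrand (p + 1)) a b = gamma_integrand
  (p + 1) b - gamma_integrand (p + 1) a).
{ rewrite <- H. symmetry. exact H2. }
lra.
Qed.

Lemma exp_half_small (c eps : R) : 0 < c -> 0 < eps -> exists b0, 0 < b0 /\ forall b, b0 <= b ->
  c * exp (- (b / 2)) < eps.
Proof.
intros Hc He. exists (2 * c / eps). assert (H0 : 0 < 2 * c / eps) by (apply Rdiv_lt_0_compat; lra).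
split; [exact H0|]. intros b Hb.
assert (H := exp_ineq1 (b / 2) ltac:(lra)).
rewrite exp_Ropp. apply Rmult_lt_reg_r with (exp (b / 2)); [apply exp_pos|].
rewrite Rmult_assoc, Rinv_l, Rmult_1_r by (apply Rgt_not_eq, exp_pos).
assert (Hb' : eps * (2 * c / eps) <= eps * b) by (apply Rmult_le_compat_l; lra).
replace (eps * (2 * c / eps)) with (2 * c) in Hb' by (field; lra).
assert (eps * (1 + b / 2) < eps * exp (b / 2)) by (apply Rmult_lt_compat_l; lra). nra.
Qed.

Lemma gamma_integrand_small_at_0 (p x : R) : 1 <= p -> 0 < x <= 1 -> gamma_integrand (p + 1) x <= x.
Proof.
intros Hp Hx. rewrite gamma_integrand_succ by lra. apply Rle_trans with (x * 1); [|lra].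
apply Rmult_le_compat_l; [lra|]. unfold gamma_integrand, Rpower. rewrite <- exp_plus.
apply Rle_trans with (exp 0); [apply exp_le_compat|rewrite exp_0; lra].
assert (Hl : ln x <= 0) by (rewrite <- ln_1; apply ln_le; lra).
assert (0 <= (p - 1) * - ln x) by (apply Rmult_le_pos; lra). lra.
Qed.

Lemma gamma_succ (p G G' : R) : 1 <= p -> gamma_lub p G -> gamma_lub (p + 1) G' -> G' = p * G.
Proof.
intros Hp H1 H2. apply Rminus_diag_uniq.
assert (E : Rabs (G' - p * G) = 0); [|destruct (Req_dec (G' - p * G) 0); auto; exfalso;
  apply (Rabs_no_R0 (G' - p * G)); assumption].
apply Rle_antisym; [|apply Rabs_pos]. apply le_epsilon. intros eps He. rewrite Rplus_0_l.
(* Error budget: p e from approximating G, e from G', and e from each of the two boundary terms. *)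
set (e := eps / (3 + p)). assert (Hepos : 0 < e) by (apply Rdiv_lt_0_compat; lra).
destruct (gamma_lub_approx p G e H1 Hepos) as (a1 & b1 & Hab1 & K1).
destruct (gamma_lub_approx (p + 1) G' e H2 Hepos) as (a2 & b2 & Hab2 & K2).
destruct (exp_half_small (gamma_const (p + 1)) e ltac:(apply exp_pos) Hepos) as (b3 & Hb3 & K3).
set (a := Rmin (Rmin a1 a2) (Rmin 1 e)). set (b := Rmax (Rmax b1 b2) (Rmax b3 1)).
assert (A1 : a <= a1) by (unfold a; eapply Rle_trans; [apply Rmin_l|apply Rmin_l]).
assert (A2 : a <= a2) by (unfold a; eapply Rle_trans; [apply Rmin_l|apply Rmin_r]).
assert (A3 : a <= 1) by (unfold a; eapply Rle_trans; [apply Rmin_r|apply Rmin_l]).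
assert (A4 : a <= e) by (unfold a; eapply Rle_trans; [apply Rmin_r|apply Rmin_r]).
assert (A0 : 0 < a) by (unfold a; repeat apply Rmin_pos; lra).
assert (B1 : b1 <= b) by (unfold b; eapply Rle_trans; [apply Rmax_l|apply Rmax_l]).
assert (B2 : b2 <= b) by (unfold b; eapply Rle_trans; [apply Rmax_r|apply Rmax_l]).
assert (B3 : b3 <= b) by (unfold b; eapply Rle_trans; [apply Rmax_l|apply Rmax_r]).
assert (B4 : 1 <= b) by (unfold b; eapply Rle_trans; [apply Rmax_r|apply Rmax_r]).
specialize (K1 a b ltac:(lra) B1). specialize (K2 a b ltac:(lra) B2). specialize (K3 b B3).
assert (E := RInt_gamma_succ p a b ltac:(lra)).
assert (S1 := gamma_integrand_small_at_0 p a Hp ltac:(lra)).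
assert (S2 := gamma_integrand_le (p + 1) b ltac:(lra) ltac:(lra)).
assert (S3 := gamma_integrand_pos (p + 1) a). assert (S4 := gamma_integrand_pos (p + 1) b).
assert (Ee : (3 + p) * e = eps) by (unfold e; field; lra).
assert (p * (G - e) <= p * RInt (gamma_integrand p) a b) by (apply Rmult_le_compat_l; lra).
assert (p * RInt (gamma_integrand p) a b <= p * G) by (apply Rmult_le_compat_l; lra).
apply Rabs_le. lra.
Qed.

Lemma gamma_1 (G : R) : gamma_lub 1 G -> G = 1.
Proof.
intros H.
assert (E : forall a b, 0 < a <= b -> RInt (gamma_integrand 1) a b = exp (- a) - exp (- b)).
{ intros a b Hab. apply is_RInt_unique. apply (is_RInt_ext (fun x => exp (- x))).
  - rewrite Rmin_left by lra. intros x Hx. unfold gamma_integrand. rewrite Rminus_diag.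
    unfold Rpower. rewrite Rmult_0_l, exp_0. symmetry. apply Rmult_1_l.
  - evar_last.
    + apply (is_RInt_derive (V := R_CompleteNormedModule) (fun x => - exp (- x))).
      * intros x _. auto_derive; [exact I|]. ring.
      * intros x _. apply (ex_derive_continuous (K := R_AbsRing) (V := R_NormedModule)).
          auto_derive. exact I.
    + unfold minus, plus, opp; simpl. ring. }
assert (H1 : G <= 1).
{ apply H. intros v (a & b & Hab & ->). rewrite E by exact Hab.
  assert (0 < exp (- b)) by apply exp_pos. assert (exp (- a) <= 1) by (rewrite <- exp_0;
    apply exp_le_compat; lra). lra. }
apply Rle_antisym; [exact H1|]. apply le_epsilon. intros eps He.
destruct (exp_half_small 1 (eps / 2) ltac:(lra) ltac:(lra)) as (b0 & Hb0 & K).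
set (a := Rmin 1 (eps / 2)). set (b := Rmax b0 1).
assert (Ha0 : 0 < a) by (apply Rmin_pos; lra). assert (Ha1 := Rmin_l 1 (eps / 2)). assert (Ha2 :=
  Rmin_r 1 (eps / 2)).
assert (Hb1 := Rmax_l b0 1). assert (Hb2 := Rmax_r b0 1). fold a in Ha1, Ha2. fold b in Hb1, Hb2.
assert (HG : RInt (gamma_integrand 1) a b <= G) by (apply H; exists a, b; split; [lra|reflexivity]).
rewrite E in HG by lra.
specialize (K (2 * b) ltac:(lra)). replace (2 * b / 2) with b in K by field.
assert (H3 := exp_ineq1_le (- a)). lra.
Qed.

(** Convexity of exp on the interval between 0 and l: [K1] and [K2] compare exp with its tangent at
    x l, at the points l and 0, with weights x and 1 - x. *)
Lemma young_exp (x l : R) : 0 <= x <= 1 -> exp (x * l) <= 1 - x + x * exp l.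
Proof.
intros Hx.
assert (H1 := exp_ineq1_le ((1 - x) * l)). assert (H2 := exp_ineq1_le (- (x * l))).
assert (E1 : exp l = exp (x * l) * exp ((1 - x) * l)) by (rewrite <- exp_plus; f_equal; ring).
assert (E2 : 1 = exp (x * l) * exp (- (x * l))) by (rewrite <- exp_plus, Rplus_opp_r, exp_0;
  reflexivity).
assert (Hm := exp_pos (x * l)). set (m := exp (x * l)) in *.
assert (K1 : x * (m * (1 + (1 - x) * l)) <= x * (m * exp ((1 - x) * l))).
{ apply Rmult_le_compat_l; [lra|]. apply Rmult_le_compat_l; lra. }
assert (K2 : (1 - x) * (m * (1 + - (x * l))) <= (1 - x) * (m * exp (- (x * l)))).
{ apply Rmult_le_compat_l; [lra|]. apply Rmult_le_compat_l; lra. }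
rewrite <- E1 in K1. rewrite <- E2 in K2. lra.
Qed.

(* Integrate [(t / y)^x <= 1 - x + x * t / y] against [t^(y-1) exp (-t)]. *)
Lemma gamma_wendel (y x G G' : R) : 1 <= y -> 0 <= x <= 1 -> gamma_lub y G ->
  gamma_lub (y + x) G' ->
  G' <= Rpower y x * G.
Proof.
intros Hy Hx H1 H2. destruct (gamma_lub_exists (y + 1) ltac:(lra)) as [G1 H3].
assert (EG := gamma_succ y G G1 Hy H1 H3).
apply H2. intros v (a & b & Hab & ->).
assert (Hyx : 0 < Rpower y x) by apply exp_pos.
apply Rle_trans with (Rpower y x * ((1 - x) * RInt (gamma_integrand y) a b + x / y * RInt
  (gamma_integrand (y + 1)) a b)).
- assert (HI := is_RInt_scal (V := R_NormedModule) _ _ _ (Rpower y x) _ (is_RInt_plus (V :=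
    R_NormedModule) _ _ _ _ _ _
    (is_RInt_scal (V := R_NormedModule) _ _ _ (1 - x) _ (RInt_correct (V :=
      R_CompleteNormedModule) _ _ _ (ex_RInt_gamma y a b Hab)))
    (is_RInt_scal (V := R_NormedModule) _ _ _ (x / y) _ (RInt_correct (V :=
      R_CompleteNormedModule) _ _ _ (ex_RInt_gamma (y + 1) a b Hab))))).
  apply (is_RInt_le (gamma_integrand (y + x)) _ a b _ _ (proj2 Hab) (RInt_correct (V :=
    R_CompleteNormedModule) _ _ _ (ex_RInt_gamma (y + x) a b Hab)) HI).
  intros t Ht.
  change (gamma_integrand (y + x) t <= Rpower y x * ((1 - x) * gamma_integrand y t + x / y *
    gamma_integrand (y + 1) t)).
  rewrite gamma_integrand_succ by lra.
  assert (K := young_exp x (ln (t / y)) Hx). rewrite exp_ln in K by (apply Rdiv_lt_0_compat; lra).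
  assert (E : gamma_integrand (y + x) t = Rpower y x * (exp (x * ln (t / y)) * gamma_integrand y
    t)).
  { unfold gamma_integrand, Rpower. rewrite ln_div by lra. rewrite <- !exp_plus. f_equal. ring. }
  rewrite E. apply Rmult_le_compat_l; [lra|].
  replace ((1 - x) * gamma_integrand y t + x / y * (t * gamma_integrand y t)) with ((1 - x + x * (t
    / y)) * gamma_integrand y t) by (field; lra).
  apply Rmult_le_compat_r; [apply Rlt_le, gamma_integrand_pos|exact K].
- apply Rmult_le_compat_l; [lra|].
  assert (K1 : RInt (gamma_integrand y) a b <= G) by (apply H1; exists a, b; auto).
  assert (K2 : RInt (gamma_integrand (y + 1)) a b <= y * G) by (rewrite <- EG; apply H3; exists a,
    b; auto).
  assert ((1 - x) * RInt (gamma_integrand y) a b <= (1 - x) * G) by (apply Rmult_le_compat_l; lra).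
  assert (Hxy : 0 <= x / y) by (apply Rmult_le_pos; [lra|apply Rlt_le, Rinv_0_lt_compat; lra]).
  assert (K3 : x / y * RInt (gamma_integrand (y + 1)) a b <=
    x / y * (y * G)) by (apply Rmult_le_compat_l; lra).
  replace (x / y * (y * G)) with (x * G) in K3 by (field; lra). lra.
Qed.

(** * The constant in Stirling's formula *)

Definition wallis_int (k : nat) : R := RInt (fun x => sin x ^ k) 0 (PI / 2).

Lemma wallis_ex (k : nat) : is_RInt (fun x => sin x ^ k) 0 (PI / 2) (wallis_int k).
Proof.
apply (RInt_correct (V := R_CompleteNormedModule)). apply (ex_RInt_continuous (V :=
  R_CompleteNormedModule)). intros z _.
apply (ex_derive_continuous (K := R_AbsRing) (V := R_NormedModule)). auto_derive. exact I.
Qed.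

Lemma wallis_rec (k : nat) : (INR k + 2) * wallis_int (S (S k)) = (INR k + 1) * wallis_int k.
Proof.
assert (H : is_RInt (fun x => (INR k + 2) * sin x ^ S (S k) - (INR k + 1) * sin x ^ k) 0 (PI / 2)
  0).
{ evar_last.
  - apply (is_RInt_derive (V := R_CompleteNormedModule) (fun x => - (cos x * sin x ^ S k))).
    + intros x _. auto_derive; [exact I|].
      assert (E : cos x * cos x = 1 - sin x * sin x) by (generalize (sin2_cos2 x); unfold Rsqr;
        lra).
      (* [auto_derive] leaves the factor INR (S k) unfolded to this match. *)
      replace (match k with O => 1 | S _ => INR k + 1 end) with (INR k + 1) by (destruct k; simpl;
        ring).
      cbn [pow Nat.pred].
      match goal with |- ?l = _ => replace l with (sin x * (sin x * sin x ^ k) - (INR k + 1) * (cos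
        x * cos x) * sin x ^ k) by ring end.
      rewrite E. ring.
    + intros x _. apply (ex_derive_continuous (K := R_AbsRing) (V := R_NormedModule)). auto_derive.
        exact I.
  - unfold minus, plus, opp; simpl. rewrite cos_PI2, sin_0. ring. }
assert (H2 := is_RInt_minus (V := R_NormedModule) _ _ _ _ _ _
  (is_RInt_scal (V := R_NormedModule) _ _ _ (INR k + 2) _ (wallis_ex (S (S k)))) (is_RInt_scal (V
    := R_NormedModule) _ _ _ (INR k + 1) _ (wallis_ex k))).
apply (is_RInt_unique (V := R_CompleteNormedModule)) in H. apply (is_RInt_unique (V :=
  R_CompleteNormedModule)) in H2.
assert (E : (INR k + 2) * wallis_int (S (S k)) - (INR k + 1) * wallis_int k = 0) by (rewrite <- H;
  symmetry; exact H2).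
lra.
Qed.

Lemma wallis_0 : wallis_int 0 = PI / 2.
Proof.
apply is_RInt_unique. apply (is_RInt_ext (fun _ => 1)); [reflexivity|].
evar_last; [apply (is_RInt_const (V := R_NormedModule))|].
unfold scal; simpl; unfold mult; simpl. field.
Qed.

Lemma wallis_1 : wallis_int 1 = 1.
Proof.
apply is_RInt_unique. apply (is_RInt_ext (fun x => sin x)); [intros; symmetry; apply Rmult_1_r|].
evar_last.
- apply (is_RInt_derive (V := R_CompleteNormedModule) (fun x => - cos x)).
  + intros x _. auto_derive; [exact I|]. ring.
  + intros x _. apply (ex_derive_continuous (K := R_AbsRing) (V := R_NormedModule)). auto_derive.
      exact I.
- unfold minus, plus, opp; simpl. rewrite cos_PI2, cos_0. ring.
Qed.

Lemma wallis_decr (k : nat) : wallis_int (S k) <= wallis_int k.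
Proof.
assert (HPI := PI_RGT_0).
apply (is_RInt_le (fun x => sin x ^ S k) (fun x => sin x ^ k) 0 (PI / 2));
  [lra|apply wallis_ex|apply wallis_ex|].
intros x Hx. assert (Hs : 0 <= sin x <= 1) by (split; [apply sin_ge_0; lra|apply SIN_bound]).
simpl. assert (0 <= sin x ^ k) by (apply pow_le; lra). nra.
Qed.

(** The central binomial coefficient of 2n divided by 4^n. Both the even and the odd Wallis
    integrals are expressed through it. *)
Definition central_ratio (n : nat) : R := INR (fact (2 * n)) / (4 ^ n * INR (fact n) ^ 2).

Lemma central_ratio_pos (n : nat) : 0 < central_ratio n.
Proof.
apply Rdiv_lt_0_compat; [apply INR_fact_lt_0|]. apply Rmult_lt_0_compat; [apply pow_lt; lra|].
apply pow_lt, INR_fact_lt_0.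
Qed.

Lemma central_ratio_succ (n : nat) : (2 * INR n + 2) * central_ratio (S n) = (2 * INR n + 1) *
  central_ratio n.
Proof.
unfold central_ratio. replace (2 * S n)%nat with (S (S (2 * n))) by lia.
rewrite !fact_simpl. rewrite !mult_INR, !S_INR, mult_INR. change (INR 2) with 2. cbn [pow].
assert (Hn := pos_INR n). field. repeat split; try lra; try apply INR_fact_neq_0;
  apply pow_nonzero; lra.
Qed.

Lemma wallis_even (n : nat) : wallis_int (2 * n) = PI / 2 * central_ratio n.
Proof.
induction n; [unfold central_ratio; simpl; rewrite wallis_0; field|].
assert (Hn := pos_INR n).
replace (2 * S n)%nat with (S (S (2 * n))) by lia.
apply Rmult_eq_reg_l with (2 * INR n + 2); [|lra].
assert (H := wallis_rec (2 * n)). rewrite mult_INR in H. change (INR 2) with 2 in H. rewrite H, IHn.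
replace ((2 * INR n + 2) * (PI / 2 * central_ratio (S n))) with (PI / 2 * ((2 * INR n + 2) *
  central_ratio (S n))) by ring.
rewrite central_ratio_succ. ring.
Qed.

Lemma wallis_odd (n : nat) : wallis_int (S (2 * n)) * ((2 * INR n + 1) * central_ratio n) = 1.
Proof.
induction n; [unfold central_ratio; simpl; rewrite wallis_1; field|].
assert (Hn := pos_INR n). apply eq_trans with (2 := IHn). rewrite S_INR.
replace (S (2 * S n))%nat with (S (S (S (2 * n)))) by lia.
assert (H := wallis_rec (S (2 * n))). rewrite S_INR, mult_INR in H. change (INR 2) with 2 in H.
transitivity ((2 * INR n + 1 + 2) * wallis_int (S (S (S (2 * n)))) * central_ratio (S n)); [ring|].
rewrite H. transitivity (wallis_int (S (2 * n)) * ((2 * INR n + 2) * central_ratio (S n))); [ring|].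
rewrite central_ratio_succ. ring.
Qed.

(** Wallis' product: multiply W(2n+2) <= W(2n+1) <= W(2n) by (2n + 1) [central_ratio n]. The middle
    term becomes 1, and the outer ones are quadratic in the ratio. *)
Lemma central_ratio_bounds (n : nat) : (1 <= n)%nat ->
  2 * INR n / (2 * INR n + 1) <= PI * (INR n * central_ratio n ^ 2) <= 1.
Proof.
intros Hn. apply le_INR in Hn. simpl in Hn. assert (Hb := central_ratio_pos n). assert (HPI :=
  PI_RGT_0).
assert (H1 := wallis_decr (2 * n)). assert (H2 := wallis_decr (S (2 * n))).
assert (E := wallis_odd n). rewrite wallis_even in H1.
replace (S (S (2 * n))) with (2 * S n)%nat in H2 by lia. rewrite wallis_even in H2.
assert (E2 := central_ratio_succ n).
set (b := central_ratio n) in *. set (b' := central_ratio (S n)) in *. set (w :=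
  wallis_int (S (2 * n))) in *. set (N := INR n) in *.
assert (K1 : w * ((2 * N + 1) * b) <= PI / 2 * b * ((2 * N + 1) * b)) by (apply Rmult_le_compat_r;
  [apply Rmult_le_pos; lra|exact H1]).
assert (K2 : PI / 2 * b' * ((2 * N + 1) * b) <= w * ((2 * N + 1) * b)) by (apply Rmult_le_compat_r;
  [apply Rmult_le_pos; lra|exact H2]).
rewrite E in K1, K2. split.
- apply Rmult_le_reg_r with (2 * N + 1); [lra|]. replace (2 * N / (2 * N + 1) * (2 * N + 1)) with
    (2 * N * 1) by (field; lra).
  apply Rle_trans with (2 * N * (PI / 2 * b * ((2 * N + 1) * b))); [apply Rmult_le_compat_l; lra|].
    right; field.
- assert (K3 : PI / 2 * ((2 * N + 1) * b) * ((2 * N + 1) * b) <= 2 * N + 2).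
  { assert (K4 : (2 * N + 2) * (PI / 2 * b' * ((2 * N + 1) * b)) <=
    (2 * N + 2) * 1) by (apply Rmult_le_compat_l; lra).
    replace ((2 * N + 2) * (PI / 2 * b' * ((2 * N + 1) * b))) with (PI / 2 * ((2 * N + 2) * b') *
      ((2 * N + 1) * b)) in K4 by field.
    rewrite E2 in K4. lra. }
  apply Rmult_le_reg_r with ((2 * N + 1) ^ 2); [apply pow_lt; lra|].
  replace (PI * (N * b ^ 2) * (2 * N + 1) ^ 2) with (2 * N * (PI / 2 * ((2 * N + 1) * b) * ((2 * N
    + 1) * b))) by field.
  apply Rle_trans with (2 * N * (2 * N + 2)); [apply Rmult_le_compat_l; lra|]. nra.
Qed.

Definition stirling_seq (n : nat) : R := ln (INR (fact n)) - (INR n * ln (INR n) - INR n + / 2 * ln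
  (INR n)).

(** In stirling_seq (2n) - 2 stirling_seq n the powers of n cancel, leaving half of ln (PI n
    [central_ratio n]^2), which tends to 0, minus half of ln (2 PI). The limit of the same
    expression is P - 2 P = -P. *)
Lemma stirling_constant (P : R) :
  (forall eps, 0 < eps -> exists N, forall n, (N <= n)%nat -> Rabs (stirling_seq n - P) < eps) ->
  P = ln (sqrt (2 * PI)).
Proof.
intros H. assert (HPI := PI_RGT_0).
assert (Hln : ln (sqrt (2 * PI)) = / 2 * (ln 2 + ln PI)).
{ rewrite <- ln_mult by lra. rewrite <- (sqrt_sqrt (2 * PI)) at 2 by lra.
  rewrite ln_mult by (apply sqrt_lt_R0; lra). field. }
assert (HS : forall n, (1 <= n)%nat -> stirling_seq (2 * n) - 2 * stirling_seq n
   = / 2 * ln (PI * (INR n * central_ratio n ^ 2)) - / 2 * (ln 2 + ln PI)).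
{ intros n Hn. apply le_INR in Hn. simpl in Hn. assert (Hb := central_ratio_pos n).
  assert (Hf := INR_fact_lt_0 n). assert (Hf2 := INR_fact_lt_0 (2 * n)).
  assert (Eb : ln (central_ratio n) = ln (INR (fact (2 * n))) - (INR n * (2 * ln 2) + 2 * ln (INR
    (fact n)))).
  { unfold central_ratio. rewrite ln_div; [|exact Hf2|apply Rmult_lt_0_compat; [apply pow_lt;
    lra|apply pow_lt; exact Hf]].
    rewrite ln_mult by (apply pow_lt; lra). rewrite !ln_pow by lra. replace 4 with (2 * 2) by ring.
      rewrite ln_mult by lra.
    change (INR 2) with 2. ring. }
  rewrite ln_mult; [|lra|apply Rmult_lt_0_compat; [lra|apply pow_lt; lra]].
  rewrite ln_mult by (try apply pow_lt; lra). rewrite ln_pow by lra. rewrite Eb.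
  unfold stirling_seq. rewrite mult_INR. change (INR 2) with 2. rewrite ln_mult by lra. simpl.
    field. }
apply Rminus_diag_uniq.
assert (E : Rabs (P - ln (sqrt (2 * PI))) = 0); [|destruct (Req_dec (P - ln (sqrt (2 * PI))) 0);
  auto; exfalso; apply (Rabs_no_R0 (P - ln (sqrt (2 * PI)))); assumption].
apply Rle_antisym; [|apply Rabs_pos]. apply le_epsilon. intros eps He. rewrite Rplus_0_l.
(* One use of the limit at 2n and two at n cost eps / 2; half of ln q costs at most eps / 4. *)
destruct (H (eps / 6) ltac:(lra)) as [N HN].
destruct (archimed_cor1 (eps / 2) ltac:(lra)) as (N' & HN' & HN0).
set (n := max N N').
assert (n1 : (N <= n)%nat) by apply Nat.le_max_l. assert (n2 : (N' <= n)%nat) by apply Nat.le_max_r.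
assert (h1 := HN n n1). assert (h2 := HN (2 * n)%nat ltac:(lia)).
assert (HSn := HS n ltac:(lia)). rewrite <- Hln in HSn.
destruct (central_ratio_bounds n ltac:(lia)) as [c1 c2].
assert (Hn1 : 1 <= INR N') by (apply (le_INR 1); lia). assert (Hn2 := le_INR _ _ n2).
set (q := PI * (INR n * central_ratio n ^ 2)) in *.
assert (q0 : 0 < 2 * INR n / (2 * INR n + 1)) by (apply Rdiv_lt_0_compat; lra).
assert (l1 : ln q <= 0) by (rewrite <- ln_1; apply ln_le; lra).
assert (l2 : - / INR N' <= ln q).
{ apply Rle_trans with (ln (2 * INR n / (2 * INR n + 1))); [|apply ln_le; lra].
  assert (K := ln_le_sub1 ((2 * INR n + 1) / (2 * INR n)) ltac:(apply Rdiv_lt_0_compat; lra)).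
  rewrite ln_div in K |- * by lra.
  replace ((2 * INR n + 1) / (2 * INR n) - 1) with (/ (2 * INR n)) in K by (field; lra).
  assert (/ (2 * INR n) <= / INR N') by (apply Rinv_le_contravar; lra). lra. }
apply Rabs_lt_between in h1. apply Rabs_lt_between in h2. apply Rabs_le. lra.
Qed.

(** * Values of the zeta function at the non-positive integers *)

Lemma cder_Cpower_exponent (a s : C) : cder (fun s => Cpower a (- s)) s (- Clog a * Cpower a (-
  s))%C.
Proof.
unfold Cpower. apply (cder_comp Cexp (fun s => - s * Clog a)%C); [apply cder_Cexp|].
apply cder_ext with (fun s => (- Clog a) * s)%C; [intros; ring|].
apply cder_eq with (- Clog a * 1)%C; [apply cder_scal, cder_id|ring].
Qed.

Lemma cder_pole_part (a s : C) : s <> RtoC 1 ->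
  cder (fun s => pole_part s a) s (- Clog a * Cpower a (1 - s) * / (s - 1) - Cpower a (1 - s) * (/
    (s - 1) * / (s - 1)))%C.
Proof.
intros Hs. unfold pole_part, Cdiv.
assert (Hs1 : (s - 1)%C <> 0).
{ intros E. apply Hs. replace s with (s - 1 + 1)%C by ring. rewrite E. ring. }
assert (D1 : cder (fun s => s - 1)%C s 1).
{ apply cder_eq with (1 - 0)%C; [apply cder_minus; [apply cder_id|apply cder_const]|ring]. }
assert (D2 : cder (fun s => Cpower a (1 - s)) s (- Clog a * Cpower a (1 - s))%C).
{ apply cder_ext with (fun s => Cpower a (- (s - 1))); [intros; f_equal; ring|].
  apply cder_eq with (1 * (- Clog a * Cpower a (- (s - 1))))%C.
  - apply (cder_comp (fun s => Cpower a (- s)) (fun s => s - 1)%C);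
      [apply cder_Cpower_exponent|exact D1].
  - replace (- (s - 1))%C with (1 - s)%C by ring. ring. }
assert (D3 := cder_comp (fun y => / y)%C (fun s => s - 1)%C s _ _ (cder_inv _ Hs1) D1).
apply cder_eq with (1 := cder_mult _ _ _ _ _ D2 D3). ring.
Qed.

Lemma RtoC_S_neq0 (n : nat) : RtoC (INR n + 1) <> 0.
Proof. apply RtoC_neq0. generalize (pos_INR n); lra. Qed.

Lemma opp_nat_neq1 (n : nat) : (- RtoC (INR n))%C <> RtoC 1.
Proof. apply Cneq_re. rewrite Re_opp, !Re_RtoC. generalize (pos_INR n); lra. Qed.

Lemma zeta_neg_int (zeta Y : C -> C -> C) (A : R) (n : nat) (a : C) : entire_part zeta Y A ->
  A < - INR n -> 0 < Re a ->
  (zeta (- RtoC (INR n)) a = Y (- RtoC (INR n)) a - a ^ S n * / RtoC (INR n + 1))%C /\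
  cder (fun s => zeta s a) (- RtoC (INR n))%C
   (dY Y (- RtoC (INR n)) a + a ^ S n * Clog a * / RtoC (INR n + 1) - a ^ S n * (/ RtoC (INR n + 1)
     * / RtoC (INR n + 1)))%C.
Proof.
intros (H1 & H2 & _) HA Ha.
assert (Hn := RtoC_S_neq0 n). assert (Hs := opp_nat_neq1 n). rewrite RtoC_plus in *.
assert (Ep : Cpower a (1 - - RtoC (INR n)) = (a ^ S n)%C).
{ rewrite <- Cpower_nat by (apply Cpos_neq0, Ha). apply (f_equal (Cpower a)). rewrite S_INR,
  RtoC_plus. ring. }
assert (Ed : (- RtoC (INR n) - 1 = - (RtoC (INR n) + 1))%C) by ring.
assert (HRe : A < Re (- RtoC (INR n))%C) by (rewrite Re_opp, Re_RtoC; exact HA).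
split.
- rewrite H2 by auto. unfold pole_part, Cdiv. rewrite Ep, Ed. field. exact Hn.
- assert (D1 : cder (fun s => Y s a) (- RtoC (INR n))%C (dY Y (- RtoC (INR n)) a)).
  { apply analytic_cder, family_analytic; auto. }
  assert (D2 := cder_plus _ _ _ _ _ D1 (cder_pole_part a _ Hs)).
  assert (Hn0 := pos_INR n).
  (* This radius keeps s in the half-plane Re s > A and away from the pole at 1. *)
  apply cder_ext_loc with (g := fun s => zeta s a) (d := Rmin (- INR n - A) 1) in D2.
  + apply cder_eq with (1 := D2). rewrite Ep, Ed. field. exact Hn.
  + apply Rmin_pos; lra.
  + intros y Hy. symmetry.
    assert (Hr := re_le_Cmod (y - - RtoC (INR n))%C). apply Rabs_le_between in Hr.
    rewrite Re_sub, Re_opp, Re_RtoC in Hr.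
    assert (Hm1 := Rmin_l (- INR n - A) 1). assert (Hm2 := Rmin_r (- INR n - A) 1).
    apply H2; [lra|exact Ha|]. apply Cneq_re. rewrite Re_RtoC. lra.
Qed.

Lemma g_entire_part (zeta Y : C -> C -> C) (A : R) (n : nat) (a : C) : entire_part zeta Y A ->
  A < - INR n -> 0 < Re a ->
  g zeta n a = (dY Y (- RtoC (INR n)) a + a ^ S n * Clog a * / RtoC (INR n + 1) - a ^ S n * (/ RtoC
    (INR n + 1) * / RtoC (INR n + 1))
   + digamma (RtoC (INR n) + 1) * (Y (- RtoC (INR n)) a - a ^ S n * / RtoC (INR n + 1)))%C.
Proof.
intros HY HA Ha. destruct (zeta_neg_int zeta Y A n a HY HA Ha) as [E1 E2].
unfold g. rewrite E1. apply cder_C_derive in E2. rewrite E2. reflexivity.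
Qed.

Definition zeta'0 (zeta : C -> C -> C) (a : C) : C := C_derive (fun s => zeta s a) 0.

Lemma zeta'0_eq (zeta Y : C -> C -> C) (A : R) (a : C) : entire_part zeta Y A -> A < 0 ->
  0 < Re a ->
  zeta'0 zeta a = (dY Y 0 a + a * Clog a - a)%C /\ cder (fun s => zeta s a) 0 (zeta'0 zeta a).
Proof.
intros HY HA Ha. destruct (zeta_neg_int zeta Y A 0 a HY ltac:(simpl; lra) Ha) as [_ E2].
replace (- RtoC (INR 0))%C with (RtoC 0) in E2 by (simpl; ring).
assert (E3 := cder_C_derive _ _ _ E2). unfold zeta'0. split.
- rewrite E3. simpl INR. replace (0 + 1) with 1 by ring. simpl. field; try (apply RtoC_neq0; lra).
- rewrite E3. exact E2.
Qed.

Lemma zeta'0_shift (zeta Y : C -> C -> C) (A : R) (a : C) : is_Hurwitz_zeta zeta ->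
  entire_part zeta Y A -> A < 0 -> 0 < Re a ->
  zeta'0 zeta (a + 1)%C = (zeta'0 zeta a + Clog a)%C.
Proof.
intros Hz HY HA Ha.
destruct (zeta'0_eq zeta Y A a HY HA Ha) as [_ D1].
assert (D2 := cder_minus _ _ _ _ _ D1 (cder_Cpower_exponent a 0)).
unfold zeta'0 at 1. rewrite (cder_C_derive (fun s => zeta s (a + 1)%C) 0 (zeta'0 zeta a - - Clog a
  * Cpower a (- 0))%C).
- replace (- 0)%C with (RtoC 0) by ring. rewrite Cpower_0. ring.
- apply cder_ext_loc with (3 := D2) (d := 1); [lra|]. intros y Hy. symmetry. apply Hurwitz_shift;
    auto.
  intros E. rewrite E in Hy. replace (1 - 0)%C with (RtoC 1) in Hy by ring. rewrite Cmod_1 in Hy.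
    lra.
Qed.

(** At s = 0 the term s dY (s + 1) vanishes and - Y 1 a remains, a finite value where zeta itself
    has its pole; the logarithm comes from a log a - a. *)
Lemma cder_zeta'0 (zeta Y : C -> C -> C) (A : R) (a : C) : entire_part zeta Y A -> A < 0 ->
  0 < Re a ->
  cder (zeta'0 zeta) a (Clog a - Y 1 a)%C.
Proof.
intros HY HA Ha. assert (Ha0 := Cpos_neq0 a Ha).
destruct (cder_entire_part zeta Y A 0 a HY ltac:(rewrite Re_RtoC; lra) Ha) as [_ D1].
assert (D2 := cder_minus _ _ _ _ _ (cder_plus _ _ _ _ _ D1 (cder_mult _ _ _ _ _ (cder_id a)
  (cder_Clog a Ha))) (cder_id a)).
apply cder_ext_loc with (g := zeta'0 zeta) (d := Re a / 2) in D2; [|lra|].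
- apply cder_eq with (1 := D2). replace (0 + 1)%C with (RtoC 1) by ring. field. exact Ha0.
- intros y Hy. symmetry. apply (zeta'0_eq zeta Y A); auto.
  assert (H := ball_Re_pos a (y - a)%C Hy). rewrite Cadd_sub in H. lra.
Qed.

(** * Behaviour of the entire part at infinity *)

Lemma Cpower_m2 (z : C) : z <> 0 -> Cpower z (- (2)) = (/ z * / z)%C.
Proof.
intros Hz. replace (- (2))%C with (- (1) + - (1))%C by (rewrite <- !RtoC_opp, <- RtoC_plus;
  f_equal; ring).
rewrite Cpower_add, Cpower_m1 by exact Hz. reflexivity.
Qed.

Lemma zeta2_bound (zeta : C -> C -> C) (x : R) : is_Hurwitz_zeta zeta -> 1 < x ->
  Cmod (zeta (RtoC 2) (RtoC x)) <= / (x - 1).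
Proof.
intros Hz Hx.
assert (H := proj1 (Hz (RtoC x) ltac:(rewrite Re_RtoC; lra)) (RtoC 2) ltac:(rewrite Re_RtoC; lra)).
apply (Cmod_lim_le _ _ _ O (proj1 (cser_eps _ _) H)). intros n _.
apply Rle_trans with (sum_n (fun k => / (INR k + x - 1) - / (INR k + x)) n).
- apply csum_bound. intros k _. assert (Hk := pos_INR k).
  rewrite Cpower_m2 by (rewrite <- RtoC_plus; apply RtoC_neq0; lra).
  rewrite <- RtoC_plus, Cmod_mult, Cmod_inv by (apply RtoC_neq0; lra). rewrite Cmod_R,
    Rabs_pos_eq by lra.
  replace (/ (INR k + x - 1) - / (INR k + x)) with (/ (INR k + x - 1) * / (INR k + x)) by (field;
    lra).
  apply Rmult_le_compat_r; [apply Rlt_le, Rinv_0_lt_compat; lra|]. apply Rinv_le_contravar; lra.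
- assert (E : sum_n (fun k => / (INR k + x - 1) - / (INR k + x)) n = / (x - 1) - / (INR n + x)).
  { induction n; rewrite ?sum_O, ?sum_Sn; [simpl; rewrite Rplus_0_l; reflexivity|].
    rewrite IHn, S_INR. assert (Hn := pos_INR n). unfold plus; simpl.
      replace (INR n + 1 + x - 1) with (INR n + x) by ring. ring. }
  rewrite E. assert (Hn := pos_INR n). assert (0 < / (INR n + x)) by (apply Rinv_0_lt_compat; lra).
    lra.
Qed.

(** At s = 0 the factor s removes the second summand of [next_strip], and [pow_mean] is the integral
    of 1 - u. *)
Lemma entire_part_0 (zeta Y : C -> C -> C) (A : R) (a : C) : entire_part zeta Y A -> A < 0 ->
  0 < Re a ->
  Y 0 a = RtoC (/ 2).
Proof.
intros (_ & _ & H3 & _) HA Ha. rewrite H3 by (rewrite ?Re_RtoC; auto). unfold next_strip.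
match goal with |- (_ + RtoC 0 * ?x)%C = _ => replace (0 * x)%C with (RtoC 0) by ring end.
replace (pow_mean 0 a + 0)%C with (pow_mean 0 a) by ring. unfold pow_mean.
apply (CInt_eq (fun u => RtoC (1 - u))%C).
- apply cint_components. split.
  + evar_last.
    * apply (is_RInt_derive (V := R_CompleteNormedModule) (fun u => u - u ^ 2 / 2)).
      -- intros x _. auto_derive; [exact I|]. simpl. unfold Rdiv. field.
      -- intros x _. apply (ex_derive_continuous (K := R_AbsRing) (V := R_NormedModule)). simpl.
        auto_derive. exact I.
    * unfold minus, plus, opp; simpl. field.
  + apply (is_RInt_ext (fun _ => 0)); [reflexivity|].
    evar_last; [apply (is_RInt_const (V := R_NormedModule))|]. apply (scal_zero_r (V :=
      R_NormedModule)).
- intros u _. replace (- 0)%C with (RtoC 0) by ring. rewrite Cpower_0. ring.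
Qed.

(** The recursion at s = 1 expresses Y 1 by 1 / (x + u) and by Y 2 = zeta 2 - 1 / (x + u). These
    contribute 1 + 2 times 1 / (x - 1), whence the 3. *)
Lemma entire_part_decay (zeta Y : C -> C -> C) (A x : R) : is_Hurwitz_zeta zeta ->
  entire_part zeta Y A -> A < 0 -> 1 < x ->
  Cmod (Y 1 (RtoC x)) <= 3 / (x - 1).
Proof.
intros Hz (H1 & H2 & H3 & _) HA Hx.
assert (Hx0 : 0 < Re (RtoC x)) by (rewrite Re_RtoC; lra).
rewrite H3 by (rewrite ?Re_RtoC; lra). unfold next_strip, pow_mean.
destruct (family_path (fun s a => Cpower a (- s)) 1 (fun u =>
  1 - u) _ _ _ _ (family_Cpower 1) Hx0 weight_1m (unit_path (RtoC x))) as (_ & I1 & _ & _).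
destruct (family_path Y (1 + 1)%C (fun u => 1 - u) _ _ _ _ (H1 (1 + 1)%C ltac:(rewrite Re_add,
  !Re_RtoC; lra)) Hx0 weight_1m (unit_path (RtoC x))) as (_ & I2 & _ & _).
assert (Hi : / x <= / (x - 1)) by (apply Rinv_le_contravar; lra).
assert (Hx1 : 0 < / (x - 1)) by (apply Rinv_0_lt_compat; lra).
apply Rle_trans with (1 := Cmod_triangle _ _).
rewrite Cmod_mult, Cmod_1, Rmult_1_l.
apply Rle_trans with (/ (x - 1) + 2 * / (x - 1)); [|unfold Rdiv; lra].
assert (Hb : forall u, 0 <= u <= 1 -> / (x + u) <= / (x - 1)) by (intros; apply Rinv_le_contravar;
  lra).
apply Rplus_le_compat.
- apply (cint_bound_const _ _ _ I1). intros u Hu. rewrite Cmod_Rmul by lra. rewrite <- RtoC_plus.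
  rewrite Cpower_m1, Cmod_inv by (apply RtoC_neq0; lra). rewrite Cmod_R, Rabs_pos_eq by lra.
  specialize (Hb u Hu). assert (0 < / (x + u)) by (apply Rinv_0_lt_compat; lra). nra.
- apply (cint_bound_const _ _ _ I2). intros u Hu. rewrite Cmod_Rmul by lra. rewrite <- !RtoC_plus.
  replace (1 + 1) with 2 by ring.
  assert (E := H2 (RtoC 2) (RtoC (x + u)) ltac:(rewrite Re_RtoC; lra) ltac:(rewrite Re_RtoC;
    lra) ltac:(apply Cneq_re; rewrite !Re_RtoC; lra)).
  assert (E1 : pole_part (RtoC 2) (RtoC (x + u)) = (/ RtoC (x + u))%C).
  { unfold pole_part. replace (1 - RtoC 2)%C with (- (1))%C by (rewrite <- RtoC_minus, <- RtoC_opp;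
    f_equal; ring).
    rewrite Cpower_m1 by (apply RtoC_neq0; lra). rewrite <- RtoC_minus.
      replace (2 - 1) with 1 by ring.
    field; try (apply RtoC_neq0; lra). }
  rewrite E1 in E. replace (Y (RtoC 2) (RtoC (x + u))) with (zeta (RtoC 2) (RtoC (x + u)) - / RtoC
    (x + u))%C by (rewrite E; ring).
  assert (K := Cmod_tri3 (zeta (RtoC 2) (RtoC (x + u))) (/ RtoC (x + u))%C).
  rewrite Cmod_inv, Cmod_R, Rabs_pos_eq in K by (try apply RtoC_neq0; lra).
  assert (K2 := zeta2_bound zeta (x + u) Hz ltac:(lra)).
  assert (K3 : / (x + u - 1) <= / (x - 1)) by (apply Rinv_le_contravar; lra).
  specialize (Hb u Hu).
  assert (K4 := Cmod_ge_0 (zeta (RtoC 2) (RtoC (x + u)) - / RtoC (x + u))%C). nra.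
Qed.

Lemma ln_increment (n u : R) : 0 < n -> 0 <= u -> 0 <= ln (n + u) - ln n <= u / n.
Proof.
intros Hn Hu. split; [assert (ln n <= ln (n + u)) by (apply ln_le; lra); lra|].
rewrite <- ln_div by lra. assert (H := ln_le_sub1 ((n + u) / n) ltac:(apply Rdiv_lt_0_compat; lra)).
replace ((n + u) / n - 1) with (u / n) in H by (field; lra). exact H.
Qed.

(** On [n, n + x] the function zeta'0 a - a ln n has derivative ln a - ln n - Y 1 a. The logarithms
    differ by at most 1 / n and Y 1 is at most 3 / (n - 1), which gives the 4. *)
Lemma zeta'0_increment (zeta Y : C -> C -> C) (A n x : R) : is_Hurwitz_zeta zeta ->
  entire_part zeta Y A -> A < 0 ->
  1 < n -> 0 <= x <= 1 ->
  Cmod (zeta'0 zeta (RtoC (n + x)) - zeta'0 zeta (RtoC n) - RtoC (x * ln n))%C <= 4 / (n - 1).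
Proof.
intros Hz HY HA Hn Hx.
replace (zeta'0 zeta (RtoC (n + x)) - zeta'0 zeta (RtoC n) - RtoC (x * ln n))%C with
 ((zeta'0 zeta (RtoC n + RtoC x) - RtoC (ln n) * (RtoC n + RtoC x)) - (zeta'0 zeta (RtoC n) - RtoC
   (ln n) * RtoC n))%C
 by (rewrite RtoC_plus, RtoC_mult; ring).
apply Rle_trans with (4 / (n - 1) * Cmod (RtoC x)).
2: { rewrite Cmod_R, Rabs_pos_eq by lra. assert (0 < 4 / (n - 1)) by (apply Rdiv_lt_0_compat; lra).
  nra. }
assert (Hp : forall u, 0 <= u <= 1 -> (RtoC n + RtoC u * RtoC x)%C = RtoC (n + u * x)) by (intros;
  rewrite RtoC_plus, RtoC_mult; reflexivity).
apply (cder_lip (fun a => zeta'0 zeta a - RtoC (ln n) * a)%C (RtoC n) (RtoC x)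
  (fun u => Clog (RtoC (n + u * x)) - Y 1 (RtoC (n + u * x)) - RtoC (ln n) * 1)%C).
- intros u Hu. rewrite Hp by exact Hu. assert (0 <= u * x) by nra.
  apply cder_minus; [|apply cder_scal, cder_id]. apply (cder_zeta'0 zeta Y A); auto.
    rewrite Re_RtoC; lra.
- intros u Hu. assert (Hux : 0 <= u * x <= 1) by nra.
  rewrite Clog_RtoC by lra.
  replace (RtoC (ln (n + u * x)) - Y 1 (RtoC (n + u * x)) - RtoC (ln n) * 1)%C
    with (RtoC (ln (n + u * x) - ln n) - Y 1 (RtoC (n + u * x)))%C by (rewrite RtoC_minus; ring).
  apply Rle_trans with (1 := Cmod_tri3 _ _). rewrite Cmod_R.
  destruct (ln_increment n (u * x) ltac:(lra) ltac:(lra)) as [l1 l2].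
  rewrite Rabs_pos_eq by lra.
  assert (K := entire_part_decay zeta Y A (n + u * x) Hz HY HA ltac:(lra)).
  assert (K1 : / (n + u * x - 1) <= / (n - 1)) by (apply Rinv_le_contravar; lra).
  assert (K2 : / n <= / (n - 1)) by (apply Rinv_le_contravar; lra).
  assert (K3 : 0 < / n) by (apply Rinv_0_lt_compat; lra).
  unfold Rdiv in *. assert (u * x * / n <= 1 * / n) by (apply Rmult_le_compat_r; lra). lra.
Qed.

(** Stirling's expansion on the zeta side. Differentiating the recursion at s = 0 writes dY 0 n as
    the integral of (1 - u) (Y 1 (n + u) - ln (n + u)), which is - (1/2) ln n up to O(1 / n). *)
Lemma zeta'0_asymptotic (zeta Y : C -> C -> C) (A n : R) : is_Hurwitz_zeta zeta ->
  entire_part zeta Y A -> A < 0 -> 1 < n ->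
  Cmod (zeta'0 zeta (RtoC n) - RtoC (n * ln n - n - / 2 * ln n))%C <= 4 / (n - 1).
Proof.
intros Hz HY HA Hn. assert (Hn0 : 0 < Re (RtoC n)) by (rewrite Re_RtoC; lra).
destruct (zeta'0_eq zeta Y A (RtoC n) HY HA Hn0) as [E _]. rewrite E, Clog_RtoC by lra.
destruct (HY) as (H1 & _ & H3 & _).
destruct (family_path (fun s a => Cpower a (- s)) 0 (fun u =>
  1 - u) _ _ _ _ (family_Cpower 0) Hn0 weight_1m (unit_path (RtoC n))) as (_ & _ & I1 & D1).
destruct (family_path Y (0 + 1)%C (fun u => 1 - u) _ _ _ _ (H1 (0 + 1)%C ltac:(rewrite Re_add,
  !Re_RtoC; lra)) Hn0 weight_1m (unit_path (RtoC n))) as (_ & I2 & _ & D2).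
assert (D3 := cder_comp (fun s => CInt (fun u => RtoC (1 - u) * Y s (RtoC n + RtoC u))%C) (fun s =>
  s + 1)%C 0 _ _ D2 (cder_plus _ _ _ _ _ (cder_id 0) (cder_const 1 0))).
assert (D4 := cder_plus _ _ _ _ _ D1 (cder_mult _ _ _ _ _ (cder_id 0) D3)).
cbv beta in D4.
assert (EY : dY Y 0 (RtoC n) = (CInt (fun u => RtoC (1 - u) * C_derive (fun s =>
  Cpower (RtoC n + RtoC u) (- s)) 0) + CInt (fun u => RtoC (1 - u) * Y (0 + 1) (RtoC n + RtoC
    u)))%C).
{ unfold dY. apply cder_C_derive.
  eapply cder_eq; [apply cder_ext_loc with (3 := D4) (d := - A); [lra|]|ring].
  intros y Hy. symmetry. rewrite H3; [reflexivity| |exact Hn0].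
  assert (Hr := re_le_Cmod (y - 0)%C). apply Rabs_le_between in Hr. rewrite Re_sub, Re_RtoC in Hr.
    lra. }
(* Writing the half as the integral of 1 - u allows ln n to be compared with ln (n + u) under one
   integral. *)
assert (Hhalf : cint (fun u => RtoC (1 - u) * RtoC (ln n))%C (RtoC (/ 2 * ln n))).
{ replace (RtoC (/ 2 * ln n)) with (RtoC (ln n) * Y 0 (RtoC n))%C.
  - assert (I3 : cint (fun u => RtoC (1 - u))%C (Y 0 (RtoC n))).
    { rewrite (entire_part_0 zeta Y A) by auto. rewrite <- (entire_part_0 zeta Y A (RtoC n)) by
      auto.
      destruct (family_path (fun s a => Cpower a (- s)) 0 (fun u =>
        1 - u) _ _ _ _ (family_Cpower 0) Hn0 weight_1m (unit_path (RtoC n))) as (_ & I0 & _ & _).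
      replace (Y 0 (RtoC n)) with (CInt (fun u => RtoC (1 - u) * Cpower (RtoC n + RtoC u) (- 0))%C).
      - revert I0. apply cint_ext. intros u _. replace (- 0)%C with (RtoC 0) by ring.
          rewrite Cpower_0. ring.
      - symmetry. rewrite H3 by (rewrite ?Re_RtoC; lra). unfold next_strip, pow_mean. ring. }
    apply cint_ext with (2 := cint_scal (RtoC (ln n)) _ _ I3). intros; ring.
  - rewrite (entire_part_0 zeta Y A) by auto. rewrite <- RtoC_mult. f_equal. ring. }
assert (I4 := cint_plus _ _ _ _ (cint_plus _ _ _ _ I1 I2) Hhalf).
replace (dY Y 0 (RtoC n) + RtoC n * RtoC (ln n) - RtoC n - RtoC (n * ln n - n - / 2 * ln n))%C
 with (dY Y 0 (RtoC n) + RtoC (/ 2 * ln n))%C by (rewrite !RtoC_minus, !RtoC_mult; ring).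
rewrite EY. apply (cint_bound_const _ _ _ I4). intros u Hu. cbv beta.
rewrite (cder_C_derive _ _ _ (cder_Cpower_exponent (RtoC n + RtoC u)%C 0)).
replace (- 0)%C with (RtoC 0) by ring. rewrite Cpower_0. replace (0 + 1)%C with (RtoC 1) by ring.
rewrite <- RtoC_plus, Clog_RtoC by lra.
replace (RtoC (1 - u) * (- RtoC (ln (n + u)) * 1) + RtoC (1 - u) * Y 1 (RtoC (n + u)) + RtoC (1 -
  u) * RtoC (ln n))%C
 with (RtoC (1 - u) * (Y 1 (RtoC (n + u)) - RtoC (ln (n + u) - ln n)))%C by (rewrite (RtoC_minus
   (ln (n + u))); ring).
rewrite Cmod_Rmul by lra.
destruct (ln_increment n u ltac:(lra) ltac:(lra)) as [l1 l2].
assert (K0 := Cmod_tri3 (Y 1 (RtoC (n + u))) (RtoC (ln (n + u) - ln n))). rewrite Cmod_R,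
  Rabs_pos_eq in K0 by lra.
assert (K := entire_part_decay zeta Y A (n + u) Hz HY HA ltac:(lra)).
assert (K1 : / (n + u - 1) <= / (n - 1)) by (apply Rinv_le_contravar; lra).
assert (K2 : / n <= / (n - 1)) by (apply Rinv_le_contravar; lra).
assert (K3 : 0 < / n) by (apply Rinv_0_lt_compat; lra).
assert (K4 : u * / n <= 1 * / n) by (apply Rmult_le_compat_r; lra).
assert (K5 := Cmod_ge_0 (Y 1 (RtoC (n + u)) - RtoC (ln (n + u) - ln n))%C).
unfold Rdiv in *. nra.
Qed.

(** * Analyticity in the parameter *)

(** With |h / z| <= 1/4 the linear factor of the remainder is absorbed by n + 2 <= 2 * 2^n, and the
    ratio 1/2 remains. *)
Lemma cps_inv_sqr (z h : C) : z <> 0 -> Cmod h <= Cmod z / 4 ->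
  cps (fun k => RtoC (INR k + 1) * (- / z) ^ k * (/ z * / z))%C h (/ (z + h) * / (z + h))%C.
Proof.
intros Hz Hh. assert (Hm : 0 < Cmod z) by (apply Cmod_gt_0, Hz).
assert (Hzh0 : Cmod z / 2 < Cmod (z + h)%C) by (generalize (Cmod_tri_rev z h); lra).
assert (Hzh : (z + h)%C <> 0) by (apply Cmod_gt_0; lra).
set (t := (- (h / z))%C).
assert (Ht : Cmod t <= / 4).
{ unfold t. rewrite Cmod_opp, Cmod_div by exact Hz. apply Rmult_le_reg_r with (Cmod z); [exact Hm|].
  unfold Rdiv. rewrite Rmult_assoc, Rinv_l by lra. lra. }
(* Exact remainder: 1/(1-t)^2 minus the sum of (k+1) t^k for k <= n equals t^(n+1) ((n+2) - (n+1) t)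
   / (1-t)^2. *)
assert (E : forall n, (/ (z + h) * / (z + h) - csum (fun k =>
  RtoC (INR k + 1) * (- / z) ^ k * (/ z * / z) * h ^ k) n
  = / (z + h) * / (z + h) * (t ^ S n * (RtoC (INR n + 2) - RtoC (INR n + 1) * t)))%C).
{ assert (Hpow : forall k, ((- / z) ^ k * h ^ k = t ^ k)%C).
  { intros k. rewrite <- Cpow_mult_l. f_equal. unfold t. field. exact Hz. }
  assert (Hh' : h = (- (t * z))%C) by (unfold t; field; exact Hz).
  assert (Hzt : (/ (z + h) * / (z + h) = / z * / z * (/ (1 - t) * / (1 - t)))%C).
  { assert (E1 : (z + h = z * (1 - t))%C) by (rewrite Hh'; ring). rewrite E1.
    assert (E2 : (1 - t)%C <> 0) by (intros E2; apply Hzh; rewrite E1, E2; ring). field. auto. }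
  assert (E2 : (1 - t)%C <> 0).
  { apply Cmod_gt_0. generalize (Cmod_tri_rev 1 (- t)%C). rewrite Cmod_1, Cmod_opp. unfold Cminus.
    lra. }
  induction n.
  - rewrite csum_0, Hzt. simpl. rewrite !RtoC_plus. field. auto.
  - rewrite csum_S.
    match goal with |- (?a - (?b + ?c))%C = _ => replace (a - (b + c))%C with ((a - b) - c)%C by
      ring end.
    rewrite IHn.
    replace (RtoC (INR (S n) + 1) * (- / z) ^ S n * (/ z * / z) * h ^ S n)%C with (RtoC (INR (S n)
      + 1) * t ^ S n * (/ z * / z))%C by (rewrite <- Hpow; ring).
    rewrite Hzt, S_INR, !RtoC_plus. rewrite (Cpow_S t (S n)). field. auto. }
apply cps_of_remainder with (Cmod (/ (z + h) * / (z + h)) * 4) (/ 2); [lra|]. intros n. rewrite E,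
  Cmod_mult, Rmult_assoc.
apply Rmult_le_compat_l; [apply Cmod_ge_0|]. rewrite Cmod_mult, Cmod_pow.
assert (Hn := pos_INR n).
assert (B1 : Cmod (RtoC (INR n + 2) - RtoC (INR n + 1) * t)%C <= 2 * (INR n + 2)).
{ apply Rle_trans with (1 := Cmod_tri3 _ _). rewrite Cmod_mult, !Cmod_R, !Rabs_pos_eq by lra.
  assert (0 <= Cmod t) by apply Cmod_ge_0. nra. }
assert (B2 : Cmod t ^ S n <= (/ 4) ^ S n) by (apply pow_incr; split; [apply Cmod_ge_0|exact Ht]).
assert (B3 : INR n + 2 <= 2 * 2 ^ n).
{ clear. induction n; [simpl; lra|]. rewrite S_INR. simpl pow. assert (1 <=
  2 ^ n) by (apply pow_R1_Rle; lra). lra. }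
apply Rle_trans with ((/ 4) ^ S n * (2 * (INR n + 2))).
- apply Rmult_le_compat; [apply pow_le, Cmod_ge_0|apply Cmod_ge_0|exact B2|exact B1].
- apply Rle_trans with ((/ 4) ^ S n * (4 * 2 ^ n)); [apply Rmult_le_compat_l; [apply pow_le;
    lra|lra]|].
  replace ((/ 4) ^ S n * (4 * 2 ^ n)) with ((/ 4) ^ n * 2 ^ n) by (simpl; field).
  rewrite <- Rpow_mult_distr. replace (/ 4 * 2) with (/ 2) by field.
  assert (0 < (/ 2) ^ n) by (apply pow_lt; lra). lra.
Qed.

(** Analyticity in a starts here, since zeta 2 is the second derivative of [zeta'0] and still given
    by its series. The terms 1/(n + a)^2 are expanded in a common disc of radius e / 4 with Cauchy
    constants of order 1 / (n + 1)^2. *)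
Lemma zeta2_analytic (zeta : C -> C -> C) (a : C) : is_Hurwitz_zeta zeta -> 0 < Re a ->
  analytic_geo_at (fun a => zeta (RtoC 2) a) a.
Proof.
intros Hz Ha.
set (b := fun n => (RtoC (INR n) + a)%C).
set (e := Rmin (Re a) 1). assert (He : 0 < e) by (apply Rmin_pos; lra).
assert (He1 := Rmin_l (Re a) 1). assert (He2 := Rmin_r (Re a) 1). fold e in He1, He2.
assert (Hb : forall n, e * (INR n + 1) <= Re (b n)).
{ intros n. unfold b. rewrite Re_natp. assert (Hn := pos_INR n). nra. }
assert (Hb0 : forall n, e <= Re (b n)) by (intros n; specialize (Hb n); assert (Hn := pos_INR n);
  nra).
assert (Hbn : forall n, b n <> 0) by (intros n; apply Cpos_neq0; specialize (Hb0 n); lra).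
set (m := fun n => / e ^ 2 * / (INR n + 1) ^ 2).
assert (Hg : forall n, geo (fun k => RtoC (INR k + 1) * (- / b n) ^ k * (/ b n * / b n))%C (e / 4)
  (m n)).
{ intros n k. assert (Hk := pos_INR k). assert (Hn := pos_INR n).
  assert (HC : 0 < Cmod (b n)) by (apply Cmod_gt_0, Hbn).
  assert (HC1 := Re_le_Cmod (b n)). specialize (Hb n). specialize (Hb0 n).
  rewrite !Cmod_mult, Cmod_pow, Cmod_opp, Cmod_inv, Cmod_R, Rabs_pos_eq by (auto; lra).
  replace ((INR k + 1) * (/ Cmod (b n)) ^ k * (/ Cmod (b n) * / Cmod (b n)) * (e / 4) ^ k)
   with (((INR k + 1) * (/ 4) ^ k) * (/ Cmod (b n) * e) ^ k * (/ Cmod (b n)) ^ 2)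
   by (unfold Rdiv; rewrite !Rpow_mult_distr; ring).
  assert (K1 : (INR k + 1) * (/ 4) ^ k <= 1).
  { clear. induction k; [simpl; lra|]. rewrite S_INR. simpl pow.
    assert (0 < (/ 4) ^ k) by (apply pow_lt; lra).
    assert (Hk := pos_INR k). nra. }
  assert (K0 : 0 <= (INR k + 1) * (/ 4) ^ k) by (apply Rmult_le_pos; [lra|apply pow_le; lra]).
  assert (Hi : 0 < / Cmod (b n)) by (apply Rinv_0_lt_compat, HC).
  assert (K2 : 0 <= / Cmod (b n) * e <= 1).
  { split; [apply Rmult_le_pos; lra|]. apply Rmult_le_reg_l with (Cmod (b n)); [exact HC|].
    rewrite <- Rmult_assoc, Rinv_r by lra. lra. }
  assert (K3 : 0 <= (/ Cmod (b n) * e) ^ k <= 1).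
  { split; [apply pow_le; lra|]. rewrite <- (pow1 k). apply pow_incr. lra. }
  assert (K4 : (/ Cmod (b n)) ^ 2 <= m n).
  { unfold m. rewrite <- Rinv_mult, <- Rpow_mult_distr, <- pow_inv. apply pow_incr. split; [lra|].
    apply Rinv_le_contravar; [apply Rmult_lt_0_compat; lra|lra]. }
  assert (K5 : 0 <= (/ Cmod (b n)) ^ 2) by (apply pow_le; lra).
  rewrite <- (Rmult_1_l (m n)). apply Rmult_le_compat; auto; [apply Rmult_le_pos; lra|].
  rewrite <- (Rmult_1_l 1). apply Rmult_le_compat; lra. }
assert (Hm : ex_series m) by apply ex_series_scal_inv_sqr.
set (ck := fun k => CSer (fun n => RtoC (INR k + 1) * (- / b n) ^ k * (/ b n * / b n))%C).
assert (Hck : forall k, cser (fun n => RtoC (INR k + 1) * (- / b n) ^ k * (/ b n * / b n))%C (ck k)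
  /\ Cmod (ck k) * (e / 4) ^ k <= Series m).
{ intros k. assert (Hp : 0 < (e / 4) ^ k) by (apply pow_lt; lra).
  assert (Hbd : forall n, Cmod (RtoC (INR k + 1) * (- / b n) ^ k * (/ b n * / b n))%C <=
    / (e / 4) ^ k * m n).
  { intros n. apply Rmult_le_reg_r with ((e / 4) ^ k); [exact Hp|].
    replace (/ (e / 4) ^ k * m n * (e / 4) ^ k) with (m n) by (field; lra). apply Hg. }
  assert (Hex : ex_series (fun n => / (e / 4) ^ k * m n)) by exact (ex_series_scal_l (K :=
    R_AbsRing) (V := R_NormedModule) _ m Hm).
  assert (Hs := cser_CSer _ _ Hbd Hex). split; [exact Hs|].
  apply Rmult_le_reg_l with (/ (e / 4) ^ k); [apply Rinv_0_lt_compat, Hp|].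
  replace (/ (e / 4) ^ k * (Cmod (ck k) * (e / 4) ^ k)) with (Cmod (ck k)) by (field; lra).
  rewrite <- Series_scal_l. apply (cser_bound _ _ _ Hs Hbd Hex). }
exists ck, (e / 4), (Series m). split; [lra|]. split; [intros k; apply Hck|].
intros h Hh.
apply (cps_series (fun n k => RtoC (INR k + 1) * (- / b n) ^ k * (/ b n * / b n))%C ck m (e / 4) h
  _ (fun n => / (b n + h) * / (b n + h))%C); auto; [lra|intros k; apply Hck| |].
- intros n. apply cps_inv_sqr; [apply Hbn|]. specialize (Hb0 n). assert (HC1 := Re_le_Cmod (b n)).
    lra.
- assert (HRe : 0 < Re (a + h)%C).
  { rewrite Re_add. assert (Hr := re_le_Cmod h). apply Rabs_le_between in Hr. lra. }
  assert (H := proj1 (Hz (a + h)%C HRe) (RtoC 2) ltac:(rewrite Re_RtoC; lra)).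
  revert H. apply cser_ext. intros n. unfold b. rewrite <- Cplus_assoc. apply Cpower_m2.
  apply Cpos_neq0. rewrite Re_natp. generalize (pos_INR n); lra.
Qed.

(** Integrate the power series of f termwise along the segment from z to z + h. The new coefficients
    c j / (j + 1) keep Cauchy's estimate, with one extra factor r. *)
Lemma analytic_antiderivative (F f : C -> C) (z : C) (d : R) : 0 < d ->
  (forall h, Cmod h < d -> cder F (z + h)%C (f (z + h)%C)) ->
  (forall h, Cmod h < d -> ccont f (z + h)%C) ->
  analytic_geo_at f z -> analytic_geo_at F z.
Proof.
intros Hd HF Hf (c & r & M & Hr & HM & Hc).
assert (HM0 := geo_M_ge_0 _ _ _ HM).
set (c' := fun k => match k with O => F z | S j => / RtoC (INR j + 1) * c j end%C).
exists c', (Rmin d r), (Cmod (F z) + r * M).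
assert (Hm : 0 < Rmin d r) by (apply Rmin_pos; lra).
assert (Hml := Rmin_l d r). assert (Hmr := Rmin_r d r).
split; [exact Hm|]. split.
- intros [|j].
  + simpl. assert (0 <= r * M) by (apply Rmult_le_pos; lra). lra.
  + unfold c'. rewrite Cmod_mult, Cmod_inv, Cmod_R by apply RtoC_S_neq0.
    assert (Hj := pos_INR j). rewrite Rabs_pos_eq by lra.
    assert (Hi : 0 < / (INR j + 1) <= 1).
    { split; [apply Rinv_0_lt_compat; lra|]. rewrite <- Rinv_1. apply Rinv_le_contravar; lra. }
    assert (Hcj := Cmod_ge_0 (c j)). assert (HMj := HM j).
    assert (Hpw : Rmin d r ^ S j <= r ^ S j) by (apply pow_incr; lra).
    assert (Hpw0 : 0 <= Rmin d r ^ S j) by (apply pow_le; lra).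
    apply Rle_trans with (Cmod (c j) * r ^ S j).
    * apply Rmult_le_compat; auto; [apply Rmult_le_pos; lra|]. nra.
    * simpl. replace (Cmod (c j) * (r * r ^ j)) with (r * (Cmod (c j) * r ^ j)) by ring.
      assert (r * (Cmod (c j) * r ^ j) <= r * M) by (apply Rmult_le_compat_l; lra).
      generalize (Cmod_ge_0 (F z)); lra.
- intros h Hh. set (q := Cmod h / r).
  assert (Hq : 0 <= q < 1) by (apply Cmod_ratio; lra).
  assert (Huh : forall u, 0 <= u <= 1 -> Cmod (RtoC u * h)%C <= Cmod h) by (intros;
    apply Cmod_Rmul_le; assumption).
  assert (I1 := cint_FTC F f z h (fun u Hu => HF _ (Rle_lt_trans _ _ _ (Huh u Hu) (Rlt_le_trans _ _
    _ Hh Hml)))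
     (fun u Hu => Hf _ (Rle_lt_trans _ _ _ (Huh u Hu) (Rlt_le_trans _ _ _ Hh Hml)))).
  assert (I2 : forall n, cint (fun u => h * csum (fun k => c k * (RtoC u * h) ^ k) n)%C (csum (fun
    k => c' k * h ^ k) (S n) - F z)%C).
  { intros n. rewrite csum_shift. simpl (c' 0%nat).
    replace (F z * h ^ 0 + csum (fun k => c' (S k) * h ^ S k) n - F z)%C with (csum (fun k =>
      c' (S k) * h ^ S k) n)%C by (simpl; ring).
    apply cint_ext with (fun u => csum (fun k => h * (c k * (RtoC u * h) ^ k)) n)%C; [intros;
      apply csum_scal|].
    apply (cint_csum (fun k u => h * (c k * (RtoC u * h) ^ k))%C). intros k _.
    assert (Ik : cint (fun u => RtoC (u ^ k)) (RtoC (/ INR (S k)))).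
    { apply cint_components. split; [apply is_RInt_pow01|]. apply (is_RInt_ext (fun _ => 0));
      [reflexivity|].
      evar_last; [apply (is_RInt_const (V := R_NormedModule))|]. apply (scal_zero_r (V :=
        R_NormedModule)). }
    replace (c' (S k) * h ^ S k)%C with (h * c k * h ^ k * RtoC (/ INR (S k)))%C.
    - apply cint_ext with (2 := cint_scal (h * c k * h ^ k)%C _ _ Ik). intros u _.
        rewrite Cpow_mult_l, RtoC_pow. ring.
    - unfold c'. rewrite S_INR, RtoC_inv by (generalize (pos_INR k); lra). simpl. ring. }
  assert (HR : forall n, Cmod (F (z + h) - csum (fun k => c' k * h ^ k) (S n))%C <=
    Cmod h * (M * q ^ S n / (1 - q))).
  { intros n. assert (I3 := cint_minus _ _ _ _ I1 (I2 n)).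
    replace (F (z + h) - csum (fun k => c' k * h ^ k) (S n))%C with (F (z + h) - F z - (csum (fun k
      => c' k * h ^ k) (S n) - F z))%C by ring.
    apply (cint_bound_const _ _ _ I3). intros u Hu. cbv beta.
    match goal with |- Cmod (h * ?x - h * ?y)%C <= _ => replace (h * x - h * y)%C with (h * (x -
      y))%C by ring end.
    rewrite Cmod_mult. apply Rmult_le_compat_l; [apply Cmod_ge_0|].
    specialize (Huh u Hu).
    apply cps_remainder with r; auto; [unfold q; replace (Cmod h / r * r) with (Cmod h) by (field;
      lra); exact Huh|].
    apply Hc. lra. }
  apply cps_eps. intros eps He.
  set (B := Cmod h * (M / (1 - q)) + 1).
  assert (HMq : 0 <= M / (1 - q)) by (apply Rmult_le_pos; [lra|apply Rlt_le, Rinv_0_lt_compat;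
    lra]).
  assert (HB : 0 < B) by (unfold B; generalize (Rmult_le_pos _ _ (Cmod_ge_0 h) HMq); lra).
  destruct (pow_lt_1_zero q ltac:(rewrite Rabs_pos_eq; lra) (eps / B)) as [N HN];
    [apply Rdiv_lt_0_compat; lra|].
  exists (S N). intros n Hn. destruct n; [lia|].
  specialize (HN (S n) ltac:(lia)). assert (Hqn : 0 <= q ^ S n) by (apply pow_le; lra).
    rewrite Rabs_pos_eq in HN by exact Hqn.
  rewrite Cmod_sub_sym. apply Rle_lt_trans with (1 := HR n).
  apply Rle_lt_trans with (B * q ^ S n).
  + unfold B. replace (Cmod h * (M * q ^ S n / (1 - q))) with (Cmod h * (M / (1 - q)) * q ^ S n) by
      (field; lra). nra.
  + apply lt_div_mul_l in HN; [|lra]. exact HN.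
Qed.

Lemma ball_Re_lt (a h : C) : 0 < Re a -> Cmod h < Re a / 2 -> 0 < Re (a + h)%C.
Proof. intros Ha Hh. assert (H := ball_Re_pos a h Hh). lra. Qed.

(** Two antiderivatives lead from zeta 2 to [zeta'0]: the derivative of [zeta'0] is log a - Y 1 a,
    and the derivative of that is zeta 2 a. *)
Lemma zeta'0_analytic (zeta Y : C -> C -> C) (A : R) (a : C) : is_Hurwitz_zeta zeta ->
  entire_part zeta Y A -> A < 0 -> 0 < Re a ->
  C_analytic_at (zeta'0 zeta) a.
Proof.
intros Hz HY HA Ha.
assert (D1 : forall b, 0 < Re b -> cder (fun a => Clog a - Y 1 a)%C b (zeta (RtoC 2) b)).
{ intros b Hb. destruct (cder_entire_part zeta Y A 1 b HY ltac:(rewrite Re_RtoC; lra) Hb) as [D _].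
  apply cder_eq with (1 := cder_minus _ _ _ _ _ (cder_Clog b Hb) D).
  destruct HY as (_ & H2 & _). rewrite (H2 (RtoC 2) b) by (try apply Cneq_re; rewrite ?Re_RtoC;
    lra).
  rewrite <- RtoC_plus. replace (1 + 1) with 2 by ring.
  unfold pole_part. replace (1 - RtoC 2)%C with (- (1))%C by (rewrite <- RtoC_minus, <- RtoC_opp;
    f_equal; ring).
  rewrite Cpower_m1 by (apply Cpos_neq0, Hb). rewrite <- RtoC_minus. replace (2 - 1) with 1 by ring.
  field. repeat split; first [apply Cpos_neq0, Hb|apply RtoC_neq0; lra]. }
assert (D2 : forall b, 0 < Re b -> analytic_geo_at (fun a => zeta (RtoC 2) a) b) by (intros;
  apply zeta2_analytic; assumption).
assert (D3 : analytic_geo_at (zeta'0 zeta) a).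
{ apply (analytic_antiderivative _ (fun a => Clog a - Y 1 a)%C a (Re a / 2)); [lra| | |].
  - intros h Hh. apply (cder_zeta'0 zeta Y A); auto. apply ball_Re_lt; assumption.
  - intros h Hh. eapply cder_ccont, D1. apply ball_Re_lt; assumption.
  - apply (analytic_antiderivative _ (fun a => zeta (RtoC 2) a) a (Re a / 2)); [lra| | |].
    + intros h Hh. apply D1, ball_Re_lt; assumption.
    + intros h Hh. destruct (D2 (a + h)%C (ball_Re_lt a h Ha Hh)) as (c & r & M & Hr & HM & Hc).
      eapply cder_ccont, (cps_cder (fun a => zeta (RtoC 2) a) _ c r M Hr HM Hc).
    + apply D2, Ha. }
destruct D3 as (c & r & M & Hr & _ & Hc). apply analytic_intro with (1 := Hr) (2 := Hc).
Qed.

(** * Lerch's formula *)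

Lemma log_Gamma_real (L : C -> C) (p : R) : is_log_Gamma L -> 1 <= p ->
  L (RtoC p) = RtoC (Re (L (RtoC p))) /\ gamma_lub p (exp (Re (L (RtoC p)))).
Proof.
intros (_ & H2 & H3) Hp.
assert (E : L (RtoC p) = RtoC (Re (L (RtoC p)))).
{ apply Ceq; [reflexivity|]. rewrite Im_RtoC. apply H3. lra. }
split; [exact E|].
destruct (gamma_lub_exists p Hp) as [G HG].
assert (H := H2 (RtoC p) ltac:(rewrite Re_RtoC; lra)). rewrite E, Cexp_RtoC in H.
rewrite (CGamma_real p G HG) in H. apply RtoC_inj in H. rewrite H. exact HG.
Qed.

Lemma log_Gamma_succ (L : C -> C) (p : R) : is_log_Gamma L -> 1 <= p ->
  Re (L (RtoC (p + 1))) = Re (L (RtoC p)) + ln p.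
Proof.
intros HL Hp. destruct (log_Gamma_real L p HL Hp) as [_ H1].
destruct (log_Gamma_real L (p + 1) HL ltac:(lra)) as [_ H2].
assert (H := gamma_succ p _ _ Hp H1 H2).
apply (f_equal ln) in H. rewrite ln_mult, !ln_exp in H by (try apply exp_pos; lra). lra.
Qed.

Lemma log_Gamma_wendel (L : C -> C) (y x : R) : is_log_Gamma L -> 1 <= y -> 0 <= x <= 1 ->
  Re (L (RtoC (y + x))) <= Re (L (RtoC y)) + x * ln y.
Proof.
intros HL Hy Hx. destruct (log_Gamma_real L y HL Hy) as [_ H1].
destruct (log_Gamma_real L (y + x) HL ltac:(lra)) as [_ H2].
assert (H := gamma_wendel y x _ _ Hy Hx H1 H2). unfold Rpower in H. rewrite <- exp_plus in H.
apply Rnot_lt_le. intros K. apply exp_increasing in K.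
rewrite (Rplus_comm (x * ln y)) in H. lra.
Qed.

Lemma log_Gamma_fact (L : C -> C) (n : nat) : is_log_Gamma L ->
  Re (L (RtoC (INR (S n)))) = ln (INR (fact n)).
Proof.
intros HL. induction n.
- simpl. rewrite ln_1. destruct (log_Gamma_real L 1 HL ltac:(lra)) as [_ H].
  apply gamma_1 in H. rewrite <- (ln_exp (Re (L (RtoC 1)))), H. apply ln_1.
- assert (Hn := pos_INR n). rewrite (S_INR (S n)). rewrite log_Gamma_succ by (auto; rewrite S_INR;
    lra).
  rewrite IHn, fact_simpl, mult_INR, ln_mult; [ring|rewrite S_INR; lra|apply INR_fact_lt_0].
Qed.

(** Wendel's inequality is used twice: the step from n to n + x gives the upper bound, the step from
    n + x to n + 1 together with the functional equation gives the lower bound. *)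
Lemma log_Gamma_increment (L : C -> C) (n x : R) : is_log_Gamma L -> 1 < n -> 0 <= x <= 1 ->
  Cmod (L (RtoC (n + x)) - L (RtoC n) - RtoC (x * ln n))%C <= / (n - 1).
Proof.
intros HL Hn Hx.
destruct (log_Gamma_real L n HL ltac:(lra)) as [E1 _]. destruct (log_Gamma_real L (n + x) HL
  ltac:(lra)) as [E2 _].
rewrite E1, E2, <- !RtoC_minus, Cmod_R.
assert (K1 := log_Gamma_wendel L n x HL ltac:(lra) Hx).
assert (K2 := log_Gamma_wendel L (n + x) (1 - x) HL ltac:(lra) ltac:(lra)).
replace (n + x + (1 - x)) with (n + 1) in K2 by ring. rewrite log_Gamma_succ in K2 by (auto; lra).
destruct (ln_increment n x ltac:(lra) ltac:(lra)) as [l1 l2].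
assert (Hi : 0 < / n) by (apply Rinv_0_lt_compat; lra).
assert (Hi2 : / n <= / (n - 1)) by (apply Rinv_le_contravar; lra).
assert (l3 : x / n <= / n) by (unfold Rdiv; nra).
assert (l4 : (1 - x) * (ln (n + x) - ln n) <= 1 * / n).
{ apply Rmult_le_compat; lra. }
apply Rabs_le. lra.
Qed.

Lemma eq_of_arbitrarily_close (z w : C) (K : R) :
  (forall n, Cmod (z - w)%C <= K / INR (S n)) -> z = w.
Proof.
intros H. assert (E : Cmod (z - w)%C = 0).
{ apply Rle_antisym; [|apply Cmod_ge_0]. apply le_epsilon. intros eps He. rewrite Rplus_0_l.
  assert (HK : 0 < Rabs K + 1) by (generalize (Rabs_pos K); lra).
  destruct (archimed_cor1 (eps / (Rabs K + 1))) as (N & HN & HN0); [apply Rdiv_lt_0_compat; lra|].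
  apply Rle_trans with (1 := H N).
  assert (Hp : 0 < INR N) by (apply lt_0_INR; lia).
  assert (Hi : / INR (S N) <= / INR N) by (apply Rinv_le_contravar; [lra|rewrite S_INR; lra]).
  assert (Hi0 : 0 < / INR (S N)) by (apply Rinv_0_lt_compat; rewrite S_INR; lra).
  assert (Hb : (Rabs K + 1) * / INR N <= eps).
  { apply lt_div_mul_l in HN; [|lra]. lra. }
  assert (K <= Rabs K + 1) by (generalize (Rle_abs K); lra). unfold Rdiv. nra. }
apply Cmod_eq_0 in E. replace z with (z - w + w)%C by ring. rewrite E. ring.
Qed.

Section Lerch.

Variables (L : C -> C) (zeta Y : C -> C -> C) (A : R).
Hypotheses (HL : is_log_Gamma L) (Hz : is_Hurwitz_zeta zeta) (HY : entire_part zeta Y A) (HA : A <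
  0).

Let D (a : C) : C := (L a - zeta'0 zeta a)%C.

Lemma Lerch_periodic (p : R) : 1 <= p -> D (RtoC (p + 1)) = D (RtoC p).
Proof.
intros Hp. unfold D.
destruct (log_Gamma_real L p HL Hp) as [E1 _]. destruct (log_Gamma_real L (p + 1) HL ltac:(lra)) as
  [E2 _].
rewrite E1, E2, log_Gamma_succ, !RtoC_plus by auto.
rewrite (zeta'0_shift zeta Y A) by (auto; rewrite Re_RtoC; lra).
rewrite Clog_RtoC by lra. ring.
Qed.

Lemma Lerch_periodic_nat (p : R) (n : nat) : 1 <= p -> D (RtoC (p + INR n)) = D (RtoC p).
Proof.
intros Hp. induction n; [simpl; rewrite Rplus_0_r; reflexivity|].
rewrite S_INR, <- Rplus_assoc, Lerch_periodic; [exact IHn|generalize (pos_INR n); lra].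
Qed.

(** D has period 1, so its increment can be measured after a shift by n + 1. There both sides grow
    like x ln N up to 1 / (N - 1) and 4 / (N - 1), so the increment is at most 5 / (n + 1). *)
Lemma Lerch_interval (x : R) : 0 <= x <= 1 -> D (RtoC (1 + x)) = D (RtoC 1).
Proof.
intros Hx. apply (eq_of_arbitrarily_close _ _ 5). intros n.
rewrite <- (Lerch_periodic_nat (1 + x) (S n)), <- (Lerch_periodic_nat 1 (S n)) by lra.
set (N := 1 + INR (S n)). assert (HN : 1 < N) by (unfold N; rewrite S_INR; generalize (pos_INR n);
  lra).
replace (1 + x + INR (S n)) with (N + x) by (unfold N; ring).
assert (K1 := log_Gamma_increment L N x HL HN Hx).
assert (K2 := zeta'0_increment zeta Y A N x Hz HY HA HN Hx).
replace (D (RtoC (N + x)) - D (RtoC N))%C with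
 ((L (RtoC (N + x)) - L (RtoC N) - RtoC (x * ln N)) - (zeta'0 zeta (RtoC (N + x)) - zeta'0 zeta
   (RtoC N) - RtoC (x * ln N)))%C by (unfold D; ring).
apply Rle_trans with (1 := Cmod_tri3 _ _).
replace (INR (S n)) with (N - 1) by (unfold N; ring). unfold Rdiv in *. lra.
Qed.

Lemma Lerch_constant_value : D (RtoC 1) = RtoC (ln (sqrt (2 * PI))).
Proof.
assert (K : forall n, Cmod (RtoC (stirling_seq (S (S n))) - D (RtoC 1))%C <= 4 / INR (S n)).
{ intros n. rewrite <- (Lerch_periodic_nat 1 (S n)) by lra.
  replace (1 + INR (S n)) with (INR (S (S n))) by (rewrite (S_INR (S n)); ring).
  set (N := INR (S (S n))). assert (HN : 1 < N) by (unfold N; rewrite !S_INR;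
    generalize (pos_INR n); lra).
  assert (K := zeta'0_asymptotic zeta Y A N Hz HY HA HN).
  destruct (log_Gamma_real L N HL ltac:(lra)) as [E _].
  assert (ES : stirling_seq (S (S n)) = Re (L (RtoC N)) - (N * ln N - N - / 2 * ln N)).
  { assert (EL : Re (L (RtoC N)) = ln (INR (fact (S n)))) by exact (log_Gamma_fact L (S n) HL).
    rewrite EL. unfold stirling_seq. fold N. rewrite fact_simpl, mult_INR, ln_mult; [fold N;
      field|fold N; lra|apply INR_fact_lt_0]. }
  unfold D. rewrite E, ES, RtoC_minus.
  replace (RtoC (Re (L (RtoC N))) - RtoC (N * ln N - N - / 2 * ln N) - (RtoC (Re (L (RtoC N))) -
    zeta'0 zeta (RtoC N)))%C
   with (zeta'0 zeta (RtoC N) - RtoC (N * ln N - N - / 2 * ln N))%C by ring.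
  replace (INR (S n)) with (N - 1) by (unfold N; rewrite (S_INR (S n)); ring). exact K. }
(* D 1 is a limit of real numbers, hence real; [stirling_constant] speaks of real limits. *)
assert (EI : RtoC (Re (D (RtoC 1))) = D (RtoC 1)).
{ apply Ceq; [reflexivity|]. rewrite Im_RtoC. symmetry. apply RtoC_inj.
  apply (eq_of_arbitrarily_close _ _ 4). intros n. apply Rle_trans with (2 := K n).
  rewrite <- RtoC_minus, Cmod_R, Rminus_0_r.
  apply Rle_trans with (2 := im_le_Cmod _). rewrite <- (Rabs_Ropp (Im (D _))). right. f_equal.
    simpl. ring. }
rewrite <- EI. f_equal. apply stirling_constant. intros eps He.
destruct (archimed_cor1 (eps / 4)) as (N & HN & HN0); [lra|].
exists (S N). intros n Hn. destruct n as [|[|n]]; [lia|lia|].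
rewrite <- Cmod_R, RtoC_minus, EI. apply Rle_lt_trans with (1 := K n).
assert (HNn : INR N <= INR (S n)) by (apply le_INR; lia).
assert (Hp : 0 < INR N) by (apply lt_0_INR; lia).
assert (Hi : / INR (S n) <= / INR N) by (apply Rinv_le_contravar; lra). unfold Rdiv in *. lra.
Qed.

Lemma Lerch (a : C) : 0 < Re a -> L a = (zeta'0 zeta a + RtoC (ln (sqrt (2 * PI))))%C.
Proof.
intros Ha. rewrite <- Lerch_constant_value.
assert (HDa : forall b, 0 < Re b -> C_analytic_at (fun b => D b - D (RtoC 1))%C b).
{ intros b Hb. apply analytic_minus; [|apply analytic_const]. apply analytic_minus; [apply HL, Hb|].
  apply (zeta'0_analytic zeta Y A); assumption. }
assert (E : (D a - D (RtoC 1))%C = 0).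
(* An interior point of [1, 2], at which the zeros furnished by [Lerch_interval] accumulate. *)
{ set (z := RtoC (3 / 2)). assert (Hz0 : 0 < Re z) by (unfold z; rewrite Re_RtoC; lra).
  rewrite <- (Cadd_sub z a) at 1. apply (identity_segment (fun b => D b - D (RtoC 1))%C).
  - intros u Hu. apply HDa, seg_Re_lt; auto. rewrite Cadd_sub. exact Ha.
  - apply isolated_zeros; [apply HDa, Hz0|]. intros d Hd.
    set (x := Rmin (d / 2) (/ 2)). assert (Hx0 : 0 < x) by (apply Rmin_pos; lra).
    assert (Hx1 := Rmin_l (d / 2) (/ 2)). assert (Hx2 := Rmin_r (d / 2) (/ 2)). fold x in Hx1, Hx2.
    exists (RtoC (1 + (/ 2 + x))). split; [|split].
    + intros E. apply RtoC_inj in E. lra.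
    + unfold z. rewrite <- RtoC_minus, Cmod_R. rewrite Rabs_pos_eq; lra.
    + rewrite Lerch_interval by lra. ring. }
replace (L a) with (D a + zeta'0 zeta a)%C by (unfold D; ring).
replace (D a) with (D a - D (RtoC 1) + D (RtoC 1))%C by ring. rewrite E. ring.
Qed.

(** Near a, [CGamma] is exp of L, and L is differentiable by Lerch's formula; the logarithmic
    derivative is thus that of [zeta'0]. *)
Lemma digamma_entire_part (a : C) : 0 < Re a -> digamma a = (Clog a - Y 1 a)%C.
Proof.
intros Ha. destruct (HL) as (_ & H2 & _).
assert (D1 : cder L a (Clog a - Y 1 a)%C).
{ assert (D0 := cder_plus _ _ _ _ _ (cder_zeta'0 zeta Y A a HY HA Ha) (cder_const (RtoC (ln (sqrt
  (2 * PI)))) a)).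
  apply cder_eq with (Clog a - Y 1 a + 0)%C; [|ring].
  apply cder_ext_loc with (3 := D0) (d := Re a / 2); [lra|]. intros y Hy. symmetry. apply Lerch.
  rewrite <- (Cadd_sub a y). apply ball_Re_lt; assumption. }
assert (D2 : cder CGamma a ((Clog a - Y 1 a) * CGamma a)%C).
{ rewrite <- H2 by exact Ha.
  apply cder_ext_loc with (3 := cder_comp _ _ _ _ _ (cder_Cexp (L a)) D1) (d := Re a / 2); [lra|].
  intros y Hy. apply H2. rewrite <- (Cadd_sub a y). apply ball_Re_lt; assumption. }
unfold digamma. rewrite (cder_C_derive _ _ _ D2). field. rewrite <- H2 by exact Ha. apply Cexp_neq0.
Qed.

(** Differentiate [zeta'0_shift] in a. The functional equation of Gamma at complex arguments is not
    involved. *)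
Lemma digamma_succ (a : C) : 0 < Re a -> digamma (a + 1)%C = (digamma a + / a)%C.
Proof.
intros Ha. assert (Ha1 : 0 < Re (a + 1)%C) by (rewrite Re_add, Re_RtoC; lra).
rewrite !digamma_entire_part by assumption.
assert (D1 := cder_comp (zeta'0 zeta) (fun b => b + 1)%C a _ _ (cder_zeta'0 zeta Y A _ HY HA Ha1)
  (cder_plus _ _ _ _ _ (cder_id a) (cder_const 1 a))).
assert (D2 := cder_plus _ _ _ _ _ (cder_zeta'0 zeta Y A a HY HA Ha) (cder_Clog a Ha)).
assert (D3 : cder (fun b => zeta'0 zeta (b + 1)%C) a (Clog a - Y 1 a + / a)%C).
{ apply cder_ext_loc with (3 := D2) (d := Re a / 2); [lra|]. intros y Hy. symmetry.
  apply (zeta'0_shift zeta Y A); auto. rewrite <- (Cadd_sub a y). apply ball_Re_lt; assumption. }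
apply cder_C_derive in D1. apply cder_C_derive in D3. rewrite <- D3, D1. ring.
Qed.

(** [g zeta 0 a] exceeds zeta'0 a by digamma(1) zeta(0, a) = gamma (a - 1/2), since zeta(0, a) = 1/2
    - a. *)
Lemma log_Gamma_g (a : C) : 0 < Re a ->
  L a = (g zeta 0 a + RtoC (ln (sqrt (2 * PI))) - Euler_gamma * (a - RtoC (1 / 2)))%C.
Proof.
intros Ha. rewrite Lerch by exact Ha.
destruct (zeta_neg_int zeta Y A 0 a HY ltac:(simpl; lra) Ha) as [E1 _].
unfold g, Euler_gamma, zeta'0. rewrite E1. simpl INR.
replace (- RtoC 0)%C with (RtoC 0) by ring. rewrite (entire_part_0 zeta Y A) by assumption.
replace (RtoC 0 + 1)%C with (RtoC 1) by ring. replace (0 + 1) with 1 by ring.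
replace (1 / 2) with (/ 2) by field. simpl. field; try (apply RtoC_neq0; lra).
Qed.

(** At s = -(n + 1), differentiating dY in a gives (n + 1) dY (-n) - Y (-n). The term - Y (-n) is
    cancelled by the 1 / (n + 1) in which digamma (n + 2) exceeds digamma (n + 1); this is the
    purpose of the digamma term in [g]. *)
Lemma cder_g (n : nat) (a : C) : A < - INR (S n) -> 0 < Re a ->
  cder (fun a => g zeta (S n) a) a (RtoC (INR (S n)) * g zeta n a)%C.
Proof.
intros HAn Ha. assert (Ha0 := Cpos_neq0 a Ha). assert (Hn := pos_INR n).
assert (HAn' : A < - INR n) by (rewrite S_INR in HAn; lra).
assert (HRe : A < Re (- RtoC (INR (S n)))%C) by (rewrite Re_opp, Re_RtoC; exact HAn).
destruct (cder_entire_part zeta Y A (- RtoC (INR (S n)))%C a HY HRe Ha) as [D0 D1].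
replace (- RtoC (INR (S n)) + 1)%C with (- RtoC (INR n))%C in D0, D1 by (rewrite S_INR, RtoC_plus;
  ring).
assert (Dp := cder_pow (S n) a).
assert (DL := cder_mult _ _ _ _ _ Dp (cder_Clog a Ha)).
set (c := (/ RtoC (INR (S n) + 1))%C).
assert (DG := cder_plus _ _ _ _ _
  (cder_minus _ _ _ _ _ (cder_plus _ _ _ _ _ D1 (cder_scal c _ _ _ DL)) (cder_scal (c * c)%C _ _ _
    Dp))
  (cder_scal (digamma (RtoC (INR (S n)) + 1)) _ _ _ (cder_minus _ _ _ _ _ D0 (cder_scal c _ _ _
    Dp)))).
cbv beta in DG.
apply cder_ext_loc with (g := fun a => g zeta (S n) a) (d := Re a / 2) in DG; [|lra|].
- apply cder_eq with (1 := DG). rewrite (g_entire_part zeta Y A n a HY HAn' Ha).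
  rewrite (digamma_succ (RtoC (INR (S n)))) by (rewrite Re_RtoC, S_INR; lra).
  replace (RtoC (INR n) + 1)%C with (RtoC (INR (S n))) by (rewrite S_INR, RtoC_plus; ring).
  unfold c. rewrite (S_INR (S n)).
  replace (RtoC (INR n + 1)) with (RtoC (INR (S n))) by (rewrite S_INR; reflexivity).
  assert (Hk0 : RtoC (INR (S n)) <> 0) by (apply RtoC_neq0; rewrite S_INR; lra).
  assert (Hk1 : (RtoC (INR (S n)) + 1)%C <> 0) by (rewrite <- RtoC_plus; apply RtoC_neq0;
    rewrite S_INR; lra).
  rewrite !(RtoC_plus (INR (S n)) 1). rewrite !(Cpow_S a).
  set (k := RtoC (INR (S n))) in *. field. auto.
- intros y Hy. symmetry. rewrite (g_entire_part zeta Y A (S n) y HY HAn); [unfold c; ring|].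
  rewrite <- (Cadd_sub a y). apply ball_Re_lt; assumption.
Qed.

End Lerch.

(** * Integration by parts *)

Lemma cder_pow_pred (n : nat) (z : C) : cder (fun y => y ^ n)%C z (RtoC (INR n) * z ^ (pred n))%C.
Proof.
destruct n; [|apply cder_pow].
apply cder_ext with (fun _ => RtoC 1); [reflexivity|]. apply cder_eq with (1 := cder_const 1 z).
  simpl. ring.
Qed.

Lemma csum_telescope (T : nat -> C) (n : nat) : csum (fun k =>
  T k - T (S k))%C n = (T O - T (S n))%C.
Proof. induction n; [apply csum_0|]. rewrite csum_S, IHn. ring. Qed.

(** The derivative of the k-th summand is T k - T (k + 1), because C(m, k + 1) = C(m, k) (m - k) /
    (k + 1); the sum telescopes to T 0. *)
Lemma cder_by_parts (G : nat -> C -> C) (m : nat) (z : C) :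
  (forall k, (k <= m)%nat -> cder (G (S k)) z (RtoC (INR (S k)) * G k z)%C) ->
  cder (fun y => csum (fun k => RtoC ((-1) ^ k / INR (k + 1) * Binomial.C m k) * y ^ (m - k) * G (S
    k) y)%C m) z
    (z ^ m * G O z)%C.
Proof.
intros HG.
(* The cut-off matters: with truncated subtraction [Binomial.C m (S m)] is 1 / (m + 1), not 0. *)
set (T := fun k => if le_lt_dec k m then (RtoC ((-1) ^ k * Binomial.C m k) * z ^ (m - k) * G k z)%C
  else RtoC 0).
assert (H := cder_csum (fun k y => RtoC ((-1) ^ k / INR (k + 1) * Binomial.C m k) * y ^ (m - k) * G
  (S k) y)%C
  (fun k _ => T k - T (S k))%C m z).
eapply cder_eq; [apply H|].
- intros k Hk.
  apply cder_eq with (1 := cder_mult _ _ _ _ _ (cder_scal (RtoC ((-1) ^ k / INR (k + 1) *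
    Binomial.C m k)) _ _ _ (cder_pow_pred (m - k) z)) (HG k Hk)).
  unfold T. destruct (le_lt_dec k m) as [_|]; [|lia].
  replace (k + 1)%nat with (S k) by lia.
  assert (Hk0 : INR (S k) <> 0) by (apply not_0_INR; lia).
  replace (RtoC ((-1) ^ k / INR (S k) * Binomial.C m k) * z ^ (m - k) * (RtoC (INR (S k)) * G k
    z))%C
   with (RtoC ((-1) ^ k * Binomial.C m k) * z ^ (m - k) * G k z)%C.
  2: { replace ((-1) ^ k * Binomial.C m k) with ((-1) ^ k / INR (S k) * Binomial.C m k * INR (S k))
    by (field; exact Hk0).
    rewrite (RtoC_mult _ (INR (S k))). ring. }
  destruct (le_lt_dec (S k) m) as [Hk'|Hk'].
  + replace (pred (m - k)) with (m - S k)%nat by lia.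
    rewrite (pascal_step3 m k) by lia.
    replace ((-1) ^ S k * (INR (m - k) / INR (S k) * Binomial.C m k)) with (- ((-1) ^ k / INR (S k)
      * Binomial.C m k * INR (m - k))) by (simpl ((-1) ^ S k); field; exact Hk0).
    rewrite RtoC_opp, (RtoC_mult _ (INR (m - k))). ring.
  + replace (m - k)%nat with O by lia. simpl (INR 0). ring.
- rewrite csum_telescope. unfold T. destruct (le_lt_dec 0 m); [|lia]. destruct (le_lt_dec (S m) m);
    [lia|].
  rewrite C_n_0, Nat.sub_0_r. simpl ((-1) ^ 0). rewrite Rmult_1_r. ring.
Qed.

Theorem theorem4 :
  forall (logGamma : C -> C) (zeta : C -> C -> C),
    is_log_Gamma logGamma -> is_Hurwitz_zeta zeta ->
  forall (a t : C) (m : nat),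
    0 < Re a -> Cmod t < Re a ->
    is_CInt_segment (fun s : C => (s ^ m * logGamma (a + s))%C) 0 t
      (- Euler_gamma * (t ^ (m + 2) / RtoC (INR (m + 2)))
       + (RtoC (ln (sqrt (2 * PI))) - Euler_gamma * (a - RtoC (1 / 2)))
         * (t ^ (m + 1) / RtoC (INR (m + 1)))
       + sum_n (G := C_AbelianMonoid)
           (fun k : nat =>
              (RtoC ((-1) ^ k / INR (k + 1) * Binomial.C m k)
               * t ^ (m - k) * g zeta (k + 1) (a + t))%C) m
       - RtoC ((-1) ^ m / INR (m + 1)) * g zeta (m + 1) a)%C.
Proof.
intros L zeta HL Hz a t m Ha Ht.
(* The formula involves g up to index m + 1, that is s = -(m + 1), which must lie strictly inside
   the half-plane. *)
destruct (entire_part_exists zeta (- INR (S (S m))) Hz) as [Y HY].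
set (A := - INR (S (S m))) in *.
assert (HA : A < 0) by (unfold A; rewrite !S_INR; generalize (pos_INR m); lra).
assert (Hseg : forall u, 0 <= u <= 1 -> 0 < Re (a + (0 + RtoC u * t))%C).
{ intros u Hu. replace (a + (0 + RtoC u * t))%C with (a + RtoC u * t)%C by ring. rewrite Re_add.
  assert (Hr := re_le_Cmod (RtoC u * t)%C). apply Rabs_le_between in Hr.
  assert (H1 := Cmod_Rmul_le u t Hu). lra. }
set (c0 := (RtoC (ln (sqrt (2 * PI))) - Euler_gamma * (a - RtoC (1 / 2)))%C).
set (n1 := RtoC (INR (S m))). set (n2 := RtoC (INR (S (S m)))).
assert (Hn1 : n1 <> 0) by (apply RtoC_neq0, not_0_INR; lia).
assert (Hn2 : n2 <> 0) by (apply RtoC_neq0, not_0_INR; lia).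
set (S1 := fun s => csum (fun k => RtoC ((-1) ^ k / INR (k + 1) * Binomial.C m k) * s ^ (m - k) * g
  zeta (S k) (a + s))%C m).
(* By [log_Gamma_g] at a + s, log Gamma (a + s) is g 0 (a + s) + c0 - gamma s: the first two terms
   integrate the polynomial part, [S1] the part with g. *)
set (F := fun s => ((- Euler_gamma * / n2) * s ^ S (S m) + (c0 * / n1) * s ^ S m + S1 s)%C).
assert (Dshift : forall z, cder (fun s => a + s)%C z 1).
{ intros z. apply cder_eq with (0 + 1)%C; [apply cder_plus; [apply cder_const|apply cder_id]|ring].
  }
assert (HF : forall z, 0 < Re (a + z)%C -> cder F z (z ^ m * L (a + z))%C).
{ intros z Hpos.
  assert (DS : cder S1 z (z ^ m * g zeta 0 (a + z))%C).
  { apply (cder_by_parts (fun k s => g zeta k (a + s)%C) m z). intros k Hk.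
    assert (Hk' : A < - INR (S k)) by (unfold A; rewrite !S_INR; apply le_INR in Hk; lra).
    apply cder_eq with (1 * (RtoC (INR (S k)) * g zeta k (a + z)))%C; [|ring].
    apply (cder_comp (fun b => g zeta (S k) b) (fun s => a + s)%C); [|apply Dshift].
    apply (cder_g L zeta Y A HL Hz HY HA k _ Hk' Hpos). }
  apply cder_eq with (1 := cder_plus _ _ _ _ _ (cder_plus _ _ _ _ _ (cder_scal _ _ _ _ (cder_pow (S
    m) z)) (cder_scal _ _ _ _ (cder_pow m z))) DS).
  rewrite (log_Gamma_g L zeta Y A HL Hz HY HA (a + z)%C Hpos). fold n1 n2. rewrite Cpow_S.
    unfold c0. field. auto. }
assert (Hint := cint_FTC F (fun s => s ^ m * L (a + s))%C 0 t (fun u Hu => HF _ (Hseg u Hu))).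
assert (Hc : forall u, 0 <= u <= 1 -> ccont (fun s => s ^ m * L (a + s))%C (0 + RtoC u * t)%C).
{ intros u Hu. eapply cder_ccont. apply cder_mult; [apply cder_pow_pred|].
  apply (cder_comp L (fun s => a + s)%C); [|apply Dshift]. apply analytic_cder, HL, Hseg, Hu. }
specialize (Hint Hc).
unfold is_CInt_segment.
(* At 0 only the summand k = m survives, through 0^0 = 1; it is the last term of the formula. *)
assert (E0 : F 0 = (RtoC ((-1) ^ m / INR (m + 1)) * g zeta (m + 1) a)%C).
{ unfold F, S1. replace (m + 1)%nat with (S m) by lia.
  replace (csum _ m) with (RtoC ((-1) ^ m / INR (S m)) * g zeta (S m) a)%C; [simpl; ring|].
  destruct m as [|m'].
  - rewrite csum_0. simpl. rewrite C_n_0. replace (a + 0)%C with a by ring.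
      replace (1 / 1 * 1) with (1 / 1) by ring. ring.
  - rewrite csum_S, (csum_ext _ (fun _ => 0 * 0)%C), csum_scal.
    + rewrite C_n_n, Nat.sub_diag, Rmult_1_r. replace (a + 0)%C with a by ring.
      replace (S m' + 1)%nat with (S (S m')) by lia. simpl (0 ^ 0)%C. ring.
    + intros k Hk. replace (S m' - k)%nat with (S (m' - k)) by lia. rewrite Cpow_S. ring. }
assert (Et : F (0 + t)%C = (- Euler_gamma * (t ^ (m + 2) / RtoC (INR (m + 2))) + c0 * (t ^ (m + 1)
  / RtoC (INR (m + 1)))
  + sum_n (G := C_AbelianMonoid) (fun k : nat => (RtoC ((-1) ^ k / INR (k + 1) * Binomial.C m k) *
      t ^ (m - k) * g zeta (k + 1) (a + t))%C) m)%C).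
{ replace (0 + t)%C with t by ring. unfold F, S1.
  replace (m + 2)%nat with (S (S m)) by lia. replace (m + 1)%nat with (S m) by lia. fold n1 n2.
  rewrite (csum_ext (fun k => RtoC ((-1) ^ k / INR (k + 1) * Binomial.C m k) * t ^ (m - k) * g zeta
    (S k) (a + t))%C
    (fun k => RtoC ((-1) ^ k / INR (k + 1) * Binomial.C m k) * t ^ (m - k) * g zeta (k + 1) (a +
      t))%C).
  - unfold csum, Cdiv. ring.
  - intros k _. replace (k + 1)%nat with (S k) by lia. reflexivity. }
rewrite <- E0, <- Et.
revert Hint. apply cint_ext. intros u _. cbv beta. replace (t - 0)%C with t by ring. ring.
Qed.
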